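(* Let $B$ be a closed, oriented manifold of dimension $2n$. If the trivial principal $S^1$-bundle over $B$ admits an $S^1$-invariant contact structure with dividing set $\Gamma\subset B$, then every principal $S^1$-bundle over $B$ admits an $S^1$-invariant contact structure with dividing set $\Gamma$.
   Context: For a principal $S^1$-bundle $\pi\colon M\to B$, $\partial_\theta$ denotes the vector field on $M$ generating the $S^1$-action. $M$ is oriented so that $\psi\wedge\pi^*\mathrm{vol}_B>0$ for any $S^1$-invariant $1$-form $\psi$ with $\psi(\partial_\theta)\equiv1$. Contact structures on $M$ are cooriented, $\xi=\ker\alpha$, and positive, $\alpha\wedge(d\alpha)^n>0$. For an $S^1$-invariant contact structure $\xi=\ker\alpha$ on $M$ with $\alpha$ an $S^1$-invariant contact form, the $S^1$-invariant function $u=\alpha(\partial_\theta)$ descends to $B$, and the dividing set of $B$ induced by $\xi$ is $\{p\in B: u(p)=0\}$. *)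

(* Defs.v *)
From mathcomp Require Import all_boot all_order all_algebra all_fingroup.
From mathcomp Require Import ring.
From mathcomp Require Import all_classical all_reals all_analysis.

Set Implicit Arguments.
Unset Strict Implicit.
Unset Printing Implicit Defensive.

Import Order.TTheory GRing.Theory Num.Theory.
Import numFieldNormedType.Exports.

Local Open Scope classical_set_scope.
Local Open Scope ring_scope.

(** * Smooth maps between finite-dimensional normed spaces *)

(* Directional derivatives in all directions stand for all partial
   derivatives; [U] is open in every use. *)
Fixpoint Ck (R : realType) (V W : normedModType R) (k : nat) (U : set V)
    (f : V -> W) : Prop :=
  if k is k'.+1 then
    (forall x, U x -> differentiable f x) /\
    (forall v, Ck k' U (fun x => 'D_v f x))
  else forall x, U x -> {for x, continuous f}.

Definition smooth (R : realType) (V W : normedModType R) (U : set V)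
    (f : V -> W) : Prop := forall k, Ck k U f.

(** * Manifolds *)

(* A topological space with, for each point [p], a preferred chart
   [crd p : chart_dom p -> 'rV_m] around [p], with inverse [par p].  The tangent
   space at [p] is ['rV_m], a tangent vector being given by its components in
   the preferred chart at [p].  [crd p] and [par p] are total functions,
   meaningful on [chart_dom p] and [chart_tgt p] only; the axioms are in
   [is_manifold]. *)
Record mfd (R : realType) (m : nat) := Mfd {
  mfd_pt :> topologicalType;
  chart_dom : mfd_pt -> set mfd_pt;
  crd : mfd_pt -> mfd_pt -> 'rV[R]_m;
  par : mfd_pt -> 'rV[R]_m -> mfd_pt }.

Definition chart_tgt (R : realType) m (M : mfd R m) (p : M) : set 'rV[R]_m :=
  crd p @` chart_dom p.

Record is_manifold (R : realType) m (M : mfd R m) : Prop := IsManifold {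
  mfd_hausdorff : hausdorff_space M;
  mfd_second_countable : @second_countable M;
  mfd_dom : forall p : M, chart_dom p p;
  mfd_dom_open : forall p : M, open (chart_dom p);
  mfd_tgt_open : forall p : M, open (chart_tgt p);
  mfd_crdK : forall p q : M, chart_dom p q -> par p (crd p q) = q;
  mfd_crd_continuous : forall p q : M, chart_dom p q -> {for q, continuous (crd p)};
  mfd_par_continuous : forall (p : M) y, chart_tgt p y -> {for y, continuous (par p)};
  mfd_transition : forall p q : M,
    smooth (chart_tgt p `&` par p @^-1` chart_dom q) (crd q \o par p) }.

(* Smoothness of [F] on the open set [A]. *)
Definition msmooth (R : realType) m l (M : mfd R m) (N : mfd R l) (A : set M)
    (F : M -> N) : Prop :=
  (forall x, A x -> {for x, continuous F}) /\
  (forall (p : M) (q : N),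
    smooth (chart_tgt p `&` par p @^-1` (A `&` F @^-1` chart_dom q)) (crd q \o F \o par p)).

Definition mdiff (R : realType) m l (M : mfd R m) (N : mfd R l) (F : M -> N)
    (p : M) (v : 'rV[R]_m) : 'rV[R]_l :=
  'D_v (crd (F p) \o F \o par p) (crd p p).

(* [F] restricts to a diffeomorphism from the open set [A] onto the open set
   [C], with inverse [G]. *)
Record diffeo_on (R : realType) m l (M : mfd R m) (N : mfd R l)
    (A : set M) (C : set N) (F : M -> N) (G : N -> M) : Prop := DiffeoOn {
  diffeo_smooth : msmooth A F;
  diffeo_inv_smooth : msmooth C G;
  diffeo_fun : forall x, A x -> C (F x);
  diffeo_inv_fun : forall y, C y -> A (G y);
  diffeo_K : forall x, A x -> G (F x) = x;
  diffeo_inv_K : forall y, C y -> F (G y) = y }.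

Definition mprod (R : realType) m l (M : mfd R m) (N : mfd R l) :
    mfd R (m + l) :=
  @Mfd R (m + l) (M * N)%type
    (fun p => chart_dom p.1 `*` chart_dom p.2)
    (fun p q => row_mx (crd p.1 q.1) (crd p.2 q.2))
    (fun p y => (par p.1 (lsubmx y), par p.2 (rsubmx y))).

(** * The circle, as the group of unit complex numbers [z.1 + i z.2] *)

Definition circle_set (R : realType) : set (R * R) :=
  [set z | z.1 ^+ 2 + z.2 ^+ 2 = 1].

Notation circle R := (set_type (@circle_set R)).

Definition mk_circle (R : realType) (a b : R) (h : a ^+ 2 + b ^+ 2 = 1) :
    circle R :=
  exist _ (a, b) (mem_set h).

Lemma circleP (R : realType) (z : circle R) :
  (val z).1 ^+ 2 + (val z).2 ^+ 2 = 1.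
Proof. by case: z => z /= /set_mem. Qed.

Lemma circle_one_subproof (R : realType) : (1 : R) ^+ 2 + 0 ^+ 2 = 1.
Proof. by ring. Qed.

Definition circle_one (R : realType) : circle R :=
  mk_circle (circle_one_subproof R).

Lemma circle_mul_subproof (R : realType) (z w : circle R) :
  ((val z).1 * (val w).1 - (val z).2 * (val w).2) ^+ 2 +
  ((val z).1 * (val w).2 + (val z).2 * (val w).1) ^+ 2 = 1.
Proof.
transitivity (((val z).1 ^+ 2 + (val z).2 ^+ 2) *
              ((val w).1 ^+ 2 + (val w).2 ^+ 2)); first by ring.
by rewrite !circleP mulr1.
Qed.

Definition circle_mul (R : realType) (z w : circle R) : circle R :=
  mk_circle (circle_mul_subproof z w).

Definition cis (R : realType) (t : R) : circle R := mk_circle (cos2Dsin2 t).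

Lemma circle_stereo_subproof (R : realType) (s : R) :
  ((1 - s ^+ 2) / (1 + s ^+ 2)) ^+ 2 + (2 * s / (1 + s ^+ 2)) ^+ 2 = 1.
Proof.
have s0 : 1 + s ^+ 2 != 0 by rewrite gt_eqF// ltr_pwDl// sqr_ge0.
by field.
Qed.

(* The chart around [p] is stereographic projection from [-p]:
   [p * e^(i t)] has coordinate [tan (t / 2) = sin t / (1 + cos t)]. *)
Definition mcircle (R : realType) : mfd R 1 :=
  @Mfd R 1 (circle R)
    (fun p => [set z | (val p).1 * (val z).1 + (val p).2 * (val z).2 != - 1])
    (fun p z => const_mx
      (((val p).1 * (val z).2 - (val p).2 * (val z).1) /
       (1 + ((val p).1 * (val z).1 + (val p).2 * (val z).2))))
    (fun p y => circle_mul p (mk_circle (circle_stereo_subproof (y 0 0)))).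

(** * Differential forms *)

Definition dform (R : realType) k m (M : mfd R m) : Type :=
  M -> ('I_k -> 'rV[R]_m) -> R.

Definition slot_linear (R : realType) k m (w : ('I_k -> 'rV[R]_m) -> R) : Prop :=
  forall (v : 'I_k -> 'rV[R]_m) (i : 'I_k) (a : R) (x y : 'rV[R]_m),
    let put z := fun j => if j == i then z else v j in
    w (put (a *: x + y)) = a * w (put x) + w (put y).

Definition slot_alternating (R : realType) k m (w : ('I_k -> 'rV[R]_m) -> R) : Prop :=
  forall (v : 'I_k -> 'rV[R]_m) (i j : 'I_k), i != j -> v i = v j -> w v = 0.

(* The expression of [w] in the chart [crd p], i.e. its pullback by [par p]. *)
Definition in_chart (R : realType) k m (M : mfd R m) (w : dform k M) (p : M)
    (y : 'rV[R]_m) (v : 'I_k -> 'rV[R]_m) : R :=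
  w (par p y) (fun i => 'D_(v i) (crd (par p y) \o par p) y).

Record is_form (R : realType) k m (M : mfd R m) (w : dform k M) : Prop := IsForm {
  form_linear : forall p : M, slot_linear (w p);
  form_alternating : forall p : M, slot_alternating (w p);
  form_smooth : forall (p : M) (v : 'I_k -> 'rV[R]_m),
    smooth (W := R^o) (chart_tgt p) (fun y => in_chart w p y v) }.

Definition pullf (R : realType) k m l (M : mfd R m) (N : mfd R l)
    (F : M -> N) (w : dform k N) : dform k M :=
  fun p v => w (F p) (fun i => mdiff F p (v i)).

Definition wedgef (R : realType) k l m (M : mfd R m)
    (w : dform k M) (t : dform l M) : dform (k + l) M :=
  fun p v => (k`!%:R * l`!%:R)^-1 *
    \sum_(s : {perm 'I_(k + l)}) (-1) ^+ s *
      w p (fun i => v (s (lshift l i))) * t p (fun j => v (s (rshift k j))).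

Fixpoint wedgef_exp (R : realType) k m (M : mfd R m) (w : dform k M) (n : nat) :
    dform (n * k) M :=
  if n is n'.+1 then wedgef w (@wedgef_exp R k m M w n') else fun _ _ => 1.

Arguments wedgef_exp {R k m M} w n : rename.

(* [d w (v_0, .., v_k) = \sum_i (-1)^i D_{v_i} (w (v_0, .., ^v_i, .., v_k))]
   for constant vector fields [v_i] in the chart at [p]. *)
Definition ext_d (R : realType) k m (M : mfd R m) (w : dform k M) :
    dform k.+1 M :=
  fun p v => \sum_(i < k.+1) (-1) ^+ i *
    'D_(v i) (fun y => in_chart w p y (fun j => v (lift i j)) : R^o) (crd p p).

Definition is_volume_form (R : realType) m (M : mfd R m) (vol : dform m M) : Prop :=
  is_form vol /\ forall p : M, exists v, vol p v <> 0.

(** * Principal circle bundles *)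

Record bundle (R : realType) m (B : mfd R m) := Bundle {
  btot :> mfd R (m + 1);
  bproj : btot -> B;
  bact : btot -> circle R -> btot }.

Definition trivial_bundle (R : realType) m (B : mfd R m) : bundle B :=
  @Bundle R m B (mprod B (mcircle R)) fst (fun x z => (x.1, circle_mul x.2 z)).

Record is_principal_bundle (R : realType) m (B : mfd R m) (P : bundle B) :
    Prop := IsPrincipalBundle {
  bundle_manifold : is_manifold P;
  bundle_proj_smooth : msmooth setT (@bproj R m B P);
  bundle_act_smooth :
    msmooth (M := mprod P (mcircle R)) (N := P) setT (fun xz => bact xz.1 xz.2);
  bundle_act1 : forall x : P, bact x (circle_one R) = x;
  bundle_actM : forall (x : P) z w, bact (bact x z) w = bact x (circle_mul z w);
  bundle_proj_act : forall (x : P) z, bproj (bact x z) = bproj x;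
  bundle_local_triv : forall b : B, exists U : set B, [/\ open U, U b &
    exists (Phi : P -> trivial_bundle B) (Psi : trivial_bundle B -> P),
      diffeo_on (@bproj R m B P @^-1` U) (@bproj R m B (trivial_bundle B) @^-1` U)
        Phi Psi /\
      forall x : P, U (bproj x) ->
        bproj (Phi x) = bproj x /\ forall z, Phi (bact x z) = bact (Phi x) z] }.

Definition dtheta (R : realType) m (B : mfd R m) (P : bundle B) (x : P) :
    'rV[R]_(m + 1) :=
  derive1 (fun t : R => crd x (bact x (cis t))) 0.

Definition invariant_form (R : realType) k m (B : mfd R m) (P : bundle B)
    (w : dform k P) : Prop :=
  forall z, pullf (fun x : P => bact x z) w = w.

(** * Contact structures on circle bundles over a [2n]-dimensional base *)

Record connection_form (R : realType) m (B : mfd R m) (P : bundle B)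
    (psi : dform 1 P) : Prop := ConnectionForm {
  connection_is_form : is_form psi;
  connection_invariant : invariant_form psi;
  connection_dtheta : forall x : P, psi x (fun _ => dtheta x) = 1 }.

(* Orientation of the total space induced by the orientation [vol] of [B]. *)
Definition positive_frame (R : realType) m (B : mfd R m) (vol : dform m B)
    (P : bundle B) (x : P) (v : 'I_(1 + m) -> 'rV[R]_(m + 1)) : Prop :=
  forall psi : dform 1 P, connection_form psi ->
    0 < wedgef psi (pullf (@bproj R m B P) vol) x v.

Definition contact_form (R : realType) n (B : mfd R (n * 2))
    (vol : dform (n * 2) B) (P : bundle B) (alpha : dform 1 P) : Prop :=
  is_form alpha /\
  forall (x : P) v, positive_frame vol x v ->
    0 < wedgef alpha (wedgef_exp (ext_d alpha) n) x v.

(* [xi x] is the set of tangent vectors at [x] that lie in the distribution. *)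
Definition distribution (R : realType) m (M : mfd R m) : Type :=
  M -> set 'rV[R]_m.

Definition ker_form (R : realType) m (M : mfd R m) (alpha : dform 1 M) :
    distribution M :=
  fun x => [set w | alpha x (fun _ => w) = 0].

Definition contact_structure (R : realType) n (B : mfd R (n * 2))
    (vol : dform (n * 2) B) (P : bundle B) (xi : distribution P) : Prop :=
  exists2 alpha : dform 1 P, contact_form vol alpha & xi = ker_form alpha.

Definition invariant_distribution (R : realType) m (B : mfd R m) (P : bundle B)
    (xi : distribution P) : Prop :=
  forall z (x : P), mdiff (fun x' : P => bact x' z) x @` xi x = xi (bact x z).

(* [Gamma] is the dividing set induced by [xi]: the zero set in [B] of the
   function [u (bproj x) = alpha (dtheta x)], for an invariant contact form
   [alpha] defining [xi]. *)
Definition dividing_set (R : realType) n (B : mfd R (n * 2))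
    (vol : dform (n * 2) B) (P : bundle B) (xi : distribution P)
    (Gamma : set B) : Prop :=
  exists (alpha : dform 1 P) (u : B -> R),
    [/\ contact_form vol alpha, invariant_form alpha, xi = ker_form alpha,
        forall x : P, u (bproj x) = alpha x (fun _ => dtheta x) &
        Gamma = [set p | u p = 0]].

Definition admits_contact_with_dividing_set (R : realType) n
    (B : mfd R (n * 2)) (vol : dform (n * 2) B) (P : bundle B)
    (Gamma : set B) : Prop :=
  exists xi : distribution P,
    [/\ contact_structure vol xi, invariant_distribution xi &
        dividing_set vol xi Gamma].

(* Main.v *)
Require Import Defs.
From mathcomp Require Import all_boot all_order all_algebra all_fingroup.
From mathcomp Require Import ring lra.
From mathcomp Require Import all_classical all_reals all_analysis.

Set Implicit Arguments.
Unset Strict Implicit.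
Unset Printing Implicit Defensive.

Import Order.TTheory GRing.Theory Num.Theory.
Import numFieldNormedType.Exports.

Local Open Scope classical_set_scope.
Local Open Scope ring_scope.

(* On the trivial bundle an invariant contact form is [beta + u dtheta] with
   [beta] and [u] on [B].  Given a connection form [psi] on [P], consider
   [alpha_e = pi^* beta + e u psi] for [e > 0]; its dividing set is again
   [u = 0].  With [d psi = pi^* F] and the vertical coordinate rescaled by [e],
   [alpha_e] and [d alpha_e] become [beta + u t] and
   [d beta + du /\ t + e u F], so that at [e = 0] the contact condition is the
   one of the trivial bundle.  By compactness of [B] it holds on [P] for all
   small [e].  Smooth bump functions glue the local connection forms [dtheta]
   to the global [psi]. *)

(** * Differential calculus *)

(** A connection form and a chart [q] of the base split each tangent space of [P] by sending [v] to
    the pair of [psi v] and the derivative of [crd q \o proj] along [v]. In this splitting the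
    contact condition becomes a coefficient times a determinant. The coefficient depends on [e] and
    on the base point alone, not on the point of the fibre, which is why compactness of $B$ controls
    all of [P]. Its sign is compared with that of the orientation form, written in the same chart
    and the same splitting.

    The obstacle is the curvature: $e\,u\,F$ has no definite sign and in general cannot be removed
    by another choice of [psi], so it is made small. The price is one factor [e] in the determinant,
    harmless because [e > 0]. $F$ enters only locally, as $dA$ for a potential $A$ on an open set of
    the base.

    In the gluing, normalisation comes last: a sum of local connection forms weighted by bump
    functions is invariant and takes a function of the base point as value on the generator; once
    that function is positive, dividing by it gives a connection form. *)

Section calculus.
Context {R : realType}.
Implicit Types V W : normedModType R.

(** [g] is [f] plus a function that vanishes near [x], and the latter has differential 0 straight
    from the definition. *)
Lemma near_eq_differentiable V W (f g : V -> W) x :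
  (\near x, f x = g x) -> differentiable f x -> differentiable g x.
Proof.
move=> fg df; have fgx : f x = g x by exact: (@nbhs_singleton V x (fun y => f y = g y)).
suff dz : differentiable (g - f) x.
  have -> : g = (g - f) + f by apply/funext => y; rewrite /= /GRing.add/=/GRing.opp/= subrK.
  exact: differentiableD.
suff H : (g - f) \o shift x = cst ((g - f) x) + (\0 : {linear V -> W}) +o_ (0 : V) id.
  apply/diff_locallyP; rewrite (diff_unique _ H)//; last exact: cst_continuous.
  by split => //; exact: cst_continuous.
apply/eqaddoP => _/posnumP[e]; near=> h.
rewrite !fctE /= fgx subrr add0r -[X in `|_ - X|]/(0 : W) subr0.
have -> : f (h + x) = g (h + x).
  near: h; move: fg; rewrite (near_shift 0 x) /= => fg.
  by apply: filterS fg => h /=; rewrite subr0.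
by rewrite subrr normr0 mulr_ge0.
Unshelve. all: by end_near. Qed.

Lemma Ck_eq V W k (U : set V) (f g : V -> W) : open U ->
  (forall x, U x -> f x = g x) -> Ck k U f -> Ck k U g.
Proof.
move=> oU; elim: k f g => [|k IH] f g fg /=.
  move=> cf x Ux; rewrite /prop_for/continuous_at -(fg x Ux).
  apply: cvg_trans (cf x Ux); apply: near_eq_cvg.
  by near=> y; rewrite fg//; near: y; exact: open_nbhs_nbhs.
have nfg x : U x -> \near x, f x = g x.
  by move=> Ux; near=> y; apply: fg; near: y; exact: open_nbhs_nbhs.
move=> [df cf]; split=> [x Ux|v].
  exact: near_eq_differentiable (nfg _ Ux) (df x Ux).
apply: IH (cf v) => x Ux; exact: near_eq_derive (nfg _ Ux).
Unshelve. all: by end_near. Qed.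

(** All conditions in [Ck] are stated at points of [U] inside the ambient space, never relative to
    [U], so they can be checked one point at a time. Restriction and patching follow. *)
Lemma Ck_point V W k (U : set V) (f : V -> W) :
  Ck k U f <-> forall x, U x -> Ck k [set x] f.
Proof.
elim: k f => [|k IH] f /=.
  by split=> [cf x Ux _ ->|cf x Ux]; [exact: cf|exact: cf Ux _ erefl].
split=> [[df cf] x Ux|H]; first split=> [_ ->|v]; first exact: df.
  by move/IH : (cf v); exact.
split=> [x Ux|v]; first by have [/(_ _ erefl)] := H x Ux.
by apply/IH => x Ux; have [_ /(_ v)] := H x Ux.
Qed.

Lemma Ck_sub V W k (A U : set V) (f : V -> W) : A `<=` U -> Ck k U f -> Ck k A f.
Proof. by move=> AU /Ck_point H; apply/Ck_point => x /AU; exact: H. Qed.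

Lemma CkS V W k (U : set V) (f : V -> W) : Ck k.+1 U f -> Ck k U f.
Proof.
elim: k f => [|k IH] f /=; first by move=> [df _] x /df; exact: differentiable_continuous.
by move=> [df H]; split=> // v; exact: IH.
Qed.

Lemma CkD V W k (U : set V) (f g : V -> W) : open U ->
  Ck k U f -> Ck k U g -> Ck k U (fun x => f x + g x).
Proof.
move=> oU; elim: k f g => [|k IH] f g /=.
  by move=> cf cg x Ux; apply: cvgD; [exact: cf|exact: cg].
move=> [df cf] [dg cg]; split=> [x Ux|v]; first exact: differentiableD (df _ Ux) (dg _ Ux).
apply: Ck_eq (IH _ _ (cf v) (cg v)) => // x Ux.
by rewrite deriveD//; apply: diff_derivable; [exact: df|exact: dg].
Qed.

Lemma Ck_cst V W k (U : set V) (c : W) : Ck k U (fun=> c).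
Proof.
elim: k c => [|k IH] c /=; first by move=> x _; exact: cvg_cst.
split=> [x _|v]; first exact: differentiable_cst.
by under eq_fun do rewrite derive_cst; exact: IH.
Qed.

Lemma CkM V k (U : set V) (f g : V -> R^o) : open U ->
  Ck k U f -> Ck k U g -> Ck k U (fun x => f x * g x : R^o).
Proof.
move=> oU; elim: k f g => [|k IH] f g.
  by move=> cf cg x Ux; apply: (@cvgM R _ (nbhs x)); [exact: cf|exact: cg].
move=> cf cg; move: (CkS cf) (CkS cg) => cf' cg'.
case: cf cg => df cf [dg cg]; split=> [x Ux|v].
  by apply: (@differentiableM _ _ f g); [exact: df|exact: dg].
apply: Ck_eq (CkD oU (IH _ _ cf' (cg v)) (IH _ _ cg' (cf v))) => // x Ux.
by rewrite (@deriveM _ _ f g)//; apply: diff_derivable; [exact: df|exact: dg].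
Qed.

(** The derivative of [f^-1] contains [f^-1] again, and the induction hypothesis covers that factor
    one order lower. *)
Lemma CkV V k (U : set V) (f : V -> R^o) : open U ->
  (forall x, U x -> f x != 0) -> Ck k U f -> Ck k U (fun x => (f x)^-1 : R^o).
Proof.
move=> oU f0; elim: k => [|k IH].
  by move=> cf x Ux; apply: (@cvgV R _ (nbhs x)); [exact: f0|exact: cf].
move=> cf; have ci := IH (CkS cf); case: cf => df cf; split=> [x Ux|v].
  by apply: (@differentiableV _ _ f); [exact: df|exact: f0].
have cm : Ck k U (fun=> -1 : R^o) by exact: Ck_cst.
apply: Ck_eq (CkM oU (CkM oU cm (CkM oU ci ci)) (cf v)) => // x Ux.
rewrite (@deriveV _ _ f)//; [|exact: f0|apply: diff_derivable; exact: df].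
by rewrite -exprVn expr2 mulN1r.
Qed.

Lemma Ck_scalel V W k (U : set V) (f : V -> R^o) (w : W) : open U ->
  Ck k U f -> Ck k U (fun x => f x *: w).
Proof.
move=> oU; elim: k f => [|k IH] f.
  by move=> cf x Ux; apply: cvgZr_tmp; exact: cf.
move=> [df cf]; split=> [x Ux|v]; first by apply: differentiableZl; exact: df.
apply: Ck_eq (IH _ (cf v)) => // x Ux; have dfx := df x Ux.
by rewrite [RHS]deriveE; [rewrite diffZl// deriveE|exact: differentiableZl].
Qed.

Lemma derive_rV V n (f : V -> 'rV[R]_n) x v j : differentiable f x ->
  'D_v f x 0 j = 'D_v (fun y => f y 0 j : R^o) x.
Proof. by move=> df; rewrite derive_mx ?mxE//; exact: diff_derivable. Qed.

Lemma Ck_coord V n k (U : set V) (f : V -> 'rV[R]_n) j : open U ->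
  Ck k U f -> Ck k U (fun x => f x 0 j : R^o).
Proof.
move=> oU; elim: k f => [|k IH] f /=.
  move=> cf x Ux; apply: (@continuous_comp _ _ _ f (fun M : 'rV[R]_n => M 0 j : R^o)).
    exact: cf.
  exact: coord_continuous.
move=> [df cf]; split=> [x Ux|v].
  apply: (@differentiable_comp _ _ _ _ f (fun M : 'rV[R]_n => M 0 j : R^o)).
    exact: df.
  exact: differentiable_coord.
by apply: Ck_eq (IH _ (cf v)) => // x Ux; rewrite derive_rV//; exact: df.
Qed.

Lemma derive_comp (U V W : normedModType R) (g : U -> V) (f : V -> W) x v :
  differentiable g x -> differentiable f (g x) ->
  'D_v (f \o g) x = 'D_('D_v g x) f (g x).
Proof.
move=> dg df; rewrite deriveE; last exact: differentiable_comp.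
by rewrite diff_comp//= -deriveE// -deriveE.
Qed.

Lemma derive_delta m (f : 'rV[R]_m -> R^o) x v : differentiable f x ->
  'D_v f x = \sum_j v 0 j * 'D_(delta_mx 0 j) f x.
Proof.
move=> df; rewrite deriveE// [in LHS](row_sum_delta v) linear_sum.
by apply: eq_bigr => j _; rewrite linearZ/= -deriveE.
Qed.

(** By the chain rule in coordinates, ['D_v (f \o g)] is a sum of products of a coordinate of
    ['D_v g] with a partial derivative of [f] composed with [g]; the induction hypothesis applies to
    the latter composite. *)
Lemma Ck_comp V m k (U : set V) (O : set 'rV[R]_m) (f : 'rV[R]_m -> R^o)
    (g : V -> 'rV[R]_m) : open U -> open O -> (forall x, U x -> O (g x)) ->
  Ck k O f -> Ck k U g -> Ck k U (f \o g).
Proof.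
move=> oU oO UO; elim: k f g UO => [|k IH] f g UO.
  by move=> cf cg x Ux; apply: continuous_comp; [exact: cg|exact/cf/UO].
move=> cf cg; have cg' := CkS cg; case: cf cg => df cf [dg cg]; split=> [x Ux|v].
  by apply: differentiable_comp; [exact: dg|exact/df/UO].
have dfg x : U x -> 'D_v (f \o g) x =
    \sum_(j <- index_enum 'I_m) 'D_v g x 0 j * 'D_(delta_mx 0 j) f (g x).
  by move=> Ux; rewrite derive_comp -?derive_delta//; [exact/df/UO|exact: dg|exact/df/UO].
apply: Ck_eq => [//|x Ux|]; first by rewrite dfg.
elim: (index_enum _) => [|j s IHs].
  by under eq_fun do rewrite big_nil; exact: Ck_cst.
under eq_fun do rewrite big_cons; apply: CkD => //.
apply: (@CkM _ k U (fun x => 'D_v g x 0 j) (fun x => 'D_(delta_mx 0 j) f (g x))) => //.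
  exact: (@Ck_coord _ _ k U ('D_v g) j oU (cg v)).
exact: (IH _ _ UO (cf _) cg').
Qed.

Lemma near_open_nbhs (T : topologicalType) (x : T) (P : T -> Prop) :
  (\forall y \near x, P y) -> exists2 A, open_nbhs x A & forall y, A y -> P y.
Proof. by move=> H; have := H : nbhs x P; rewrite nbhsE => -[A ? ?]; exists A. Qed.

Lemma near_continuous (S T : topologicalType) (f : S -> T) (x : S) (P : T -> Prop) :
  {for x, continuous f} -> (\forall z \near f x, P z) -> \forall y \near x, P (f y).
Proof. by move=> cf; exact: cf. Qed.

Lemma near_all (T : topologicalType) (x : T) (P : T -> Prop) :
  (forall y, P y) -> \forall y \near x, P y.
Proof. by move=> H; exact: nearW. Qed.

Lemma near_and (T : topologicalType) (x : T) (P Q : T -> Prop) :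
  (\forall y \near x, P y) -> (\forall y \near x, Q y) ->
  \forall y \near x, P y /\ Q y.
Proof. by move=> Px Qx; apply: filterI. Qed.

(** One neighbourhood serves all orders of differentiation, which makes this an open condition on
    [x]. *)
Definition smooth_at V W (f : V -> W) (x : V) : Prop :=
  exists2 U, open_nbhs x U & smooth U f.

Lemma smooth_smooth_at V W (U : set V) (f : V -> W) x :
  open U -> U x -> smooth U f -> smooth_at f x.
Proof. by move=> oU Ux sf; exists U. Qed.

Lemma smooth_at_smooth V W (U : set V) (f : V -> W) :
  (forall x, U x -> smooth_at f x) -> smooth U f.
Proof.
move=> fU k; apply/(Ck_point k U f) => x Ux; have [A [_ Ax] sf] := fU x Ux.
by apply: Ck_sub (sf k) => _ ->.
Qed.

Lemma near_smooth_at V W (f : V -> W) x :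
  smooth_at f x -> \near x, smooth_at f x.
Proof. by move=> [U [oU Ux] sf]; apply: filterS (open_nbhs_nbhs (conj oU Ux)) => y Uy; exists U. Qed.

Lemma smooth_at_eq V W (f g : V -> W) x : (\near x, f x = g x) ->
  smooth_at f x -> smooth_at g x.
Proof.
move=> /near_open_nbhs[A [oO Ax] fg] [U [oU Ux] sf]; exists (U `&` A).
  by split=> //; exact: openI.
move=> k; apply: (@Ck_eq _ _ _ _ f); [exact: openI|by move=> y [_ /fg]|].
by apply: Ck_sub (sf k) => y [].
Qed.

Lemma smooth_at_differentiable V W (f : V -> W) x :
  smooth_at f x -> differentiable f x.
Proof. by move=> [U [oU Ux] /(_ 1%N)[df _]]; exact: df. Qed.

Lemma smooth_at_derivable V W (f : V -> W) x v :
  smooth_at f x -> derivable f x v.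
Proof. by move=> /smooth_at_differentiable; exact: diff_derivable. Qed.

Lemma smooth_at_continuous V W (f : V -> W) x :
  smooth_at f x -> {for x, continuous f}.
Proof. by move=> /smooth_at_differentiable; exact: differentiable_continuous. Qed.

Lemma smooth_at_derive V W (f : V -> W) x v :
  smooth_at f x -> smooth_at ('D_v f) x.
Proof. by move=> [U oU sf]; exists U => // k; have [_] := sf k.+1; exact. Qed.

Lemma smooth_at_cst V W (c : W) x : smooth_at (fun=> c : W) (x : V).
Proof. by exists setT => // [|k]; [split => //; exact: openT|exact: Ck_cst]. Qed.

Let smooth_at2 V W W' W'' (f : V -> W) (g : V -> W') (h : V -> W'') x :
  (forall U, open U -> smooth U f -> smooth U g -> smooth U h) ->
  smooth_at f x -> smooth_at g x -> smooth_at h x.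
Proof.
move=> H [U [oU Ux] sf] [A [oO Ax] sg].
have oUO : open (U `&` A) by exact: openI.
exists (U `&` A) => //; apply: H => // k; [apply: Ck_sub (sf k)|apply: Ck_sub (sg k)];
  by move=> ? [].
Qed.

Lemma smooth_atD V W (f g : V -> W) x : smooth_at f x -> smooth_at g x ->
  smooth_at (fun x => f x + g x) x.
Proof. by apply: smooth_at2 => U oU sf sg k; exact: CkD. Qed.

Lemma smooth_at_sum V W I (s : seq I) (f : I -> V -> W) x :
  (forall i, smooth_at (f i) x) -> smooth_at (fun x => \sum_(i <- s) f i x) x.
Proof.
move=> sf; elim: s => [|i s IH].
  by under eq_fun do rewrite big_nil; exact: smooth_at_cst.
by under eq_fun do rewrite big_cons; exact: smooth_atD.
Qed.

Lemma smooth_atM V (f g : V -> R^o) x : smooth_at f x -> smooth_at g x ->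
  smooth_at (fun x => f x * g x : R^o) x.
Proof. by apply: smooth_at2 => U oU sf sg k; exact: CkM. Qed.

Lemma smooth_at_scalel V W (f : V -> R^o) (w : W) x : smooth_at f x ->
  smooth_at (fun x => f x *: w) x.
Proof. by move=> sf; apply: (smooth_at2 _ sf sf) => U oU sf' _ k; exact: Ck_scalel. Qed.

Lemma smooth_atN V (f : V -> R^o) x : smooth_at f x ->
  smooth_at (fun x => - f x : R^o) x.
Proof.
move=> sf; under eq_fun do rewrite -mulN1r.
by apply: smooth_atM => //; exact: smooth_at_cst.
Qed.

Lemma smooth_atB V (f g : V -> R^o) x : smooth_at f x -> smooth_at g x ->
  smooth_at (fun x => f x - g x : R^o) x.
Proof. by move=> sf sg; apply: smooth_atD => //; exact: smooth_atN. Qed.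

Lemma smooth_atV V (f : V -> R^o) x : f x != 0 -> smooth_at f x ->
  smooth_at (fun x => (f x)^-1 : R^o) x.
Proof.
move=> fx0 sf; have cf := smooth_at_continuous sf.
have : \forall y \near x, f y != 0 by exact: (cvgr_neq0 (f x) cf fx0).
move=> /near_open_nbhs[A [oO Ax] f0]; case: sf => U [oU Ux] sf.
have oUO : open (U `&` A) by exact: openI.
exists (U `&` A) => // k; apply: CkV => // [y [_ /f0]//|].
by apply: Ck_sub (sf k) => ? [].
Qed.

Lemma smooth_at_coord V n (f : V -> 'rV[R]_n) j x : smooth_at f x ->
  smooth_at (fun x => f x 0 j : R^o) x.
Proof. by move=> sf; apply: (smooth_at2 _ sf sf) => U oU sf' _ k; exact: Ck_coord. Qed.

Lemma smooth_at_rV V n (f : V -> 'rV[R]_n) x :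
  (forall j, smooth_at (fun x => f x 0 j : R^o) x) -> smooth_at f x.
Proof.
move=> sf; have -> : f = (fun x => \sum_(j <- index_enum 'I_n) f x 0 j *: delta_mx 0 j).
  by apply/funext => y; rewrite [LHS]row_sum_delta.
by apply: smooth_at_sum => j; exact: smooth_at_scalel.
Qed.

Lemma smooth_at_comp V m (f : 'rV[R]_m -> R^o) (g : V -> 'rV[R]_m) x :
  smooth_at g x -> smooth_at f (g x) -> smooth_at (f \o g) x.
Proof.
move=> sg [A [oO Ogx] sf]; have cg := smooth_at_continuous sg.
have : \forall y \near x, A (g y) by apply: cg; exact: open_nbhs_nbhs.
move=> /near_open_nbhs[B [oB Bx] BA]; case: sg => U [oU Ux] sg.
have oUB : open (U `&` B) by exact: openI.
exists (U `&` B) => // k; apply: (@Ck_comp _ _ _ _ A) => //.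
  by move=> y [_ /BA].
by apply: Ck_sub (sg k) => ? [].
Qed.

Lemma smooth_at_comp_rV V m n (f : 'rV[R]_m -> 'rV[R]_n) (g : V -> 'rV[R]_m) x :
  smooth_at g x -> smooth_at f (g x) -> smooth_at (f \o g) x.
Proof.
move=> sg sf; apply: smooth_at_rV => j.
by apply: (@smooth_at_comp _ _ (fun y => f y 0 j : R^o)) => //; exact: smooth_at_coord.
Qed.

Lemma smooth_at_id m (x : 'rV[R]_m) : smooth_at id x.
Proof.
exists setT => //; first by split => //; exact: openT.
case=> [|k]; first by move=> y _; exact: cvg_id.
split=> [y _|v]; first exact: ex_diff.
by under eq_fun do rewrite derive_id; exact: Ck_cst.
Qed.

End calculus.

(** * Symmetry of second derivatives *)

Section mixed_derivatives.
Context {R : realType}.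

Lemma derive_line (V W : normedModType R) (f : V -> W) (p u : V) (s : R) :
  differentiable f (p + s *: u) ->
  is_derive s 1 (fun t => f (p + t *: u)) ('D_u f (p + s *: u)).
Proof.
move=> df; pose g (t : R) : V := p + t *: u.
have idg : is_diff s g ( *:%R^~ u).
  rewrite (_ : *:%R^~ u = 0 + *:%R^~ u); last by rewrite add0r.
  have -> : g = cst p + ( *:%R^~ u) by [].
  exact: is_diffD.
have dg : differentiable g s by exact: ex_diff.
have -> : 'D_u f (p + s *: u) = 'D_1 (f \o g) s.
  have Dg : 'D_1 g s = u by rewrite deriveE// diff_val scale1r.
  by rewrite [RHS]derive_comp// Dg.
suff D : derivable (f \o g) s 1 by exact: (derivableP D).
by apply: diff_derivable; exact: differentiable_comp.
Qed.

(** Two applications of the mean value theorem to the second difference over the parallelogram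
    spanned by [h *: u] and [h *: v]: along [u] for the difference of [f] between opposite sides,
    then along [v] for ['D_u f]. The bound on [h] keeps the parallelogram inside the ball. *)
Lemma mixed_difference (V : normedModType R) (f : V -> R^o) (x u v : V) (r h : R) :
  smooth (ball x r) f -> 0 < h -> h * (`|u| + `|v|) < r ->
  exists2 y, ball x r y &
    f (x + h *: u + h *: v) - f (x + h *: u) - f (x + h *: v) + f x =
    h ^+ 2 * 'D_v ('D_u f) y.
Proof.
move=> sf h0 hr.
have inb s t : 0 <= s <= h -> 0 <= t <= h -> ball x r (x + s *: u + t *: v).
  move=> /andP[s0 sh] /andP[t0 th]; rewrite -ball_normE /ball_/= -addrA opprD addNKr.
  rewrite normrN (le_lt_trans (ler_normD _ _))// (le_lt_trans _ hr)// !normrZ.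
  by rewrite !ger0_norm// mulrDr lerD// ler_wpM2r.
have inb0 s : 0 <= s <= h -> ball x r (x + s *: u).
  by move=> sh; rewrite -[_ + _]addr0 -(scale0r v); apply: inb => //; rewrite lexx ltW.
have dfb y : ball x r y -> differentiable f y by move=> yB; have [df _] := sf 1%N; exact: df.
have ddfb y : ball x r y -> differentiable ('D_u f) y.
  by move=> yB; have [_ /(_ u)[df _]] := sf 2; exact: df.
pose phi (s : R) : R := f (x + h *: v + s *: u) - f (x + s *: u).
have dphi s : 0 <= s <= h ->
    is_derive s 1 phi ('D_u f (x + h *: v + s *: u) - 'D_u f (x + s *: u)).
  move=> sh; apply: is_deriveB; apply: derive_line; apply: dfb; last exact: inb0.
  by rewrite addrAC; apply: inb => //; rewrite lexx ltW.
have [||s + phiE] :=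
  @MVT R phi (fun s => 'D_u f (x + h *: v + s *: u) - 'D_u f (x + s *: u)) 0 h h0.
- by move=> s; rewrite in_itv/= => /andP[s0 sh]; apply: dphi; rewrite !ltW.
- apply: derivable_within_continuous => s; rewrite in_itv/= => /dphi ds.
  exact: ex_derive.
rewrite in_itv/= => /andP[/ltW s0 /ltW sh].
have sh' : 0 <= s <= h by rewrite s0.
pose psi (t : R) : R := 'D_u f (x + s *: u + t *: v).
have dpsi t : 0 <= t <= h -> is_derive t 1 psi ('D_v ('D_u f) (x + s *: u + t *: v)).
  by move=> th; apply: derive_line; apply: ddfb; exact: inb.
have [||t + psiE] :=
  @MVT R psi (fun t => 'D_v ('D_u f) (x + s *: u + t *: v)) 0 h h0.
- by move=> t; rewrite in_itv/= => /andP[t0 th]; apply: dpsi; rewrite !ltW.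
- apply: derivable_within_continuous => t; rewrite in_itv/= => /dpsi dt.
  exact: ex_derive.
rewrite in_itv/= => /andP[/ltW t0 /ltW th].
exists (x + s *: u + t *: v); first by apply: inb => //; rewrite t0.
have E1 : psi h - psi 0 = 'D_v ('D_u f) (x + s *: u + t *: v) * h.
  by rewrite psiE subr0.
have E2 : phi h - phi 0 = (psi h - psi 0) * h.
  by rewrite phiE subr0 /psi scale0r addr0 addrAC.
transitivity (phi h - phi 0); last by rewrite E2 E1; ring.
by rewrite /phi !scale0r !addr0 (addrAC x) opprB addrA [RHS]addrAC.
Qed.

Lemma dist_half_le (p q t e : R) :
  `|p - t| < e / 2 -> `|q - t| < e / 2 -> `|p - q| <= e.
Proof. by move=> pt qt; rewrite ler_norml; move: pt qt; rewrite !ltr_norml; lra. Qed.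

(** The second difference is symmetric in [u] and [v], so by [mixed_difference] the two mixed
    derivatives agree at two points as close to [x] as desired. Their continuity at [x]
    concludes. *)
Lemma derive_sym (V : normedModType R) (f : V -> R^o) (x u v : V) :
  smooth_at f x -> 'D_u ('D_v f) x = 'D_v ('D_u f) x.
Proof.
move=> sfx; have [U [oU Ux] sf] := sfx.
apply/eqP; rewrite -subr_eq0 -normr_le0; apply/ler_addgt0Pl => e e0; rewrite addr0.
have e20 : 0 < e / 2 by rewrite divr_gt0.
have c1 : {for x, continuous ('D_u ('D_v f))}.
  by apply: smooth_at_continuous; do 2!apply: smooth_at_derive.
have c2 : {for x, continuous ('D_v ('D_u f))}.
  by apply: smooth_at_continuous; do 2!apply: smooth_at_derive.
have n1 : nbhs x (('D_u ('D_v f)) @^-1` (ball ('D_u ('D_v f) x : R^o) (e / 2))).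
  by apply: c1; exact: nbhsx_ballx.
have n2 : nbhs x (('D_v ('D_u f)) @^-1` (ball ('D_v ('D_u f) x : R^o) (e / 2))).
  by apply: c2; exact: nbhsx_ballx.
have nn := filterI (filterI n1 n2) (open_nbhs_nbhs (conj oU Ux)).
have [r r0 rP] := (iffLR (nbhs_ballP _ _) (nn _ _)).
have sfr : smooth (ball x r) f.
  by move=> k; apply: Ck_sub (sf k) => y /rP[_].
(* The summand 1 keeps the denominator positive when [u] and [v] vanish and makes the bound on [h]
   strict. *)
pose h := r / (`|u| + `|v| + 1).
have uv1 : 0 < `|u| + `|v| + 1 by rewrite ltr_wpDl// addr_ge0.
have h0 : 0 < h by rewrite divr_gt0.
have hr : h * (`|u| + `|v|) < r.
  by rewrite /h mulrAC ltr_pdivrMr// ltr_pM2l// ltrDl.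
have [y1 /rP[[_ y1e] _] E1] := mixed_difference sfr h0 hr.
have [y2 /rP[[y2e _] _] E2] := @mixed_difference _ f x v u r h sfr h0 (eq_ind _ (fun a => h * a < r) hr _ (addrC _ _)).
have L : f (x + h *: v + h *: u) - f (x + h *: v) - f (x + h *: u) + f x =
         f (x + h *: u + h *: v) - f (x + h *: u) - f (x + h *: v) + f x.
  by rewrite (addrAC x (h *: v)) (addrAC _ (- f (x + h *: v))).
have E : 'D_u ('D_v f) y2 = 'D_v ('D_u f) y1.
  have h20 : h ^+ 2 != 0 by rewrite expf_neq0// gt_eqF.
  exact: (mulfI h20 (etrans (esym E2) (etrans L E1))).
move: y1e y2e; rewrite /preimage/= -!ball_normE /ball_/= => y1e y2e.
by rewrite E in y2e; exact: (dist_half_le y2e y1e).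
Qed.

End mixed_derivatives.

(** * Rules of derivation for real-valued functions *)

Section real_derivative.
Context {R : realType} {V : normedModType R}.
Implicit Types f g : V -> R.

Definition smooth_fun_at f (x : V) := smooth_at (f : V -> R^o) x.

(* ['D_v] at the codomain [R], so that the arithmetic takes place in [R] and
   not in [R^o]. *)
Definition dderiv f (v x : V) : R := 'D_v (f : V -> R^o) x.

Lemma dderiv_eq f g v x : (\near x, f x = g x) -> dderiv f v x = dderiv g v x.
Proof. by move=> fg; apply: near_eq_derive. Qed.

Lemma dderiv_cst (c : R) v x : dderiv (fun=> c) v x = 0.
Proof. exact: derive_cst. Qed.

Lemma dderivD f g v x : smooth_fun_at f x -> smooth_fun_at g x ->
  dderiv (fun y => f y + g y) v x = dderiv f v x + dderiv g v x.
Proof.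
by move=> sf sg; apply: (@deriveD _ _ R^o f g); exact: smooth_at_derivable.
Qed.

Lemma dderivM f g v x : smooth_fun_at f x -> smooth_fun_at g x ->
  dderiv (fun y => f y * g y) v x = f x * dderiv g v x + g x * dderiv f v x.
Proof.
by move=> sf sg; apply: (@deriveM _ _ f g); exact: smooth_at_derivable.
Qed.

Lemma dderivZ c f v x : smooth_fun_at f x ->
  dderiv (fun y => c * f y) v x = c * dderiv f v x.
Proof.
move=> sf; rewrite dderivM//; last exact: smooth_at_cst.
by rewrite dderiv_cst mulr0 addr0.
Qed.

Lemma dderiv_sum I (s : seq I) (f : I -> V -> R) v x :
  (forall i, smooth_fun_at (f i) x) ->
  dderiv (fun y => \sum_(i <- s) f i y) v x = \sum_(i <- s) dderiv (f i) v x.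
Proof.
move=> sf; elim: s => [|i s IH].
  by under eq_fun do rewrite big_nil; rewrite big_nil dderiv_cst.
under eq_fun do rewrite big_cons; rewrite big_cons dderivD ?IH//.
exact: smooth_at_sum.
Qed.

Lemma dderiv_sym f u v x : smooth_fun_at f x ->
  dderiv (dderiv f v) u x = dderiv (dderiv f u) v x.
Proof. exact: derive_sym. Qed.

Lemma smooth_fun_dderiv f v x : smooth_fun_at f x -> smooth_fun_at (dderiv f v) x.
Proof. exact: smooth_at_derive. Qed.

End real_derivative.

Section real_derivative_comp.
Context {R : realType} {V : normedModType R}.

Lemma dderiv_comp m (f : 'rV[R]_m -> R) (G : V -> 'rV[R]_m) v x :
  smooth_at G x -> smooth_fun_at f (G x) ->
  dderiv (fun y => f (G y)) v x = dderiv f ('D_v G x) (G x).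
Proof.
move=> sG sf; apply: (@derive_comp _ _ _ R^o G f); exact: smooth_at_differentiable.
Qed.

Lemma dderiv_coord n (G : V -> 'rV[R]_n) v x j : smooth_at G x ->
  'D_v G x 0 j = dderiv (fun y => G y 0 j) v x.
Proof. by move=> sG; apply: derive_rV; exact: smooth_at_differentiable. Qed.

End real_derivative_comp.

(** * The differential of a 1-form in a chart *)

Section chart_forms.
Context {R : realType}.

(** [v0] and [v1] are extended as constant vector fields, for which the bracket term of the
    invariant formula for [d] vanishes. *)
Definition chart_d m (w : 'rV[R]_m -> 'rV[R]_m -> R) (y v0 v1 : 'rV[R]_m) : R :=
  dderiv (w^~ v1) v0 y - dderiv (w^~ v0) v1 y.

Lemma chart_d_eq m (w t : 'rV[R]_m -> 'rV[R]_m -> R) y v0 v1 :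
  (\forall z \near y, forall v, w z v = t z v) -> chart_d w y v0 v1 = chart_d t y v0 v1.
Proof.
move=> wt; have E u v : dderiv (w^~ u) v y = dderiv (t^~ u) v y.
  by apply: dderiv_eq; apply: filterS wt => z ->.
by rewrite /chart_d !E.
Qed.

Lemma chart_dD m (w t : 'rV[R]_m -> 'rV[R]_m -> R) y v0 v1 :
  (forall v, smooth_fun_at (w^~ v) y) -> (forall v, smooth_fun_at (t^~ v) y) ->
  chart_d (fun z v => w z v + t z v) y v0 v1 = chart_d w y v0 v1 + chart_d t y v0 v1.
Proof.
move=> sw st; rewrite /chart_d (dderivD _ (sw v1) (st v1)) (dderivD _ (sw v0) (st v0)).
by rewrite opprD addrACA.
Qed.

Lemma chart_dM m (f : 'rV[R]_m -> R) (w : 'rV[R]_m -> 'rV[R]_m -> R) y v0 v1 :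
  smooth_fun_at f y -> (forall v, smooth_fun_at (w^~ v) y) ->
  chart_d (fun z v => f z * w z v) y v0 v1 =
  dderiv f v0 y * w y v1 - dderiv f v1 y * w y v0 + f y * chart_d w y v0 v1.
Proof.
move=> sf sw; rewrite /chart_d (dderivM _ sf (sw v1)) (dderivM _ sf (sw v0)).
ring.
Qed.

Context {m l : nat} (w : 'rV[R]_l -> 'rV[R]_l -> R) (G : 'rV[R]_m -> 'rV[R]_l)
  (y : 'rV[R]_m).
Hypothesis lw : \forall z \near G y, forall v, w z v = \sum_j v 0 j * w z (delta_mx 0 j).
Hypothesis sw : forall v, smooth_fun_at (w^~ v) (G y).
Hypothesis sG : smooth_at G y.

(** The argument ['D_v G z] moves with [z], while [w^~ v] is known to be smooth for fixed [v] only.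
    Expanding in the standard basis separates the two dependences. *)
Lemma pull_near v : \forall z \near y, w (G z) ('D_v G z) =
  \sum_j dderiv (fun z => G z 0 j) v z * w (G z) (delta_mx 0 j).
Proof.
have := near_continuous (smooth_at_continuous sG) lw.
have := near_smooth_at sG; apply: filterS2 => z sz ->.
by apply: eq_bigr => j _; rewrite dderiv_coord.
Qed.

Lemma smooth_coef j : smooth_fun_at (fun z => w (G z) (delta_mx 0 j)) y.
Proof. by apply: (@smooth_at_comp _ _ _ (w^~ (delta_mx 0 j))) => //; exact: sw. Qed.

Lemma smooth_pull_coord v j : smooth_fun_at (dderiv (fun z => G z 0 j) v) y.
Proof. by apply: smooth_fun_dderiv; exact: smooth_at_coord. Qed.

Lemma smooth_pull v : smooth_fun_at (fun z => w (G z) ('D_v G z)) y.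
Proof.
apply: (@smooth_at_eq _ _ R^o (fun z =>
  \sum_j dderiv (fun z => G z 0 j) v z * w (G z) (delta_mx 0 j))).
  by have := pull_near v; apply: filterS => z ->.
apply: smooth_at_sum => j.
exact: (smooth_atM (smooth_pull_coord v j) (smooth_coef j)).
Qed.

Lemma dderiv_pull u v : dderiv (fun z => w (G z) ('D_v G z)) u y =
  \sum_j w (G y) (delta_mx 0 j) * dderiv (dderiv (fun z => G z 0 j) v) u y +
  dderiv (w^~ ('D_v G y)) ('D_u G y) (G y).
Proof.
rewrite (dderiv_eq _ (pull_near v)) dderiv_sum; last first.
  by move=> j; exact: (smooth_atM (smooth_pull_coord v j) (smooth_coef j)).
have -> : dderiv (w^~ ('D_v G y)) ('D_u G y) (G y) =
    \sum_j 'D_v G y 0 j * dderiv (w^~ (delta_mx 0 j)) ('D_u G y) (G y).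
  rewrite (@dderiv_eq _ _ _ (fun z => \sum_j 'D_v G y 0 j * w z (delta_mx 0 j))).
    rewrite dderiv_sum; last first.
      by move=> j; apply: (smooth_atM _ (sw _)); exact: smooth_at_cst.
    by apply: eq_bigr => j _; exact: (dderivZ _ _ (sw _)).
  by have := lw; apply: filterS => z ->.
rewrite -big_split; apply: eq_bigr => j _ /=.
rewrite dderivM; [|exact: smooth_pull_coord|exact: smooth_coef].
rewrite addrC; congr (_ + _).
by rewrite (dderiv_comp _ sG (sw _)) dderiv_coord.
Qed.

(* The second derivatives of [G] cancel by symmetry. *)
Lemma chart_d_pull v0 v1 :
  chart_d (fun z v => w (G z) ('D_v G z)) y v0 v1 =
  chart_d w (G y) ('D_v0 G y) ('D_v1 G y).
Proof.
rewrite /chart_d !dderiv_pull opprD addrACA -[RHS]add0r; congr (_ + _).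
rewrite -sumrB big1// => j _; rewrite dderiv_sym ?subrr//; exact: smooth_at_coord.
Qed.

End chart_forms.

(** * Maps and 1-forms on manifolds *)

Lemma smooth_nbhs (R : realType) (V W : normedModType R) (U : set V) (f : V -> W) x :
  nbhs x U -> smooth U f -> smooth_at f x.
Proof.
move=> /near_open_nbhs[A [oA Ax] AU] sf; exists A => // k.
by apply: Ck_sub (sf k) => y /AU.
Qed.

(** The local part of [is_manifold]: what differentiation asks for, and what is proved below for the
    circle and for products. *)
Record is_atlas (R : realType) m (M : mfd R m) : Prop := IsAtlas {
  atlas_dom : forall p : M, chart_dom p p;
  atlas_dom_open : forall p : M, open (chart_dom p);
  atlas_tgt_open : forall p : M, open (chart_tgt p);
  atlas_crdK : forall p q : M, chart_dom p q -> par p (crd p q) = q;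
  atlas_crd_continuous : forall p q : M, chart_dom p q -> {for q, continuous (crd p)};
  atlas_par_continuous : forall (p : M) y, chart_tgt p y -> {for y, continuous (par p)};
  atlas_transition : forall p q : M,
    smooth (chart_tgt p `&` par p @^-1` chart_dom q) (crd q \o par p) }.

Lemma manifold_atlas (R : realType) m (M : mfd R m) : is_manifold M -> is_atlas M.
Proof. by case=> *; split. Qed.

(** Continuity is a separate condition because [crd q] has arbitrary values off its domain: an
    expression in charts means nothing until [F] is known to stay in the chart. It is asked near [x]
    so that the condition is open. *)
Definition msmooth_at (R : realType) m l (M : mfd R m) (N : mfd R l) (F : M -> N)
    (x : M) : Prop :=
  (\forall x' \near x, {for x', continuous F}) /\
  forall (p : M) (q : N), chart_dom p x -> chart_dom q (F x) ->
    smooth_at (crd q \o F \o par p) (crd p x).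

Definition mfun_smooth_at (R : realType) m (M : mfd R m) (f : M -> R) (x : M) : Prop :=
  forall p : M, chart_dom p x -> smooth_fun_at (f \o par p) (crd p x).

Section atlas.
Context {R : realType} {m : nat} {M : mfd R m}.
Hypothesis aM : is_atlas M.
Implicit Types (p q x : M).

Lemma chart_tgt_crd p x : chart_dom p x -> chart_tgt p (crd p x).
Proof. by exists x. Qed.

Lemma par_dom p y : chart_tgt p y -> chart_dom p (par p y).
Proof. by case=> x px <-; rewrite (atlas_crdK aM). Qed.

Lemma crd_parK p y : chart_tgt p y -> crd p (par p y) = y.
Proof. by case=> x px <-; rewrite (atlas_crdK aM). Qed.

Lemma near_tgt p x : chart_dom p x -> \forall y \near crd p x, chart_tgt p y.
Proof.
move=> px; apply: open_nbhs_nbhs; split; first exact: (atlas_tgt_open aM).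
exact: chart_tgt_crd.
Qed.

Lemma near_dom p x : chart_dom p x -> \forall x' \near x, chart_dom p x'.
Proof.
by move=> px; apply: open_nbhs_nbhs; split => //; exact: (atlas_dom_open aM).
Qed.

Lemma near_par p x (P : M -> Prop) : chart_dom p x -> (\forall x' \near x, P x') ->
  \forall y \near crd p x, P (par p y).
Proof.
move=> px Px; apply: near_continuous; last by rewrite (atlas_crdK aM).
by apply: (atlas_par_continuous aM); exact: chart_tgt_crd.
Qed.

Lemma near_crd p x (P : 'rV[R]_m -> Prop) : chart_dom p x ->
  (\forall y \near crd p x, P y) -> \forall x' \near x, P (crd p x').
Proof.
by move=> px Py; apply: near_continuous => //; exact: (atlas_crd_continuous aM).
Qed.

Lemma transition_at p q x : chart_dom p x -> chart_dom q x ->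
  smooth_at (crd q \o par p) (crd p x).
Proof.
move=> px qx; apply: smooth_nbhs (atlas_transition aM p q).
by apply: filterI; [exact: near_tgt|exact: near_par (near_dom qx)].
Qed.

Lemma mfun_smooth_atP p (f : M -> R) x : chart_dom p x ->
  smooth_fun_at (f \o par p) (crd p x) -> mfun_smooth_at f x.
Proof.
move=> px sf q qx.
apply: (@smooth_at_eq _ _ R^o ((f \o par p) \o (crd p \o par q))).
  by have := near_par qx (near_dom px); apply: filterS => y py; rewrite /= (atlas_crdK aM).
apply: smooth_at_comp; first exact: transition_at.
by rewrite /= (atlas_crdK aM).
Qed.

Lemma mfun_smooth_at_eq (f g : M -> R) x : (\near x, f x = g x) ->
  mfun_smooth_at f x -> mfun_smooth_at g x.
Proof.
move=> fg sf p px; apply: (@smooth_at_eq _ _ R^o (f \o par p)); last exact: sf.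
exact: (near_par px fg).
Qed.

End atlas.

Section smooth_maps.
Context {R : realType} {m l : nat} {M : mfd R m} {N : mfd R l}.
Hypotheses (aM : is_atlas M) (aN : is_atlas N).

Lemma msmooth_continuous (F : M -> N) x : msmooth_at F x -> {for x, continuous F}.
Proof. by case=> cF _; exact: (@nbhs_singleton M x (fun x' => {for x', continuous F})). Qed.

Lemma msmooth_atP p q (F : M -> N) x : chart_dom p x -> chart_dom q (F x) ->
  (\forall x' \near x, {for x', continuous F}) ->
  smooth_at (crd q \o F \o par p) (crd p x) -> msmooth_at F x.
Proof.
move=> px qx cF sF; split => // p' q' px' qx'.
have cFx := nbhs_singleton cF.
apply: (@smooth_at_eq _ _ _
    ((crd q' \o par q) \o (crd q \o F \o par p) \o (crd p \o par p'))).
  have nq : \forall x' \near x, chart_dom q (F x').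
    by apply: near_continuous cFx _; exact: near_dom.
  have := near_par aM px' nq; have := near_par aM px' (near_dom aM px).
  by apply: filterS2 => y py qy; rewrite /= (atlas_crdK aM)// (atlas_crdK aN).
apply: smooth_at_comp_rV; first exact: transition_at.
rewrite /= (atlas_crdK aM)//; apply: smooth_at_comp_rV => //=.
by rewrite (atlas_crdK aM)//; exact: transition_at.
Qed.

Lemma near_msmooth_at (F : M -> N) x : msmooth_at F x ->
  \forall x' \near x, msmooth_at F x'.
Proof.
move=> sF; have [cF sFx] := sF; have xx := atlas_dom aM x; have qx := atlas_dom aN (F x).
have nq : \forall x' \near x, chart_dom (F x) (F x').
  by apply: near_continuous (msmooth_continuous sF) _; exact: near_dom.
have nc := near_join cF.
have ns := near_crd aM xx (near_smooth_at (sFx _ _ xx qx)).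
have nx := near_dom aM xx.
by apply: filterS2 (filterI nc nq) (filterI ns nx) => y [cy qy] [sy xy];
  exact: (msmooth_atP xy qy cy sy).
Qed.

Lemma msmooth_msmooth_at (A : set M) (F : M -> N) x : open A -> A x ->
  msmooth A F -> msmooth_at F x.
Proof.
move=> oA Ax [cF sF]; have nA := open_nbhs_nbhs (conj oA Ax); split.
  by have := nA; apply: filterS => y; exact: cF.
move=> p q px qx; apply: smooth_nbhs (sF p q).
apply: filterI; first exact: near_tgt.
apply: (near_par aM px (P := A `&` F @^-1` chart_dom q)).
by apply: filterI => //; apply: near_continuous (cF _ Ax) _; exact: near_dom.
Qed.

Lemma mfun_smooth_at_comp (f : N -> R) (F : M -> N) x :
  msmooth_at F x -> mfun_smooth_at f (F x) -> mfun_smooth_at (f \o F) x.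
Proof.
move=> sF sf p px; have qx := atlas_dom aN (F x).
apply: (@smooth_at_eq _ _ R^o ((f \o par (F x)) \o (crd (F x) \o F \o par p))).
  have nq : \forall x' \near x, chart_dom (F x) (F x').
    by apply: near_continuous (msmooth_continuous sF) _; exact: near_dom.
  by have := near_par aM px nq; apply: filterS => y qy; rewrite /= (atlas_crdK aN).
apply: smooth_at_comp; first by case: sF => _; exact.
by rewrite /= (atlas_crdK aM)//; exact: sf.
Qed.

End smooth_maps.

Lemma msmooth_at_comp (R : realType) k m l (L : mfd R k) (M : mfd R m) (N : mfd R l)
    (F : L -> M) (G : M -> N) x : is_atlas L -> is_atlas M -> is_atlas N ->
  msmooth_at F x -> msmooth_at G (F x) -> msmooth_at (G \o F) x.
Proof.
move=> aL aM aN sF sG; have cFx := msmooth_continuous sF; case: (sF) => cF dF.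
have nG := near_continuous cFx (near_msmooth_at aM aN sG).
split.
  apply: filterS2 cF nG => y cy sGy; apply: continuous_comp => //.
  exact: msmooth_continuous.
move=> p q px qx; have rx := atlas_dom aM (F x).
apply: (@smooth_at_eq _ _ _ ((crd q \o G \o par (F x)) \o (crd (F x) \o F \o par p))).
  have nr := near_continuous cFx (near_dom aM rx).
  by have := near_par aL px nr; apply: filterS => y ry; rewrite /= (atlas_crdK aM).
apply: smooth_at_comp_rV; first exact: dF.
by rewrite /= (atlas_crdK aL)//; case: sG => _; exact.
Qed.

Lemma msmooth_at_id (R : realType) m (M : mfd R m) (x : M) : is_atlas M -> msmooth_at id x.
Proof.
move=> aM; split; first by apply: nearW => y; exact: cvg_id.
by move=> p q px qx; exact: (transition_at aM px qx).
Qed.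

(** * Differentials of maps between manifolds *)

Section mdiff_theory.
Context {R : realType} {m l : nat} {M : mfd R m} {N : mfd R l}.
Hypotheses (aM : is_atlas M) (aN : is_atlas N).
Implicit Types (F : M -> N).

(** Tangent vectors at [x] are given by components in the chart [crd x]. The inner derivative
    converts components in another chart [p] into these, and the identity is the chain rule. *)
Lemma derive_rep_src F p q x v : msmooth_at F x -> chart_dom p x -> chart_dom q (F x) ->
  'D_('D_v (crd x \o par p) (crd p x)) (crd q \o F \o par x) (crd x x) =
  'D_v (crd q \o F \o par p) (crd p x).
Proof.
move=> [_ sF] px qx; have xx := atlas_dom aM x.
have E : \forall y \near crd p x,
    ((crd q \o F \o par x) \o (crd x \o par p)) y = (crd q \o F \o par p) y.
  have := near_par aM px (near_dom aM xx).
  by apply: filterS => y xy; rewrite /= (atlas_crdK aM).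
rewrite -(near_eq_derive v E) derive_comp.
- by rewrite /= (atlas_crdK aM).
- by apply: smooth_at_differentiable; exact: transition_at.
- by rewrite /= (atlas_crdK aM)//; apply: smooth_at_differentiable; exact: sF.
Qed.

Lemma derive_rep_tgt F p q q' x v : msmooth_at F x -> chart_dom p x ->
  chart_dom q (F x) -> chart_dom q' (F x) ->
  'D_('D_v (crd q \o F \o par p) (crd p x)) (crd q' \o par q) (crd q (F x)) =
  'D_v (crd q' \o F \o par p) (crd p x).
Proof.
move=> sFx px qx q'x; have [_ sF] := sFx.
have E : \forall y \near crd p x,
    ((crd q' \o par q) \o (crd q \o F \o par p)) y = (crd q' \o F \o par p) y.
  have nq := near_continuous (msmooth_continuous sFx) (near_dom aN qx).
  by have := near_par aM px nq; apply: filterS => y qy; rewrite /= (atlas_crdK aN).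
rewrite -(near_eq_derive v E) derive_comp.
- by rewrite /= (atlas_crdK aM).
- by apply: smooth_at_differentiable; exact: sF.
- rewrite /= (atlas_crdK aM)//; apply: smooth_at_differentiable; exact: transition_at.
Qed.

Lemma mdiff_differentiable F x : msmooth_at F x ->
  differentiable (crd (F x) \o F \o par x) (crd x x).
Proof.
move=> [_ sF]; apply: smooth_at_differentiable.
by apply: sF; [exact: atlas_dom|exact: atlas_dom].
Qed.

Lemma mdiffP F x a u v : msmooth_at F x ->
  mdiff F x (a *: u + v) = a *: mdiff F x u + mdiff F x v.
Proof.
by move=> /mdiff_differentiable dF; rewrite /mdiff !deriveE// linearP.
Qed.

Lemma mdiff_eq F G x v : (\near x, F x = G x) -> mdiff F x v = mdiff G x v.
Proof.
move=> FG; have FGx := nbhs_singleton FG; rewrite /mdiff FGx.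
apply: near_eq_derive; have := near_par aM (atlas_dom aM x) FG.
by apply: filterS => y /= ->.
Qed.

End mdiff_theory.

Lemma mdiff_id (R : realType) m (M : mfd R m) (x : M) v : is_atlas M -> mdiff id x v = v.
Proof.
move=> aM; rewrite /mdiff -[RHS](derive_id (crd x x)); apply: near_eq_derive.
have := near_tgt aM (atlas_dom aM x); apply: filterS => y ty.
by rewrite /= (crd_parK aM).
Qed.

Lemma mdiff_comp (R : realType) k m l (L : mfd R k) (M : mfd R m) (N : mfd R l)
    (F : L -> M) (G : M -> N) x v : is_atlas L -> is_atlas M -> is_atlas N ->
  msmooth_at F x -> msmooth_at G (F x) ->
  mdiff (G \o F) x v = mdiff G (F x) (mdiff F x v).
Proof.
move=> aL aM aN sFx sGx; have [_ sF] := sFx; have [_ sG] := sGx.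
have xx := atlas_dom aL x; have rx := atlas_dom aM (F x); have qx := atlas_dom aN (G (F x)).
rewrite /mdiff; set H := crd (G (F x)) \o G \o par (F x).
have E : \forall y \near crd x x,
    (H \o (crd (F x) \o F \o par x)) y = (crd (G (F x)) \o (G \o F) \o par x) y.
  have nr := near_continuous (msmooth_continuous sFx) (near_dom aM rx).
  by have := near_par aL xx nr; apply: filterS => y ry; rewrite /H/= (atlas_crdK aM).
rewrite -(near_eq_derive v E) derive_comp.
- by rewrite /= (atlas_crdK aL).
- by apply: smooth_at_differentiable; exact: sF.
- by rewrite /= (atlas_crdK aL)//; apply: smooth_at_differentiable; exact: sG.
Qed.

(** * 1-forms on manifolds and their differentials *)

Definition chart1 (R : realType) m (M : mfd R m) (w : dform 1 M) (p : M)
    (y v : 'rV[R]_m) : R := in_chart w p y (fun=> v).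

Definition linear1_at (R : realType) m (M : mfd R m) (w : dform 1 M) (x : M) : Prop :=
  forall a u v, w x (fun=> a *: u + v) = a * w x (fun=> u) + w x (fun=> v).

(** Linearity is asked on a neighbourhood because [d] differentiates the coefficients: the expansion
    of the form in the standard basis has to hold at nearby points too. *)
Definition form1_at (R : realType) m (M : mfd R m) (w : dform 1 M) (x : M) : Prop :=
  (\forall x' \near x, linear1_at w x') /\
  forall p, chart_dom p x -> forall v, smooth_fun_at ((chart1 w p)^~ v) (crd p x).

Lemma form1E (R : realType) m (M : mfd R m) (w : dform 1 M) x v :
  w x v = w x (fun=> v 0).
Proof. by congr (w x _); apply/funext => i; rewrite ord1. Qed.

Lemma is_form1P (R : realType) m (M : mfd R m) (w : dform 1 M) :
  is_form w <-> (forall x, linear1_at w x) /\ forall p (v : 'rV[R]_m),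
    smooth (W := R^o) (chart_tgt p) ((chart1 w p)^~ v).
Proof.
split=> [[lw _ sw]|[lw sw]].
  split=> [x a u v|p v]; last exact: sw.
  have E z : w x (fun j => if j == 0 then z else 0) = w x (fun=> z).
    by congr (w x _); apply/funext => j; rewrite ord1 eqxx.
  by have := lw x (fun=> 0) 0 a u v; rewrite /= !E.
split.
- move=> x v i a u u' /=.
  have E z : w x (fun j => if j == i then z else v j) = w x (fun=> z).
    by congr (w x _); apply/funext => j; rewrite (ord1 i) ord1 eqxx.
  by rewrite !E lw.
- by move=> x v i j; rewrite (ord1 i) (ord1 j) eqxx.
- move=> p v; have -> : v = (fun=> v 0) by apply/funext => i; rewrite ord1.
  exact: sw.
Qed.

Section forms1.
Context {R : realType} {m : nat} {M : mfd R m}.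
Hypothesis aM : is_atlas M.
Implicit Types (w : dform 1 M) (x : M).

Lemma is_form1_at w : is_form w <-> (forall x, linear1_at w x) /\ forall x, form1_at w x.
Proof.
rewrite is_form1P; split=> [[lw sw]|[lw sw]]; split => //.
  move=> x; split; first exact: nearW.
  move=> p px v; apply: smooth_nbhs (sw p v); exact: near_tgt.
move=> p v; apply: smooth_at_smooth => y ty.
have [_ /(_ p (par_dom aM ty) v)] := sw (par p y).
by rewrite (crd_parK aM).
Qed.

Lemma linear1_0 w x : linear1_at w x -> w x (fun=> 0) = 0.
Proof.
move=> lw; have := lw (-1) 0 0; rewrite scaler0 addr0 => {1}->.
by rewrite mulN1r addNr.
Qed.

Lemma chart1E w p x v : chart_dom p x ->
  chart1 w p (crd p x) v = w x (fun=> 'D_v (crd x \o par p) (crd p x)).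
Proof. by move=> px; rewrite /chart1/in_chart (atlas_crdK aM). Qed.

Lemma chart1_self w x v : chart1 w x (crd x x) v = w x (fun=> v).
Proof.
rewrite chart1E; last exact: (atlas_dom aM).
by congr (w x _); apply/funext => _; exact: (mdiff_id x v aM).
Qed.

Lemma chart1_sum w p x : chart_dom p x -> (\forall x' \near x, linear1_at w x') ->
  \forall y \near crd p x, forall v,
    chart1 w p y v = \sum_j v 0 j * chart1 w p y (delta_mx 0 j).
Proof.
move=> px lw; have := near_par aM px lw; have := near_tgt aM px.
apply: filterS2 => y ty lwy v.
have dy : differentiable (crd (par p y) \o par p) y.
  rewrite -[X in differentiable _ X](crd_parK aM ty); apply: smooth_at_differentiable.
  by apply: (transition_at aM); [exact: par_dom|exact: (atlas_dom aM)].
have lc : forall a u u', chart1 w p y (a *: u + u') = a * chart1 w p y u + chart1 w p y u'.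
  by move=> a u u'; rewrite /chart1/in_chart -lwy; congr (w _ _); apply/funext => _;
    rewrite !deriveE// linearP.
have c0 : chart1 w p y 0 = 0.
  have := lc (-1) 0 0; rewrite scaler0 addr0 => {1}->.
  by rewrite mulN1r addNr.
rewrite [in LHS](row_sum_delta v); elim: (index_enum _) => [|j s IH].
  by rewrite !big_nil.
by rewrite !big_cons lc IH.
Qed.

Lemma ext_d1E w x v : ext_d w x v = chart_d (chart1 w x) (crd x x) (v 0) (v 1).
Proof.
have E0 : (fun j : 'I_1 => v (lift ord0 j)) = (fun=> v 1).
  by apply/funext => j; congr (v _); apply: val_inj; rewrite (ord1 j).
have E1 : (fun j : 'I_1 => v (lift (lift ord0 ord0) j)) = (fun=> v 0).
  by apply/funext => j; congr (v _); apply: val_inj; rewrite (ord1 j).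
have E2 : lift ord0 ord0 = 1 :> 'I_2 by exact/val_inj.
by rewrite /ext_d big_ord_recl big_ord1 E0 E1 E2 expr0 expr1 mul1r mulN1r.
Qed.

End forms1.

Section pullback.
Context {R : realType} {m l : nat} {M : mfd R m} {N : mfd R l}.
Hypotheses (aM : is_atlas M) (aN : is_atlas N).
Implicit Types (F : M -> N) (w : dform 1 N).

Lemma chart1_pull F w p q x v : msmooth_at F x -> chart_dom p x -> chart_dom q (F x) ->
  chart1 (pullf F w) p (crd p x) v =
  chart1 w q (crd q (F x)) ('D_v (crd q \o F \o par p) (crd p x)).
Proof.
move=> sF px qx; have rx := atlas_dom aN (F x).
rewrite (chart1E aM _ _ px) (chart1E aN _ _ qx) /pullf /mdiff.
by rewrite (derive_rep_src aM v sF px rx) (derive_rep_tgt aM aN v sF px qx rx).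
Qed.

Lemma near_chart1_pull F w p q x : msmooth_at F x -> chart_dom p x -> chart_dom q (F x) ->
  \forall y \near crd p x, forall v, chart1 (pullf F w) p y v =
    chart1 w q ((crd q \o F \o par p) y) ('D_v (crd q \o F \o par p) y).
Proof.
move=> sF px qx.
have nq := near_continuous (msmooth_continuous sF) (near_dom aN qx).
have := near_par aM px (near_and (near_msmooth_at aM aN sF) nq).
have := near_tgt aM px; apply: filterS2 => y ty [sy qy] v.
by have := chart1_pull w v sy (par_dom aM ty) qy; rewrite (crd_parK aM).
Qed.

Lemma linear1_pull F w x : msmooth_at F x -> linear1_at w (F x) -> linear1_at (pullf F w) x.
Proof.
move=> sF lw a u v; rewrite /pullf -lw; congr (w _ _).
by apply/funext => _; rewrite mdiffP.
Qed.

Lemma form1_at_pull F w x : msmooth_at F x -> form1_at w (F x) -> form1_at (pullf F w) x.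
Proof.
move=> sF [lw sw]; split.
  have nl := near_continuous (msmooth_continuous sF) lw.
  have ns := near_msmooth_at aM aN sF.
  by apply: filterS2 ns nl => y sy ly; exact: (linear1_pull sy ly).
move=> p px v; have qx := atlas_dom aN (F x).
apply: (@smooth_at_eq _ _ R^o (fun y => chart1 w (F x)
    ((crd (F x) \o F \o par p) y) ('D_v (crd (F x) \o F \o par p) y))).
  by have := near_chart1_pull w sF px qx; apply: filterS => y ->.
have [_ dF] := sF; have Gx : (crd (F x) \o F \o par p) (crd p x) = crd (F x) (F x).
  by rewrite /= (atlas_crdK aM).
apply: smooth_pull; last exact: dF.
- by rewrite Gx; exact: chart1_sum.
- by move=> u; rewrite Gx; exact: sw.
Qed.

(** Naturality of [d], with the right-hand side in any chart [q] around [F x]. Later [q] stays fixed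
    while the base point moves, so that coefficients at different points can be compared. *)
Lemma ext_d_pull F w q x v : msmooth_at F x -> form1_at w (F x) -> chart_dom q (F x) ->
  ext_d (pullf F w) x v = chart_d (chart1 w q) (crd q (F x))
    ('D_(v 0) (crd q \o F \o par x) (crd x x)) ('D_(v 1) (crd q \o F \o par x) (crd x x)).
Proof.
move=> sF [lw sw] qx; have xx := atlas_dom aM x; have [_ dF] := sF.
rewrite ext_d1E; set G := crd q \o F \o par x.
have Gx : G (crd x x) = crd q (F x) by rewrite /G/= (atlas_crdK aM).
transitivity (chart_d (fun z v => chart1 w q (G z) ('D_v G z)) (crd x x) (v 0) (v 1)).
  exact: chart_d_eq (near_chart1_pull w sF xx qx).
rewrite chart_d_pull.
- by rewrite Gx.
- by rewrite Gx; exact: chart1_sum.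
- by move=> u; rewrite Gx; exact: sw.
- exact: dF.
Qed.

End pullback.

Section form_algebra.
Context {R : realType} {m : nat} {M : mfd R m}.
Hypothesis aM : is_atlas M.
Implicit Types (w t : dform 1 M) (f : M -> R) (x : M).

Lemma form1_at_eq w t x : (\forall x' \near x, forall v, w x' (fun=> v) = t x' (fun=> v)) ->
  form1_at w x -> form1_at t x.
Proof.
move=> wt [lw sw]; split.
  by apply: filterS2 wt lw => y E ly a u v; rewrite -!E ly.
move=> p px v; apply: (@smooth_at_eq _ _ R^o ((chart1 w p)^~ v)); last exact: sw.
by have := near_par aM px wt; apply: filterS => y E; rewrite /chart1/in_chart E.
Qed.

Lemma ext_d_eq w t x v :
  (\forall x' \near x, forall v, w x' (fun=> v) = t x' (fun=> v)) ->
  ext_d w x v = ext_d t x v.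
Proof.
move=> wt; rewrite !ext_d1E; apply: chart_d_eq.
have nE := near_par aM (atlas_dom aM x) wt.
by apply: filterS nE => y E u; rewrite /chart1/in_chart E.
Qed.

Lemma form1_at_add w t x : form1_at w x -> form1_at t x ->
  form1_at (fun x v => w x v + t x v) x.
Proof.
move=> [lw sw] [lt st]; split.
  by apply: filterS2 lw lt => y ly ly' a u v; rewrite ly ly' mulrDr addrACA.
move=> p px v; apply: (@smooth_atD _ _ R^o ((chart1 w p)^~ v) ((chart1 t p)^~ v)).
  exact: sw.
exact: st.
Qed.

Lemma form1_at_scale f w x : mfun_smooth_at f x -> form1_at w x ->
  form1_at (fun x v => f x * w x v) x.
Proof.
move=> sf [lw sw]; split.
  by apply: filterS lw => y ly a u v; rewrite ly mulrDr mulrCA.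
move=> p px v; apply: (@smooth_atM _ _ (f \o par p) ((chart1 w p)^~ v)).
  exact: sf.
exact: sw.
Qed.

Lemma ext_d_add w t x v : form1_at w x -> form1_at t x ->
  ext_d (fun x v => w x v + t x v) x v = ext_d w x v + ext_d t x v.
Proof.
move=> [_ sw] [_ st]; have xx := atlas_dom aM x; rewrite !ext_d1E.
exact: (chart_dD (w := chart1 w x) (t := chart1 t x) _ _ (sw x xx) (st x xx)).
Qed.

Lemma ext_d_scale f w x v : mfun_smooth_at f x -> form1_at w x ->
  ext_d (fun x v => f x * w x v) x v =
  dderiv (f \o par x) (v 0) (crd x x) * w x (fun=> v 1) -
  dderiv (f \o par x) (v 1) (crd x x) * w x (fun=> v 0) + f x * ext_d w x v.
Proof.
move=> sf [_ sw]; have xx := atlas_dom aM x; rewrite !ext_d1E.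
apply: etrans (chart_dM (w := chart1 w x) _ _ (sf x xx) (sw x xx)) _.
by rewrite !(chart1_self aM) [(f \o par x) _]/= (atlas_crdK aM xx).
Qed.

End form_algebra.

(** * Product manifolds *)

Section row_mx_smooth.
Context {R : realType} {V : normedModType R} {m l : nat}.

Lemma smooth_at_row_mx (f : V -> 'rV[R]_m) (g : V -> 'rV[R]_l) x :
  smooth_at f x -> smooth_at g x -> smooth_at (fun y => row_mx (f y) (g y)) x.
Proof.
move=> sf sg; apply: smooth_at_rV => j; case: (split_ordP j) => k ->.
  under eq_fun do rewrite row_mxEl; exact: smooth_at_coord.
under eq_fun do rewrite row_mxEr; exact: smooth_at_coord.
Qed.

Lemma smooth_at_lsubmx (f : V -> 'rV[R]_(m + l)) x :
  smooth_at f x -> smooth_at (fun y => lsubmx (f y)) x.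
Proof.
move=> sf; apply: smooth_at_rV => j; under eq_fun do rewrite mxE; exact: smooth_at_coord.
Qed.

Lemma smooth_at_rsubmx (f : V -> 'rV[R]_(m + l)) x :
  smooth_at f x -> smooth_at (fun y => rsubmx (f y)) x.
Proof.
move=> sf; apply: smooth_at_rV => j; under eq_fun do rewrite mxE; exact: smooth_at_coord.
Qed.

Lemma derive_row_mx (f : V -> 'rV[R]_m) (g : V -> 'rV[R]_l) x v :
  smooth_at f x -> smooth_at g x ->
  'D_v (fun y => row_mx (f y) (g y)) x = row_mx ('D_v f x) ('D_v g x).
Proof.
move=> sf sg; apply/rowP => j; rewrite dderiv_coord; last exact: smooth_at_row_mx.
case: (split_ordP j) => k ->.
  by under eq_fun do rewrite row_mxEl; rewrite row_mxEl dderiv_coord.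
by under eq_fun do rewrite row_mxEr; rewrite row_mxEr dderiv_coord.
Qed.

Lemma derive_lsubmx (f : V -> 'rV[R]_(m + l)) x v : smooth_at f x ->
  'D_v (fun y => lsubmx (f y)) x = lsubmx ('D_v f x).
Proof.
move=> sf; apply/rowP => j; rewrite dderiv_coord; last exact: smooth_at_lsubmx.
by under eq_fun do rewrite mxE; rewrite mxE dderiv_coord.
Qed.

Lemma derive_rsubmx (f : V -> 'rV[R]_(m + l)) x v : smooth_at f x ->
  'D_v (fun y => rsubmx (f y)) x = rsubmx ('D_v f x).
Proof.
move=> sf; apply/rowP => j; rewrite dderiv_coord; last exact: smooth_at_rsubmx.
by under eq_fun do rewrite mxE; rewrite mxE dderiv_coord.
Qed.

End row_mx_smooth.

Lemma continuous_row_mx (R : realType) (T : topologicalType) m l (f : T -> 'rV[R]_m)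
    (g : T -> 'rV[R]_l) x : {for x, continuous f} -> {for x, continuous g} ->
  {for x, continuous (fun y => row_mx (f y) (g y))}.
Proof.
move=> cf cg.
have -> : (fun y => row_mx (f y) (g y)) =
    (fun y => row_mx (f y) 0 + row_mx 0 (g y)).
  by apply/funext => y; rewrite add_row_mx addr0 add0r.
have cl (a : 'rV[R]_m) : {for a, continuous (fun b => row_mx b (0 : 'rV[R]_l))}.
  by apply: smooth_at_continuous; apply: smooth_at_row_mx; [exact: smooth_at_id|exact: smooth_at_cst].
have cr (a : 'rV[R]_l) : {for a, continuous (fun b => row_mx (0 : 'rV[R]_m) b)}.
  by apply: smooth_at_continuous; apply: smooth_at_row_mx; [exact: smooth_at_cst|exact: smooth_at_id].
apply: (@cvgD R _ _ (nbhs x)).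
  exact: (continuous_comp cf (cl (f x))).
exact: (continuous_comp cg (cr (g x))).
Qed.

Section product_manifold.
Context {R : realType} {m l : nat} {M : mfd R m} {N : mfd R l}.
Hypotheses (aM : is_atlas M) (aN : is_atlas N).

Lemma chart_tgt_prod (p : mprod M N) y :
  chart_tgt p y <-> chart_tgt p.1 (lsubmx y) /\ chart_tgt p.2 (rsubmx y).
Proof.
split=> [[x [x1 x2] <-]|[[x1 d1 e1] [x2 d2 e2]]].
  by rewrite /= row_mxKl row_mxKr; split; [exists x.1|exists x.2].
by exists (x1, x2) => //=; rewrite e1 e2 hsubmxK.
Qed.

Lemma mprod_atlas : is_atlas (mprod M N).
Proof.
have dom1 (p : mprod M N) : chart_dom p p.
  by split; [exact: (atlas_dom aM)|exact: (atlas_dom aN)].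
split => //.
- move=> p; rewrite openE => -[x1 x2] [/= d1 d2].
  exists (chart_dom p.1, chart_dom p.2) => //=.
  by split; [exact: (near_dom aM d1)|exact: (near_dom aN d2)].
- move=> p; have -> : chart_tgt p = (lsubmx : 'rV[R]_(m + l) -> 'rV[R]_m) @^-1` chart_tgt p.1
      `&` (rsubmx : 'rV[R]_(m + l) -> 'rV[R]_l) @^-1` chart_tgt p.2.
    by apply/seteqP; split=> y /chart_tgt_prod.
  apply: openI.
    by apply: open_comp => [y _|]; [exact: continuous_lsubmx|exact: (atlas_tgt_open aM)].
  by apply: open_comp => [y _|]; [exact: continuous_rsubmx|exact: (atlas_tgt_open aN)].
- move=> p [x1 x2] [/= d1 d2].
  by rewrite row_mxKl row_mxKr (atlas_crdK aM)// (atlas_crdK aN).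
- move=> p x [d1 d2] /=; apply: (@continuous_row_mx _ (mprod M N)).
    by apply: continuous_comp; [exact: cvg_fst|exact: (atlas_crd_continuous aM)].
  by apply: continuous_comp; [exact: cvg_snd|exact: (atlas_crd_continuous aN)].
- move=> p y /chart_tgt_prod[t1 t2] /=.
  have c1 := continuous_comp (@continuous_lsubmx R 1 m l y) (atlas_par_continuous aM t1).
  have c2 := continuous_comp (@continuous_rsubmx R 1 m l y) (atlas_par_continuous aN t2).
  exact: (cvg_pair c1 c2).
- move=> p q; apply: smooth_at_smooth => y [/chart_tgt_prod[t1 t2] [/= d1 d2]].
  have := transition_at aM (par_dom aM t1) d1; rewrite (crd_parK aM)// => s1.
  have := transition_at aN (par_dom aN t2) d2; rewrite (crd_parK aN)// => s2.
  apply: smooth_at_row_mx.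
    apply: (@smooth_at_comp_rV _ _ _ _ (crd q.1 \o par p.1) lsubmx) => //.
    by apply: (@smooth_at_lsubmx _ _ _ _ id); exact: smooth_at_id.
  apply: (@smooth_at_comp_rV _ _ _ _ (crd q.2 \o par p.2) rsubmx) => //.
  by apply: (@smooth_at_rsubmx _ _ _ _ id); exact: smooth_at_id.
Qed.

Lemma msmooth_at_fst (x : mprod M N) : msmooth_at (M := mprod M N) (N := M) fst x.
Proof.
apply: (@msmooth_atP _ _ _ _ _ mprod_atlas aM x x.1).
- exact: (atlas_dom mprod_atlas).
- exact: (atlas_dom aM).
- by apply: (@near_all (mprod M N)) => y; exact: (@cvg_fst _ _ (nbhs y.1) (nbhs y.2) _).
apply: (@smooth_at_eq _ _ _ lsubmx); last first.
  by apply: (@smooth_at_lsubmx _ _ _ _ id); exact: smooth_at_id.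
have := near_tgt mprod_atlas (atlas_dom mprod_atlas x).
by apply: filterS => y /chart_tgt_prod[t1 _]; rewrite /= (crd_parK aM).
Qed.

Lemma msmooth_at_snd (x : mprod M N) : msmooth_at (M := mprod M N) (N := N) snd x.
Proof.
apply: (@msmooth_atP _ _ _ _ _ mprod_atlas aN x x.2).
- exact: (atlas_dom mprod_atlas).
- exact: (atlas_dom aN).
- by apply: (@near_all (mprod M N)) => y; exact: (@cvg_snd _ _ (nbhs y.1) (nbhs y.2) _).
apply: (@smooth_at_eq _ _ _ rsubmx); last first.
  by apply: (@smooth_at_rsubmx _ _ _ _ id); exact: smooth_at_id.
have := near_tgt mprod_atlas (atlas_dom mprod_atlas x).
by apply: filterS => y /chart_tgt_prod[_ t2]; rewrite /= (crd_parK aN).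
Qed.

Lemma mdiff_fst (x : mprod M N) v : mdiff (M := mprod M N) (N := M) fst x v = lsubmx v.
Proof.
rewrite /mdiff -[in RHS](derive_id (crd x x) v) -derive_lsubmx; last exact: smooth_at_id.
apply: near_eq_derive; have := near_tgt mprod_atlas (atlas_dom mprod_atlas x).
by apply: filterS => y /chart_tgt_prod[t1 _]; rewrite /= (crd_parK aM).
Qed.

Lemma mdiff_snd (x : mprod M N) v : mdiff (M := mprod M N) (N := N) snd x v = rsubmx v.
Proof.
rewrite /mdiff -[in RHS](derive_id (crd x x) v) -derive_rsubmx; last exact: smooth_at_id.
apply: near_eq_derive; have := near_tgt mprod_atlas (atlas_dom mprod_atlas x).
by apply: filterS => y /chart_tgt_prod[_ t2]; rewrite /= (crd_parK aN).
Qed.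

Lemma msmooth_at_pair k (L : mfd R k) (F : L -> M) (G : L -> N) x : is_atlas L ->
  msmooth_at F x -> msmooth_at G x ->
  msmooth_at (M := L) (N := mprod M N) (fun y => (F y, G y)) x.
Proof.
move=> aL [cF sF] [cG sG].
split; first by apply: filterS2 cF cG => y; exact: cvg_pair.
move=> p q px [/= q1 q2].
by apply: smooth_at_row_mx; [exact: sF|exact: sG].
Qed.

Lemma mdiff_pair k (L : mfd R k) (F : L -> M) (G : L -> N) x v : is_atlas L ->
  msmooth_at F x -> msmooth_at G x ->
  mdiff (M := L) (N := mprod M N) (fun y => (F y, G y)) x v =
  row_mx (mdiff F x v) (mdiff G x v).
Proof.
move=> aL [_ sF] [_ sG]; have xx := atlas_dom aL x.
rewrite /mdiff; apply: derive_row_mx.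
  by apply: sF => //; exact: (atlas_dom aM).
by apply: sG => //; exact: (atlas_dom aN).
Qed.

End product_manifold.

Lemma msmooth_at_cst (R : realType) m l (M : mfd R m) (N : mfd R l) (c : N) (x : M) :
  msmooth_at (fun=> c) x.
Proof.
split; first by apply: nearW => y; exact: cvg_cst.
by move=> p q _ _; exact: smooth_at_cst.
Qed.

Lemma mdiff_cst (R : realType) m l (M : mfd R m) (N : mfd R l) (c : N) (x : M) v :
  mdiff (fun=> c) x v = 0.
Proof. exact: derive_cst. Qed.

Lemma mdiff_partial (R : realType) k m l (L : mfd R k) (M : mfd R m) (N : mfd R l)
    (H : mprod L M -> N) x z a b : is_atlas L -> is_atlas M -> is_atlas N ->
  msmooth_at H (x, z) ->
  mdiff H (x, z) (row_mx a b) =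
  mdiff (fun x' => H (x', z)) x a + mdiff (fun z' => H (x, z')) z b.
Proof.
move=> aL aM aN sH; have aP := mprod_atlas aL aM.
have sl : msmooth_at (M := L) (N := mprod L M) (fun x' => (x', z)) x.
  by apply: msmooth_at_pair => //; [exact: msmooth_at_id|exact: msmooth_at_cst].
have sr : msmooth_at (M := M) (N := mprod L M) (fun z' => (x, z')) z.
  by apply: msmooth_at_pair => //; [exact: msmooth_at_cst|exact: msmooth_at_id].
have E : row_mx a b = 1 *: row_mx a 0 + row_mx 0 b :> 'rV[R]_(k + m).
  by rewrite scale1r add_row_mx addr0 add0r.
have El : mdiff (fun x' => H (x', z)) x a = mdiff H (x, z) (row_mx a 0).
  rewrite -[X in row_mx X _](mdiff_id x a aL) -[X in row_mx _ X](@mdiff_cst R k m L M z x a).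
  rewrite -(mdiff_pair aL aM a aL (msmooth_at_id x aL) (msmooth_at_cst z x)).
  exact: (mdiff_comp a aL aP aN sl sH).
have Er : mdiff (fun z' => H (x, z')) z b = mdiff H (x, z) (row_mx 0 b).
  rewrite -[X in row_mx _ X](mdiff_id z b aM) -[X in row_mx X _](@mdiff_cst R m k M L x z b).
  rewrite -(mdiff_pair aL aM b aM (msmooth_at_cst x z) (msmooth_at_id z aM)).
  exact: (mdiff_comp b aM aP aN sr sH).
have S := mdiffP aP aN 1 (row_mx a 0) (row_mx 0 b) sH.
exact: (etrans (congr1 (mdiff H (x, z)) E)
  (etrans S (f_equal2 +%R (etrans (scale1r _) (esym El)) (esym Er)))).
Qed.

(** * The circle *)

Section circle.
Context {R : realType}.
Notation S1 := (mcircle R).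
Implicit Types (z w : circle R).

Definition circ_re z : R := (val z).1.
Definition circ_im z : R := (val z).2.

Lemma circ_norm z : circ_re z ^+ 2 + circ_im z ^+ 2 = 1.
Proof. exact: circleP. Qed.

Lemma circ_eq z w : circ_re z = circ_re w -> circ_im z = circ_im w -> z = w.
Proof.
by move=> e1 e2; apply: val_inj; rewrite [val z]surjective_pairing [val w]surjective_pairing;
  congr (_, _).
Qed.

(** With [circ_cross], the real and imaginary parts of the conjugate of [z] times [w]: cosine and
    sine of the angle from [z] to [w]. *)
Definition circ_dot z w : R := circ_re z * circ_re w + circ_im z * circ_im w.
Definition circ_cross z w : R := circ_re z * circ_im w - circ_im z * circ_re w.

Lemma circ_dot_cross z w : circ_dot z w ^+ 2 + circ_cross z w ^+ 2 = 1.
Proof.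
transitivity ((circ_re z ^+ 2 + circ_im z ^+ 2) * (circ_re w ^+ 2 + circ_im w ^+ 2)).
  by rewrite /circ_dot /circ_cross; ring.
by rewrite !circ_norm mulr1.
Qed.

Lemma circ_domE (p z : S1) : chart_dom p z <-> 1 + circ_dot p z != 0.
Proof. by rewrite addrC addr_eq0; split. Qed.

Lemma circ_crdE (p z : S1) :
  crd p z = const_mx (circ_cross p z / (1 + circ_dot p z)).
Proof. by []. Qed.

Lemma circ_parE (p : S1) y :
  circ_re (par p y) = (circ_re p * (1 - y 0 0 ^+ 2) - circ_im p * (2 * y 0 0)) / (1 + y 0 0 ^+ 2) /\
  circ_im (par p y) = (circ_re p * (2 * y 0 0) + circ_im p * (1 - y 0 0 ^+ 2)) / (1 + y 0 0 ^+ 2).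
Proof. by rewrite /circ_re /circ_im /=; split; rewrite !mulrA -?mulrDl -?mulrBl. Qed.

Lemma one_sqr_neq0 (s : R) : 1 + s ^+ 2 != 0.
Proof. by rewrite gt_eqF// ltr_pwDl// sqr_ge0. Qed.

Lemma circ_par_dot (p : S1) y :
  circ_dot p (par p y) = (1 - y 0 0 ^+ 2) / (1 + y 0 0 ^+ 2) /\
  circ_cross p (par p y) = 2 * y 0 0 / (1 + y 0 0 ^+ 2).
Proof.
have [e1 e2] := circ_parE p y; rewrite /circ_dot /circ_cross e1 e2 !mulrA -mulrDl -mulrBl.
by split; congr (_ / _); rewrite -[RHS]mul1r -(circ_norm p); ring.
Qed.

Lemma circ_dom_par (p : S1) y : chart_dom p (par p y).
Proof.
apply/circ_domE; have [-> _] := circ_par_dot p y.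
have h := one_sqr_neq0 (y 0 0).
have -> : 1 + (1 - y 0 0 ^+ 2) / (1 + y 0 0 ^+ 2) = 2 / (1 + y 0 0 ^+ 2) by field.
by rewrite mulf_neq0// invr_neq0.
Qed.

Lemma circ_crd_par (p : S1) y : crd p (par p y) = y.
Proof.
apply/rowP => j; rewrite (ord1 j) circ_crdE mxE; have [-> ->] := circ_par_dot p y.
have h := one_sqr_neq0 (y 0 0).
have -> : 1 + (1 - y 0 0 ^+ 2) / (1 + y 0 0 ^+ 2) = 2 / (1 + y 0 0 ^+ 2) by field.
by field.
Qed.

Lemma circ_par_crd (p z : S1) : chart_dom p z -> par p (crd p z) = z.
Proof.
move=> /circ_domE d; have [e1 e2] := circ_parE p (crd p z).
move: e1 e2; rewrite circ_crdE mxE; set c := circ_dot p z; set s := circ_cross p z.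
have cs : c ^+ 2 + s ^+ 2 = 1 by exact: circ_dot_cross.
(* Half-angle identities: [s / (1 + c)] is the tangent of half the angle with cosine [c] and sine
   [s]. *)
have t1 : 1 + (s / (1 + c)) ^+ 2 = 2 / (1 + c).
  have -> : 1 + (s / (1 + c)) ^+ 2 = (1 + c *+ 2 + (c ^+ 2 + s ^+ 2)) / (1 + c) ^+ 2 by field.
  by rewrite cs; field.
have t2 : (1 - (s / (1 + c)) ^+ 2) = c * (2 / (1 + c)).
  have -> : 1 - (s / (1 + c)) ^+ 2 = (1 + c *+ 2 + c ^+ 2 *+ 2 - (c ^+ 2 + s ^+ 2)) / (1 + c) ^+ 2 by field.
  by rewrite cs; field.
have np := circ_norm p.
rewrite t1 t2 => e1 e2; apply: circ_eq.
  rewrite e1; transitivity (circ_re p * c - circ_im p * s); first by field.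
  by rewrite /c /s /circ_dot /circ_cross -[RHS]mul1r -np; ring.
rewrite e2; transitivity (circ_re p * s + circ_im p * c); first by field.
by rewrite /c /s /circ_dot /circ_cross -[RHS]mul1r -np; ring.
Qed.

Lemma circ_continuous (T : topologicalType) (f : T -> circle R) x :
  {for x, continuous (circ_re \o f)} -> {for x, continuous (circ_im \o f)} ->
  {for x, continuous f}.
Proof.
move=> c1 c2 U; rewrite nbhsE => -[_ [[W oW <-] /= Wx] sWU].
apply: filterS sWU _ => /=.
have c : {for x, continuous (fun y => val (f y))}.
  have -> : (fun y => val (f y)) = (fun y => (circ_re (f y), circ_im (f y))).
    by apply/funext => y; exact: surjective_pairing.
  exact: (cvg_pair c1 c2).
by apply: c; exact: open_nbhs_nbhs.
Qed.

Lemma continuous_circ_val : continuous (val : circle R -> R * R).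
Proof. exact: (@initial_continuous _ _ set_val). Qed.

Lemma continuous_circ_re : continuous (circ_re : circle R -> R).
Proof.
move=> z; have cf : {for val z, continuous (fst : R * R -> R)} by exact: cvg_fst.
exact: (continuous_comp (@continuous_circ_val z) cf).
Qed.

Lemma continuous_circ_im : continuous (circ_im : circle R -> R).
Proof.
move=> z; have cf : {for val z, continuous (snd : R * R -> R)} by exact: cvg_snd.
exact: (continuous_comp (@continuous_circ_val z) cf).
Qed.

Lemma continuous_circ_lin (a b c : R) z :
  {for z, continuous (fun w => c + (a * circ_re w + b * circ_im w))}.
Proof.
have sc (c' : R) : {for z, continuous (fun=> c' : R)} by exact: (@cst_continuous _ _ c' z).
have Fz : Filter (nbhs z) by exact: nbhs_filter.
have c1 := @cvgM R _ _ Fz _ _ _ _ (sc a) (@continuous_circ_re z).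
have c2 := @cvgM R _ _ Fz _ _ _ _ (sc b) (@continuous_circ_im z).
exact: (@cvgD R _ _ _ Fz _ _ _ _ (sc c) (@cvgD R _ _ _ Fz _ _ _ _ c1 c2)).
Qed.

(** The chart is a rational function of the real and imaginary parts, with denominator nonzero on
    its domain. Smoothness of a map into the circle is thus tested on these two functions. *)
Lemma smooth_at_circ_crd (V : normedModType R) (f : V -> circle R) (q : S1) x :
  smooth_fun_at (circ_re \o f) x -> smooth_fun_at (circ_im \o f) x ->
  chart_dom q (f x) -> smooth_at (fun y => crd q (f y)) x.
Proof.
move=> s1 s2 /circ_domE d; apply: smooth_at_rV => j.
have -> : (fun y => crd q (f y) 0 j) = (fun y =>
    (circ_re q * circ_im (f y) - circ_im q * circ_re (f y)) *
    (1 + (circ_re q * circ_re (f y) + circ_im q * circ_im (f y)))^-1).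
  by apply/funext => y; rewrite mxE.
have sc (c : R) : smooth_fun_at (fun=> c) x by exact: smooth_at_cst.
have sM (c : R) g : smooth_fun_at g x -> smooth_fun_at (fun y => c * g y) x.
  by move=> sg; exact: (smooth_atM (sc c) sg).
have n1 := smooth_atB (sM (circ_re q) _ s2) (sM (circ_im q) _ s1).
have n2 := smooth_atD (sc 1) (smooth_atD (sM (circ_re q) _ s1) (sM (circ_im q) _ s2)).
have n3 := @smooth_atV _ _ (fun y =>
  1 + (circ_re q * circ_re (f y) + circ_im q * circ_im (f y))) x d n2.
exact: (smooth_atM n1 n3).
Qed.

Lemma smooth_circ_par (p : S1) y :
  smooth_fun_at (circ_re \o par p) y /\ smooth_fun_at (circ_im \o par p) y.
Proof.
have sc (c : R) : smooth_fun_at (fun=> c) y by exact: smooth_at_cst.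
have sX : smooth_fun_at (fun y : 'rV[R]_1 => y 0 0) y.
  by apply: (@smooth_at_coord _ _ _ id); exact: smooth_at_id.
have sM (c : R) g : smooth_fun_at g y -> smooth_fun_at (fun y => c * g y) y.
  by move=> sg; exact: (smooth_atM (sc c) sg).
have sX2 : smooth_fun_at (fun y : 'rV[R]_1 => y 0 0 ^+ 2) y.
  by under eq_fun do rewrite expr2; exact: (smooth_atM sX sX).
have sI : smooth_fun_at (fun y : 'rV[R]_1 => (1 + y 0 0 ^+ 2)^-1) y.
  exact: (@smooth_atV _ _ (fun y : 'rV[R]_1 => 1 + y 0 0 ^+ 2) y (one_sqr_neq0 _)
    (smooth_atD (sc 1) sX2)).
have s1 : smooth_fun_at (fun y : 'rV[R]_1 => 1 - y 0 0 ^+ 2) y := smooth_atB (sc 1) sX2.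
have s2 := sM 2 _ sX.
split.
  rewrite (_ : circ_re \o par p = (fun y => (circ_re p * (1 - y 0 0 ^+ 2) -
    circ_im p * (2 * y 0 0)) * (1 + y 0 0 ^+ 2)^-1)); last first.
    by apply/funext => z; have [e _] := circ_parE p z.
  exact: (smooth_atM (smooth_atB (sM (circ_re p) _ s1) (sM (circ_im p) _ s2)) sI).
rewrite (_ : circ_im \o par p = (fun y => (circ_re p * (2 * y 0 0) +
  circ_im p * (1 - y 0 0 ^+ 2)) * (1 + y 0 0 ^+ 2)^-1)); last first.
  by apply/funext => z; have [_ e] := circ_parE p z.
exact: (smooth_atM (smooth_atD (sM (circ_re p) _ s2) (sM (circ_im p) _ s1)) sI).
Qed.

Lemma circ_atlas : is_atlas S1.
Proof.
split.
- move=> p; apply/circ_domE; rewrite /circ_dot -!expr2 circ_norm.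
  by rewrite -[1 + 1]/(2 : R).
- move=> p; have -> : chart_dom p = (fun z => 1 + circ_dot p z) @^-1` [set x | x != 0].
    by apply/funext => z; apply/propext; exact: circ_domE.
  apply: open_comp; last exact: open_neq.
  by move=> z _; exact: continuous_circ_lin.
- move=> p; have -> : chart_tgt p = setT; last exact: openT.
  by apply/seteqP; split=> // y _; exists (par p y); [exact: circ_dom_par|exact: circ_crd_par].
- exact: circ_par_crd.
- move=> p z /circ_domE d; rewrite /prop_for/continuous_at.
  have c0 : {for z, continuous (fun z => circ_cross p z / (1 + circ_dot p z))}.
    have e : circ_cross p = (fun w => 0 + (- circ_im p * circ_re w + circ_re p * circ_im w)).
      by apply/funext => w; rewrite /circ_cross; ring.
    have cc := @continuous_circ_lin (- circ_im p) (circ_re p) 0 z; rewrite -e in cc.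
    have cd := @continuous_circ_lin (circ_re p) (circ_im p) 1 z.
    have Fz : Filter (nbhs z) by exact: nbhs_filter.
    exact: (@cvgM R _ _ Fz _ _ _ _ cc (@cvgV R _ _ Fz _ _ d cd)).
  have c1 : continuous (fun a : R => const_mx a : 'rV[R]_1).
    have -> : (fun a : R => const_mx a : 'rV[R]_1) = ( *:%R^~ (const_mx 1)).
      by apply/funext => a; apply/rowP => j; rewrite !mxE mulr1.
    by move=> a; apply: cvgZr_tmp; exact: cvg_id.
  exact: (continuous_comp c0 (c1 _)).
- move=> p y _; have [s1 s2] := smooth_circ_par p y.
  by apply: circ_continuous; [exact: (smooth_at_continuous s1)|exact: (smooth_at_continuous s2)].
- move=> p q; apply: smooth_at_smooth => y [_ d]; have [s1 s2] := smooth_circ_par p y.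
  exact: smooth_at_circ_crd.
Qed.

End circle.

(** On a line, [chart_d] is an alternating expression in two multiples of one basis vector. *)
Lemma chart_d_dim1 (R : realType) (w : 'rV[R]_1 -> 'rV[R]_1 -> R) y h0 h1 :
  (\forall z \near y, forall v, w z v = \sum_j v 0 j * w z (delta_mx 0 j)) ->
  (forall v, smooth_fun_at (w^~ v) y) -> chart_d w y h0 h1 = 0.
Proof.
move=> lw sw; pose e : 'rV[R]_1 := delta_mx 0 0.
have E u v : dderiv (w^~ u) v y = u 0 0 * (v 0 0 * dderiv (w^~ e) e y).
  rewrite (@dderiv_eq _ _ _ (fun z => u 0 0 * w z e)); last first.
    by apply: filterS lw => z ->; rewrite big_ord1.
  rewrite (dderivZ _ _ (sw e)); congr (_ * _).
  by rewrite /dderiv (derive_delta _ (smooth_at_differentiable (sw e))) big_ord1.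
by rewrite /chart_d (E h1 h0) (E h0 h1); ring.
Qed.

(** * The angular form, rotations and the generator of the action *)

Section angular_form.
Context {R : realType}.
Notation S1 := (mcircle R).
Implicit Types (z w : S1).

(* The chart coordinate around [z] is [tan (t / 2)], hence the factor 2. *)
Definition angular_form : dform 1 S1 := fun _ v => 2 * v 0 0 0.

(** This is $d\theta = x\,dy - y\,dx$ along [f]. On the left the chart at [f y] moves with [y]; the
    right-hand side has no chart of the circle in it, and its smoothness is plain. *)
Lemma derive_circle_curve (V : normedModType R) (f : V -> S1) y v :
  smooth_fun_at (circ_re \o f) y -> smooth_fun_at (circ_im \o f) y ->
  2 * 'D_v (fun y' => crd (f y) (f y')) y 0 0 =
  circ_re (f y) * dderiv (circ_im \o f) v y - circ_im (f y) * dderiv (circ_re \o f) v y.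
Proof.
move=> s1 s2; have dom : chart_dom (f y) (f y) by exact: (atlas_dom circ_atlas).
rewrite dderiv_coord; last exact: smooth_at_circ_crd.
pose a := circ_re (f y); pose b := circ_im (f y).
have sc (c : R) : smooth_fun_at (fun=> c) y by exact: smooth_at_cst.
have sM (c : R) g : smooth_fun_at g y -> smooth_fun_at (fun y => c * g y) y.
  by move=> sg; exact: (smooth_atM (sc c) sg).
(* The coordinate is [s * k] with [s y = 0] and [k y = 1/2]: only the derivative of [s] survives,
   and the one half cancels the 2. *)
pose s y' := a * circ_im (f y') + (- b) * circ_re (f y').
pose k y' := (1 + (a * circ_re (f y') + b * circ_im (f y')))^-1.
have ss : smooth_fun_at s y := smooth_atD (sM a _ s2) (sM (- b) _ s1).
have n1 : a * a + b * b = 1 by rewrite -!expr2 circ_norm.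
have k0 : 1 + (a * circ_re (f y) + b * circ_im (f y)) != 0 by rewrite -/a -/b n1.
have sk : smooth_fun_at k y.
  exact: (@smooth_atV _ _ (fun y' => 1 + (a * circ_re (f y') + b * circ_im (f y'))) y k0
    (smooth_atD (sc 1) (smooth_atD (sM a _ s1) (sM b _ s2)))).
have -> : (fun y' => crd (f y) (f y') 0 0) = (fun y' => s y' * k y').
  by apply/funext => y'; rewrite mxE /s mulNr.
rewrite (dderivM v ss sk) (_ : s y = 0); last by rewrite /s -/a -/b; ring.
rewrite mul0r add0r /k -/a -/b n1 mulrA divff ?mul1r//.
rewrite (dderivD v (sM a _ s2) (sM (- b) _ s1)).
by rewrite (dderivZ a v s2) (dderivZ (- b) v s1) mulNr.
Qed.

Lemma angular_form1_at z : form1_at angular_form z.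
Proof.
split; first by apply: near_all => w a u v; rewrite /angular_form !mxE; ring.
move=> p pz v; have s y := smooth_circ_par p y.
have -> : (chart1 angular_form p)^~ v = (fun y =>
    circ_re (par p y) * dderiv (circ_im \o par p) v y -
    circ_im (par p y) * dderiv (circ_re \o par p) v y).
  by apply/funext => y; have [s1 s2] := s y; rewrite -derive_circle_curve.
have [s1 s2] := s (crd p z).
exact: (smooth_atB (smooth_atM s1 (smooth_fun_dderiv v s2))
  (smooth_atM s2 (smooth_fun_dderiv v s1))).
Qed.

Lemma ext_d_pull_angular m (M : mfd R m) (g : M -> S1) x v : is_atlas M ->
  msmooth_at g x -> ext_d (pullf g angular_form) x v = 0.
Proof.
move=> aM sg; have [l s] := angular_form1_at (g x).
have gg := atlas_dom circ_atlas (g x).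
rewrite (ext_d_pull aM circ_atlas v sg (angular_form1_at _) gg).
by apply: chart_d_dim1; [exact: (chart1_sum circ_atlas gg l)|exact: s].
Qed.

Lemma circ_mulE z w : circ_re (circle_mul z w) = circ_re z * circ_re w - circ_im z * circ_im w /\
  circ_im (circle_mul z w) = circ_re z * circ_im w + circ_im z * circ_re w.
Proof. by []. Qed.

(** [circ_dot] and [circ_cross] are invariant under a common rotation. Consequently rotations have
    the identity as differential in the preferred charts. *)
Lemma crd_mulr z w w' : crd (circle_mul w z : S1) (circle_mul w' z) = crd w w'.
Proof.
have [a1 a2] := circ_mulE w z; have [b1 b2] := circ_mulE w' z.
have n := circ_norm z.
rewrite !circ_crdE; congr (const_mx (_ / (1 + _))).
  rewrite /circ_cross a1 a2 b1 b2 -[RHS]mul1r -n; ring.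
rewrite /circ_dot a1 a2 b1 b2 -[RHS]mul1r -n; ring.
Qed.

Lemma circ_mulC z w : circle_mul z w = circle_mul w z.
Proof.
have [a1 a2] := circ_mulE z w; have [b1 b2] := circ_mulE w z.
by apply: circ_eq; rewrite ?a1 ?a2 ?b1 ?b2; ring.
Qed.

Lemma circ_mulA z w w' : circle_mul z (circle_mul w w') = circle_mul (circle_mul z w) w'.
Proof. by apply: circ_eq; rewrite /circ_re /circ_im /=; ring. Qed.

Lemma circ_mul1 z : circle_mul (circle_one R) z = z.
Proof. by apply: circ_eq; rewrite /circ_re /circ_im /=; ring. Qed.

Lemma crd_mull z w w' : crd (circle_mul z w : S1) (circle_mul z w') = crd w w'.
Proof. by rewrite !(circ_mulC z) crd_mulr. Qed.

Lemma circ_inv_subproof z : circ_re z ^+ 2 + (- circ_im z) ^+ 2 = 1.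
Proof. by rewrite sqrrN circ_norm. Qed.

Definition circ_inv z : circle R := mk_circle (circ_inv_subproof z).

Lemma circ_mulV z : circle_mul (circ_inv z) z = circle_one R.
Proof.
have n := circ_norm z.
by apply: circ_eq; rewrite /circ_re /circ_im /= -/(circ_re z) -/(circ_im z); [rewrite -n|]; ring.
Qed.

Lemma msmooth_at_mull z w : msmooth_at (M := S1) (N := S1) (circle_mul z) w.
Proof.
have s p y : smooth_fun_at (circ_re \o (circle_mul z \o par (p : S1))) y /\
             smooth_fun_at (circ_im \o (circle_mul z \o par (p : S1))) y.
  have [s1 s2] := smooth_circ_par p y.
  have sc (c : R) : smooth_fun_at (fun=> c) y by exact: smooth_at_cst.
  have sM (c : R) g : smooth_fun_at g y -> smooth_fun_at (fun y => c * g y) y.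
    by move=> sg; exact: (smooth_atM (sc c) sg).
  split; first exact: (smooth_atB (sM (circ_re z) _ s1) (sM (circ_im z) _ s2)).
  exact: (smooth_atD (sM (circ_re z) _ s2) (sM (circ_im z) _ s1)).
split.
  apply: near_all => w'; apply: circ_continuous.
    have -> : circ_re \o circle_mul z =
        (fun w => 0 + (circ_re z * circ_re w + (- circ_im z) * circ_im w)).
      by apply/funext => v; have [e _] := circ_mulE z v; rewrite /= e; ring.
    exact: continuous_circ_lin.
  have -> : circ_im \o circle_mul z =
      (fun w => 0 + (circ_im z * circ_re w + circ_re z * circ_im w)).
    by apply/funext => v; have [_ e] := circ_mulE z v; rewrite /= e; ring.
  exact: continuous_circ_lin.
move=> p q pw qw; have [s1 s2] := s p (crd p w).
apply: (smooth_at_circ_crd s1 s2).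
have e := congr1 (circle_mul z) (atlas_crdK circ_atlas pw).
exact: (eq_ind_r (chart_dom q) qw e).
Qed.

Lemma mdiff_mull z w r : mdiff (M := S1) (N := S1) (circle_mul z) w r = r.
Proof.
have E : crd (circle_mul z w : S1) \o circle_mul z \o par w = crd w \o id \o par w.
  by apply/funext => y; exact: crd_mull.
by rewrite -[RHS](mdiff_id w r circ_atlas) /mdiff E.
Qed.

Lemma circ_one_eq0 : crd (circle_one R : S1) (circle_one R) = 0.
Proof.
apply/rowP => j; rewrite circ_crdE !mxE /circ_cross; apply/eqP; rewrite mulf_eq0.
by rewrite (_ : _ - _ = 0) ?eqxx//; ring.
Qed.

(** The velocity of [cis] at 0, since the coordinate of [cis t] is the tangent of [t / 2]. *)
Definition half_vec : 'rV[R]_1 := const_mx 2^-1.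

Lemma derive_cis : differentiable (fun t : R => crd (circle_one R : S1) (cis t)) 0 /\
  'D_1 (fun t : R => crd (circle_one R : S1) (cis t)) 0 = half_vec.
Proof.
have E : (fun t : R => crd (circle_one R : S1) (cis t)) =
    (fun t => (sin t * (1 + cos t)^-1) *: const_mx 1).
  apply/funext => t; apply/rowP => j; rewrite circ_crdE !mxE mulr1.
  by rewrite /circ_cross /circ_dot /circ_re /circ_im /= !mul1r !mul0r subr0 addr0.
have c0 : 1 + cos (0 : R) != 0 by rewrite cos0.
have d1 := is_deriveD (is_derive_cst (1 : R) (0 : R) 1) (is_derive_cos (0 : R)).
have d2 := @is_deriveV R (fun t => 1 + cos t) 0 _ 1 c0 d1.
have d3 := is_deriveM (is_derive_sin (0 : R)) d2.
have d : is_derive (0 : R) 1 (fun t : R => sin t * (1 + cos t)^-1) 2^-1.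
  by apply: (is_derive_eq d3); rewrite /GRing.scale/= sin0 cos0; field.
have df : differentiable (fun t : R => sin t * (1 + cos t)^-1) 0.
  by apply/derivable1_diffP; exact: ex_derive.
rewrite E; split; first exact: differentiableZl.
rewrite deriveE; last exact: differentiableZl.
rewrite diffZl// -deriveE// derive_val.
by apply/rowP => j; rewrite !mxE mulr1.
Qed.

Lemma near_cis : \forall t \near (0 : R), chart_dom (circle_one R : S1) (cis t).
Proof.
have c0 : 1 + cos (0 : R) != 0 by rewrite cos0.
have cc : {for (0 : R), continuous (fun t : R => 1 + cos t)}.
  by apply: cvgD; [exact: cvg_cst|exact: continuous_cos].
have n0 : \forall t \near (0 : R), 1 + cos t != 0 by exact: (cvgr_neq0 _ cc c0).
apply: filterS n0 => t t0; apply/circ_domE.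
by rewrite /circ_dot /circ_re /circ_im /= mul1r mul0r addr0.
Qed.

Lemma cis0 : cis (0 : R) = circle_one R.
Proof. by apply: circ_eq; rewrite /circ_re /circ_im /= ?cos0 ?sin0. Qed.

Lemma dthetaE m (B : mfd R m) (P : bundle B) (x : P) : is_atlas P ->
  bact x (circle_one R) = x ->
  msmooth_at (M := S1) (N := P) (bact x) (circle_one R) ->
  dtheta x = mdiff (M := S1) (N := P) (bact x) (circle_one R) half_vec.
Proof.
move=> aP x1 [_ sH]; have [d D] := derive_cis.
have c11 := atlas_dom circ_atlas (circle_one R).
rewrite /dtheta derive1E /mdiff -D.
have E : \forall t \near (0 : R),
    ((crd (bact x (circle_one R)) \o bact x \o par (circle_one R : S1)) \o
     (fun t => crd (circle_one R : S1) (cis t))) t = crd x (bact x (cis t)).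
  apply: filterS near_cis => t ct; rewrite x1.
  exact: (congr1 (fun z => crd x (bact x z)) (atlas_crdK circ_atlas ct)).
rewrite -(@near_eq_derive R (R : normedModType R) _ _ _ 0 1 E) derive_comp ?cis0//.
apply: smooth_at_differentiable; apply: sH => //.
exact: (atlas_dom aP).
Qed.

End angular_form.

(** * Bump functions *)

Section flat_function.
Context {R : realType}.

(** [flat 0] is the classical $e^{-1/s}$ extended by 0. The powers of [s^-1] are carried along so
    that the span of the family is closed under differentiation. *)
Definition flat (n : nat) (s : R) : R :=
  if 0 < s then s^-1 ^+ n * expR (- s^-1) else 0.

(** From $e^x \ge x^{n+2}/(n+2)!$ at $x = 1/s$. The two extra powers leave [s ^+ 2], enough for the
    derivative at 0 to exist and vanish. *)
Lemma flat_le n (s : R) : `|flat n s| <= (n.+2)`!%:R * s ^+ 2.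
Proof.
rewrite /flat; case: ltP => s0; last by rewrite normr0 mulr_ge0// sqr_ge0.
have x0 : 0 < s^-1 by rewrite invr_gt0.
rewrite ger0_norm; last by rewrite mulr_ge0 ?expR_ge0// exprn_ge0// ltW.
have f0 : 0 < (n.+2)`!%:R :> R by rewrite ltr0n fact_gt0.
have H : s^-1 ^+ n.+2 <= (n.+2)`!%:R * expR s^-1.
  rewrite -ler_pdivrMl// mulrC; apply: le_trans (expR_ge1Dxn n.+1 (ltW x0)).
  by rewrite lerDr.
rewrite expRN ler_pdivrMr ?expR_gt0// mulrAC -ler_pdivrMr ?exprn_gt0//.
by rewrite -exprVn -exprD addn2.
Qed.

Lemma is_derive_flat n (s : R) :
  is_derive s 1 (flat n) (flat n.+2 s - n%:R * flat n.+1 s).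
Proof.
have [s0|s0|<-] := ltgtP 0 s.
- have si : s != 0 by rewrite gt_eqF.
  have E : \forall t \near s, t^-1 ^+ n * expR (- t^-1) = flat n t.
    by near=> t; rewrite /flat ifT//; near: t; exact: (lt_nbhsr s0).
  apply: (near_eq_is_derive E).
  have d1 : is_derive s 1 (fun t : R => t^-1) (- s ^- 2).
    by apply: (is_derive_eq (@is_deriveV R id s 1 1 si (is_derive_id _ _))); rewrite /GRing.scale/= mulr1.
  have d2 := @is_derive1_comp R expR (fun t => - t^-1) s _ _ (is_derive_expR (- s^-1)) (is_deriveN d1).
  have d3 := @is_deriveX _ _ (fun t : R => t^-1) n s 1 _ d1.
  rewrite exprfctE in d3.
  have d4 := is_deriveM d3 d2.
  apply: (is_derive_eq d4); rewrite /flat s0 /GRing.scale/= opprK /comp.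
  rewrite -exprVn; clear; case: n => [|n]; rewrite /= ?mulr0n !exprS; ring.
- have E : \forall t \near s, 0 = flat n t.
    by near=> t; rewrite /flat ifF//; apply/negbTE; rewrite -leNgt ltW//; near: t; exact: (lt_nbhsl s0).
  apply: (near_eq_is_derive E); rewrite /flat !ifF ?mulr0 ?subrr; try by apply/negbTE; rewrite -leNgt ltW.
  exact: is_derive_cst.
have -> : flat n.+2 0 - n%:R * flat n.+1 0 = 0 :> R by rewrite /flat ltxx mulr0 subrr.
have f0 : flat n 0 = 0 :> R by rewrite /flat ltxx.
suff c : h^-1 *: ((flat n \o shift 0) (h *: (1 : R)) - flat n 0) @[h --> (0 : R)^'] --> (0 : R).
  by split; [apply/cvg_ex; exists 0|exact/cvg_lim].
apply/cvgr0Pnorm_le => e e0.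
have C0 : 0 < (n.+2)`!%:R :> R by rewrite ltr0n fact_gt0.
near=> h; rewrite f0 subr0 /= addr0 /GRing.scale/= mulr1 normrM normfV.
have h0 : h != 0 by near: h; exact: nbhs_dnbhs_neq.
rewrite ler_pdivrMl ?normr_gt0//; apply: (le_trans (flat_le n h)).
rewrite -(real_normK (num_real h)) expr2 mulrCA; apply: ler_wpM2l => //.
rewrite -ler_pdivlMl// mulrC; apply: ltW; near: h; apply: dnbhs0_lt.
by rewrite divr_gt0.
Unshelve. all: by end_near. Qed.

Lemma derive_flat n s (a : R) : differentiable (flat n : R -> R^o) s /\
  'D_a (flat n : R -> R^o) s = a * (flat n.+2 s - n%:R * flat n.+1 s).
Proof.
have d := is_derive_flat n s.
have df : differentiable (flat n : R -> R^o) s.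
  by apply/derivable1_diffP; exact: ex_derive.
split => //; rewrite deriveE// -[in LHS](mulr1 a) -[a * 1]/(a *: (1 : R)) linearZ.
by rewrite -deriveE// (@derive_val _ _ _ _ _ _ _ d).
Qed.

Lemma Ck_flat (V : normedModType R) k (U : set V) (g : V -> R^o) n : open U ->
  Ck k U g -> Ck k U (fun x => flat n (g x) : R^o).
Proof.
move=> oU; elim: k n => [|k IH] n.
  move=> cg x Ux; apply: (@continuous_comp _ _ _ g (flat n : R -> R^o)); first exact: cg.
  by apply: differentiable_continuous; have [] := derive_flat n (g x) 0.
move=> cg; have cg' := CkS cg; case: cg => dg cg.
have D x v : U x -> differentiable (fun x => flat n (g x) : R^o) x /\
    'D_v (fun x => flat n (g x) : R^o) x =
    'D_v g x * (flat n.+2 (g x) + (- n%:R) * flat n.+1 (g x)).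
  move=> Ux; have [df DE] := derive_flat n (g x) ('D_v g x).
  split; first exact: (@differentiable_comp _ _ _ _ g (flat n : R -> R^o) x (dg x Ux) df).
  rewrite mulNr -DE; exact: (@derive_comp _ _ _ _ g (flat n : R -> R^o) x v (dg x Ux) df).
split=> [x /(D x 0)[]//|v].
apply: (@Ck_eq _ _ _ _ _ (fun x => 'D_v g x * (flat n.+2 (g x) + (- n%:R) * flat n.+1 (g x)))).
- exact: oU.
- by move=> x Ux; have [_ ->] := D x v Ux.
have c1 : Ck k U (fun=> - n%:R : R^o) by exact: Ck_cst.
apply: (@CkM _ _ k U ('D_v g)); [exact: oU|exact: cg|].
apply: CkD; [exact: oU|exact: IH|].
by apply: (@CkM _ _ k U (fun=> - n%:R)); [exact: oU|exact: c1|exact: IH].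
Qed.

Lemma smooth_at_flat (V : normedModType R) (g : V -> R) x :
  smooth_fun_at g x -> smooth_fun_at (fun x => flat 0 (g x)) x.
Proof. by move=> [U [oU Ux] sg]; exists U => // k; exact: Ck_flat. Qed.

Lemma flat0_ge0 s : 0 <= flat 0 s.
Proof. by rewrite /flat; case: ifP => // _; rewrite expr0 mul1r expR_ge0. Qed.

Lemma flat0_gt0 s : (0 < flat 0 s) = (0 < s).
Proof. by rewrite /flat; case: ifP => _; rewrite ?expr0 ?mul1r ?expR_gt0 ?ltxx. Qed.

End flat_function.

Lemma mx_norm_le (R : realType) m (y : 'rV[R]_m) (e : R) : 0 <= e ->
  (forall j, `|y 0 j| <= e) -> `|y| <= e.
Proof.
move=> e0 ye; have [->|y0] := eqVneq `|y| 0; first exact: e0.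
have [[i j] /= E] := mx_norm_neq0 y0.
by rewrite /Num.Def.normr /= E (ord1 i); exact: ye.
Qed.

(** [flat 0] of a squared radius minus a squared distance, transported by a chart and extended by 0.
    The extension is smooth because the support lies in the image of a compact ball, which is closed
    in [B] and contained in the chart domain and in [U]. *)
Lemma bump_function (R : realType) m (B : mfd R m) (U : set B) (b : B) :
  is_manifold B -> open U -> U b ->
  exists rho : B -> R, [/\ forall x, mfun_smooth_at rho x, forall x, 0 <= rho x,
    0 < rho b & forall x, ~ U x -> \forall x' \near x, rho x' = 0].
Proof.
move=> mB oU Ub; have aB := manifold_atlas mB.
have bb := atlas_dom aB b; set y0 := crd b b.
have nU := open_nbhs_nbhs (conj oU Ub).
have nO : \forall y \near y0, chart_tgt b y /\ U (par b y).
  exact: (near_and (near_tgt aB bb) (near_par aB bb nU)).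
have [r r0 rO] := iffLR (nbhs_ballP _ _) nO.
have r20 : 0 < r / 2 by rewrite divr_gt0.
(* The norm of row vectors is the maximum norm, which is not smooth; the Euclidean square [Q] is,
   and it dominates the square of each coordinate. *)
pose Q (y : 'rV[R]_m) : R := \sum_j (y 0 j - y0 0 j) ^+ 2.
pose phi y : R := flat 0 ((r / 2) ^+ 2 - Q y).
pose K' := closed_ball_ Num.Def.normr y0 (r / 2).
have K'O y : K' y -> chart_tgt b y /\ U (par b y).
  move=> yK; apply: rO; rewrite -ball_normE /=; apply: le_lt_trans yK _.
  by rewrite ltr_pdivrMr// ltr_pMr// ltr1n.
have phiK y : phi y != 0 -> K' y.
  move=> p0; have : 0 < phi y by rewrite lt_neqAle eq_sym p0 flat0_ge0.
  rewrite flat0_gt0 subr_gt0 => Qr; rewrite /K'/closed_ball_/=.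
  apply: mx_norm_le; first exact: ltW.
  move=> j; rewrite !mxE distrC -(ler_pXn2r (_ : 0 < 2)%N) ?nnegrE ?normr_ge0 ?ltW//.
  rewrite real_normK ?num_real//; apply: le_lt_trans Qr.
  by rewrite /Q (bigD1 j)//= lerDl sumr_ge0// => i _; exact: sqr_ge0.
have cK' : compact K'.
  apply: bounded_closed_compact; last exact: closed_closed_ball_.
  exists (`|y0| + r / 2); split; first exact: num_real.
  move=> M ltM y yK; apply: ltW; apply: le_lt_trans ltM.
  rewrite -[X in `|X|](subrK y0) addrC (le_trans (ler_normD _ _))// lerD2l distrC.
  exact: yK.
pose K := par b @` K'.
(* A compact set is closed here because [B] is Hausdorff; without this the extension by 0 could fail
   to be smooth at limit points outside the chart. *)
have clK : closed K.
  apply: compact_closed; first exact: (mfd_hausdorff mB).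
  apply: continuous_compact => //; apply: continuous_in_subspaceT => y /set_mem /K'O[ty _].
  exact: (atlas_par_continuous aB ty).
pose rho (x : B) : R := if x \in chart_dom b then phi (crd b x) else 0.
have rhoK x : rho x != 0 -> K x.
  rewrite /rho; case: ifPn => [/set_mem dx p0|_]; last by rewrite eqxx.
  by exists (crd b x); [exact: phiK|rewrite (atlas_crdK aB)].
have nK x : ~ K x -> \forall x' \near x, rho x' = 0.
  move=> Kx; have nK : nbhs x (~` K) by apply: open_nbhs_nbhs; split => //; exact: closed_openC.
  by apply: filterS nK => x' K'x; apply: contrapT => /eqP/rhoK.
exists rho; split.
- move=> x; have [dx|ndx] := pselect (chart_dom b x).
    apply: (mfun_smooth_atP aB dx).
    apply: (@smooth_at_eq _ _ R^o phi).
      have := near_tgt aB dx; apply: filterS => y ty.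
      by rewrite /rho /= mem_set ?(crd_parK aB)//; exact: (par_dom aB).
    apply: smooth_at_flat.
    have sc (c : R) : smooth_fun_at (fun=> c) (crd b x) by exact: smooth_at_cst.
    have sX j : smooth_fun_at (fun y : 'rV[R]_m => y 0 j - y0 0 j) (crd b x).
      apply: smooth_atB; last exact: sc.
      by apply: (@smooth_at_coord _ _ _ id); exact: smooth_at_id.
    apply: smooth_atB; first exact: sc.
    by apply: smooth_at_sum => j; exact: (smooth_atM (sX j) (sX j)).
  have Kx : ~ K x by move=> [y /K'O[ty _] yx]; apply: ndx; rewrite -yx; exact: par_dom.
  apply: (mfun_smooth_at_eq aB (f := fun=> 0)).
    by apply: filterS (nK x Kx) => x' ->.
  by move=> p px; exact: smooth_at_cst.
- by move=> x; rewrite /rho; case: ifP => // _; exact: flat0_ge0.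
- rewrite /rho mem_set// flat0_gt0 /Q big1 ?subr0 ?exprn_gt0// => j _.
  by rewrite subrr expr0n.
- by move=> x Ux; apply: nK => -[y /K'O[_ Uy] yx]; apply: Ux; rewrite -yx.
Qed.

(** * Connection forms on principal circle bundles *)

Lemma mfun_smooth_at_inv (R : realType) m (M : mfd R m) (f : M -> R) x : is_atlas M ->
  f x != 0 -> mfun_smooth_at f x -> mfun_smooth_at (fun y => (f y)^-1) x.
Proof.
move=> aM fx sf p px; have fy : (f \o par p) (crd p x) != 0 by rewrite /= (atlas_crdK aM).
exact: (@smooth_atV _ _ (f \o par p) (crd p x) fy (sf p px)).
Qed.

Section principal_bundle.
Context {R : realType} {m : nat} {B : mfd R m} {P : bundle B}.
Hypotheses (mB : is_manifold B) (pP : is_principal_bundle P).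
Notation S1 := (mcircle R).
Notation proj := (@bproj R m B P).
Notation act := (@bact R m B P).
Implicit Types (x : P) (z : S1).

Let aB : is_atlas B := manifold_atlas mB.
Let aP : is_atlas P := manifold_atlas (bundle_manifold pP).
Let aC : is_atlas S1 := circ_atlas.
Let aPC : is_atlas (mprod P S1) := mprod_atlas aP aC.

Lemma proj_smooth x : msmooth_at proj x.
Proof. by apply: (msmooth_msmooth_at aP aB openT _ (bundle_proj_smooth pP)). Qed.

Lemma act_smooth (xz : mprod P S1) :
  msmooth_at (M := mprod P S1) (N := P) (fun xz => act xz.1 xz.2) xz.
Proof. by apply: (msmooth_msmooth_at aPC aP openT _ (bundle_act_smooth pP)). Qed.

Lemma act_l_smooth z x : msmooth_at (M := P) (N := P) (act^~ z) x.
Proof.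
apply: (@msmooth_at_comp _ _ _ _ P (mprod P S1) P (fun y => (y, z))
  (fun xz => act xz.1 xz.2)) => //; last exact: act_smooth.
by apply: msmooth_at_pair => //; [exact: msmooth_at_id|exact: msmooth_at_cst].
Qed.

Lemma act_r_smooth x z : msmooth_at (M := S1) (N := P) (act x) z.
Proof.
apply: (@msmooth_at_comp _ _ _ _ S1 (mprod P S1) P (fun w => (x, w))
  (fun xz => act xz.1 xz.2)) => //; last exact: act_smooth.
by apply: msmooth_at_pair => //; [exact: msmooth_at_cst|exact: msmooth_at_id].
Qed.

Lemma act1 x : act x (circle_one R) = x.
Proof. exact: bundle_act1. Qed.

Lemma dtheta_mdiff x :
  dtheta x = mdiff (M := S1) (N := P) (act x) (circle_one R) half_vec.
Proof. by apply: dthetaE => //; [exact: act1|exact: act_r_smooth]. Qed.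

Lemma mdiff_proj_act z x v : mdiff proj (act x z) (mdiff (act^~ z) x v) = mdiff proj x v.
Proof.
rewrite -(mdiff_comp v aP aP aB (act_l_smooth z x) (proj_smooth _)).
by apply: (mdiff_eq aP); apply: near_all => y; exact: (bundle_proj_act pP).
Qed.

Lemma mdiff_proj_dtheta x : mdiff proj x (dtheta x) = 0.
Proof.
have sp : msmooth_at proj (act x (circle_one R)) by exact: proj_smooth.
have := mdiff_comp half_vec aC aP aB (act_r_smooth x (circle_one R)) sp.
rewrite dtheta_mdiff act1 => <-.
rewrite (@mdiff_eq _ _ _ S1 B aC _ (fun=> proj x)); first exact: mdiff_cst.
by apply: near_all => y; exact: (bundle_proj_act pP).
Qed.

(** The orbit map of [x] is the orbit map of [act x z] after the rotation [L] taking [z] to 1, and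
    rotations have identity differential. The scalar [2 * r 0 0] is the angular speed of [r]. *)
Lemma mdiff_act_r x z r :
  mdiff (M := S1) (N := P) (act x) z r = (2 * r 0 0) *: dtheta (act x z).
Proof.
pose L : S1 -> S1 := circle_mul (circ_inv z).
have Lz : L z = circle_one R by exact: circ_mulV.
have E : act x = act (act x z) \o L.
  apply/funext => w; rewrite /= (bundle_actM pP); congr (act x _).
  by rewrite /L circ_mulA (circ_mulC z) circ_mulV circ_mul1.
have sa : msmooth_at (M := S1) (N := P) (act (act x z)) (L z) by exact: act_r_smooth.
have key : mdiff (M := S1) (N := P) (act x) z r =
    mdiff (M := S1) (N := P) (act (act x z)) (circle_one R) r.
  by rewrite [in LHS]E (mdiff_comp r aC aC aP (msmooth_at_mull _ _) sa) mdiff_mull circ_mulV.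
rewrite key dtheta_mdiff.
have -> : r = (2 * r 0 0) *: half_vec.
  by apply/rowP => j; rewrite !mxE (ord1 j); field.
have sa1 : msmooth_at (M := S1) (N := P) (act (act x z)) (circle_one R) by exact: act_r_smooth.
have M0 : mdiff (M := S1) (N := P) (act (act x z)) (circle_one R) 0 = 0.
  exact: derive0.
have := mdiffP aC aP (2 * r 0 0) half_vec 0 sa1; rewrite M0 !addr0 => ->.
by rewrite !mxE; congr (_ *: _); field.
Qed.

(* An equivariant angle function [g] over [U] and the section [sig] where
   [g] is [1]. *)
Record local_section (U : set B) (g : P -> S1) (sig : B -> P) : Prop := LocalSection {
  lsec_open : open U;
  lsec_angle_smooth : forall x, U (proj x) -> msmooth_at g x;
  lsec_angle_act : forall x z, U (proj x) -> g (act x z) = circle_mul (g x) z;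
  lsec_sig_smooth : forall b, U b -> msmooth_at sig b;
  lsec_projK : forall b, U b -> proj (sig b) = b;
  lsec_sigE : forall x, U (proj x) -> act (sig (proj x)) (g x) = x }.

Lemma local_section_exists b : exists U g sig, U b /\ local_section U g sig.
Proof.
have [U [oU Ub [Phi [Psi [[sPhi sPsi fA fC PhiK PsiK] eq]]]]] := bundle_local_triv pP b.
have aT : is_atlas (trivial_bundle B) by exact: (mprod_atlas aB aC).
have oA : open (proj @^-1` U).
  by apply: open_comp => // x _; exact: (msmooth_continuous (proj_smooth x)).
have oC : open ((@bproj R m B (trivial_bundle B)) @^-1` U).
  apply: open_comp => // x _.
  exact: (msmooth_continuous (msmooth_at_fst aB aC x)).
have PhiE x : U (proj x) -> Phi x = (proj x, (Phi x).2).
  by move=> Ux; have [p1 _] := eq x Ux; rewrite [LHS]surjective_pairing -p1.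
have projS b' : U b' -> proj (Psi (b', circle_one R)) = b'.
  move=> Ub'; have Ux : U (proj (Psi (b', circle_one R))).
    by have := fC (b', circle_one R) Ub'.
  by have [<- _] := eq _ Ux; rewrite PsiK.
exists U, (fun x => (Phi x).2), (fun b => Psi (b, circle_one R)); split => //; split => //.
- move=> x Ux.
  apply: (@msmooth_at_comp _ _ _ _ P (mprod B S1) S1 Phi snd) => //.
    exact: (msmooth_msmooth_at aP aT oA Ux sPhi).
  exact: msmooth_at_snd.
- by move=> x z Ux; have [_ ->] := eq x Ux.
- move=> b' Ub'.
  apply: (@msmooth_at_comp _ _ _ _ B (mprod B S1) P (fun b => (b, circle_one R)) Psi) => //.
    by apply: msmooth_at_pair => //; [exact: msmooth_at_id|exact: msmooth_at_cst].
  exact: (msmooth_msmooth_at aT aP oC _ sPsi).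
- move=> x Ux; set s := Psi _.
  have Us : U (proj s) by rewrite /s projS.
  have Ua : U (proj (act s (Phi x).2)) by rewrite (bundle_proj_act pP).
  rewrite -[RHS](PhiK x Ux) -[LHS](PhiK _ Ua); congr Psi.
  have [_ ->] := eq s Us; rewrite /s PsiK// [RHS](PhiE x Ux).
  by congr pair; exact: circ_mul1.
Qed.

(** * Local connection forms *)

Section local_connection.
Context {U : set B} {g : P -> S1} {sig : B -> P} (ls : local_section U g sig).

Lemma local_connection_form x : U (proj x) -> form1_at (pullf g angular_form) x.
Proof.
move=> Ux; apply: (form1_at_pull aP aC); first exact: (lsec_angle_smooth ls).
exact: angular_form1_at.
Qed.

Lemma near_lsec x : U (proj x) -> \forall x' \near x, U (proj x').
Proof.
move=> Ux; apply: (near_continuous (msmooth_continuous (proj_smooth x))).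
by apply: open_nbhs_nbhs; split => //; exact: (lsec_open ls).
Qed.

(** Over [U], acting by [z] multiplies the angle [g] by [z], which [crd] between two angles does not
    see by [crd_mulr]. *)
Lemma local_connection_invariant x z v : U (proj x) ->
  pullf g angular_form (act x z) (fun i => mdiff (act^~ z) x (v i)) =
  pullf g angular_form x v.
Proof.
move=> Ux; have Uz : U (proj (act x z)) by rewrite (bundle_proj_act pP).
have E : \forall y \near crd x x, (crd ((g \o act^~ z) x) \o (g \o act^~ z) \o par x) y =
    (crd (g x) \o g \o par x) y.
  have := near_par aP (atlas_dom aP x) (near_lsec Ux); apply: filterS => y Uy.
  by rewrite /comp (lsec_angle_act ls z Uy) (lsec_angle_act ls z Ux) crd_mulr.
have H : mdiff (N := S1) (g \o act^~ z) x (v 0) = mdiff g x (v 0).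
  exact: (near_eq_derive (v 0) E).
rewrite /pullf /angular_form -H.
by rewrite -(mdiff_comp (v 0) aP aP aC (act_l_smooth z x) (lsec_angle_smooth ls Uz)).
Qed.

Lemma local_connection_dtheta x : U (proj x) ->
  pullf g angular_form x (fun=> dtheta x) = 1.
Proof.
move=> Ux; have Ux1 : U (proj (act x (circle_one R))) by rewrite act1.
rewrite /pullf /angular_form.
have := mdiff_comp half_vec aC aP aC (act_r_smooth x (circle_one R))
  (lsec_angle_smooth ls Ux1).
rewrite -dtheta_mdiff act1 => <-.
rewrite (@mdiff_eq _ _ _ S1 S1 aC _ (circle_mul (g x))); last first.
  by apply: near_all => z; exact: (lsec_angle_act ls).
by rewrite mdiff_mull mxE divff.
Qed.

End local_connection.

(** A connection form up to normalisation: the value on the generator is a nonnegative function [f]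
    of the base point. Such pairs can be added, and where [f] is positive division by [f] yields a
    connection form. *)
Record partial_connection (psi : dform 1 P) (f : B -> R) : Prop := PartialConnection {
  pconn_form : is_form psi;
  pconn_invariant : invariant_form psi;
  pconn_smooth : forall b, mfun_smooth_at f b;
  pconn_ge0 : forall b, 0 <= f b;
  pconn_dtheta : forall x, psi x (fun=> dtheta x) = f (proj x) }.

(** The angle [g] is controlled over [U] only. Outside, the bump function vanishes near every base
    point, so the product is locally zero there. *)
Lemma partial_connection_at b : exists psi f, partial_connection psi f /\ 0 < f b.
Proof.
have [U [g [sig [Ub ls]]]] := local_section_exists b.
have [rho [srho rho0 rhob rhoU]] := bump_function mB (lsec_open ls) Ub.
pose psi : dform 1 P := fun x v => rho (proj x) * pullf g angular_form x v.
have rhoZ x : ~ U (proj x) -> rho (proj x) = 0 by move=> /rhoU/nbhs_singleton.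
have psiZ x v : ~ U (proj x) -> psi x v = 0 by move=> Ux; rewrite /psi (rhoZ x Ux) mul0r.
have scale_ring (k a s t : R) : k * (a * s + t) = a * (k * s) + k * t by ring.
exists psi, rho; split; last exact: rhob.
split; [ | | |exact: rho0| ].
- apply/(is_form1_at aP); split=> x.
    have [Ux|Ux] := pselect (U (proj x)); last first.
      move=> a v w; rewrite (psiZ x (fun=> a *: v + w) Ux).
      by rewrite (psiZ x (fun=> v) Ux) (psiZ x (fun=> w) Ux) mulr0 addr0.
    have [lx _] := local_connection_form ls Ux.
    move=> a v w; have l := nbhs_singleton lx a v w.
    exact: (etrans (congr1 ( *%R (rho (proj x))) l) (scale_ring _ _ _ _)).
  have [Ux|Ux] := pselect (U (proj x)).
    apply: (form1_at_scale (f := rho \o proj) _ (local_connection_form ls Ux)).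
    exact: (mfun_smooth_at_comp aP aB (proj_smooth x)).
  apply: (form1_at_eq aP (w := fun _ _ => 0)).
    have n0 := near_continuous (msmooth_continuous (proj_smooth x)) (rhoU _ Ux).
    by apply: filterS n0 => x' r0 v; rewrite /psi r0 mul0r.
  split; first by apply: near_all => x' a u v; rewrite mulr0 addr0.
  by move=> p px v; exact: smooth_at_cst.
- move=> z; apply/funext => x; apply/funext => v.
  have [Ux|Ux] := pselect (U (proj x)).
    exact: (f_equal2 *%R (congr1 rho (bundle_proj_act pP x z))
      (local_connection_invariant ls z v Ux)).
  have Uz : ~ U (proj (act x z)) by rewrite (bundle_proj_act pP).
  exact: (etrans (psiZ _ _ Uz) (esym (psiZ _ _ Ux))).
- exact: srho.
- move=> x; have [Ux|Ux] := pselect (U (proj x)).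
    by rewrite /psi (local_connection_dtheta ls Ux) mulr1.
  by rewrite (psiZ x _ Ux) (rhoZ x Ux).
Qed.

Lemma partial_connectionD psi1 f1 psi2 f2 :
  partial_connection psi1 f1 -> partial_connection psi2 f2 ->
  partial_connection (fun x v => psi1 x v + psi2 x v) (fun b => f1 b + f2 b).
Proof.
move=> [F1 I1 S1' G1 D1] [F2 I2 S2 G2 D2]; split.
- have [l1 s1] := iffLR (is_form1_at aP _) F1.
  have [l2 s2] := iffLR (is_form1_at aP _) F2.
  apply/(is_form1_at aP); split=> x; last exact: form1_at_add.
  by move=> a u v; rewrite l1 l2 mulrDr addrACA.
- move=> z; apply/funext => x; apply/funext => v.
  by rewrite /pullf -[in RHS](I1 z) -[in RHS](I2 z).
- by move=> b p pb; exact: (smooth_atD (S1' b p pb) (S2 b p pb)).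
- by move=> b; rewrite addr_ge0.
- by move=> x; rewrite D1 D2.
Qed.

Lemma connection_exists : compact [set: B] -> exists psi : dform 1 P, connection_form psi.
Proof.
move=> cB.
have /choice[F FP] : forall b, exists pf : dform 1 P * (B -> R),
    partial_connection pf.1 pf.2 /\ 0 < pf.2 b.
  by move=> b; have [psi [f H]] := partial_connection_at b; exists (psi, f).
have cf b (c : B) : {for c, continuous (F b).2}.
  have [[_ _ sf _ _] _] := FP b; have cc := atlas_dom aB c.
  have cF := continuous_comp (atlas_crd_continuous aB cc)
    (smooth_at_continuous (sf c c cc)).
  suff -> : {for c, continuous (F b).2} = {for c, continuous (((F b).2 \o par c) \o crd c)} by [].
  rewrite /prop_for/continuous_at /= (atlas_crdK aB cc); apply/propext; split; apply: cvg_trans;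
    apply: near_eq_cvg; have := near_dom aB cc; apply: filterS => c' cc' /=;
    by rewrite (atlas_crdK aB).
have sumP (s : seq B) : exists psi f, partial_connection psi f /\
    forall b c, b \in s -> 0 < (F b).2 c -> 0 < f c.
  elim: s => [|b s [psi [f [pc fp]]]].
    exists (fun _ _ => 0), (fun=> 0); split => //; split => //.
    - apply/(is_form1_at aP); split=> x; first by move=> a u v; rewrite mulr0 addr0.
      split; first by apply: near_all => x' a u v; rewrite mulr0 addr0.
      by move=> p px v; exact: smooth_at_cst.
    - by move=> b p pb; exact: smooth_at_cst.
  have [pcb _] := FP b.
  exists (fun x v => (F b).1 x v + psi x v), (fun c => (F b).2 c + f c).
  split; first exact: partial_connectionD.
  move=> b' c; rewrite inE => /orP[/eqP->|b's] h.
    by rewrite ltr_wpDr//; exact: (pconn_ge0 pc).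
  by rewrite ltr_wpDl//; [exact: (pconn_ge0 pcb)|exact: (fp b')].
(* The filter of all sufficiently large finite lists. With it, the near-covering form of compactness
   yields one list [s0] such that at every point some function indexed by [s0] is positive. *)
pose FS : set (set (seq B)) := [set Q : set (seq B) | exists s0 : seq B, forall s : seq B, {subset s0 <= s} -> Q s].
have FF : Filter FS.
  split.
  - by exists [::].
  - move=> Q1 Q2 [s1 h1] [s2 h2]; exists (s1 ++ s2) => s ss.
    by split; [apply: h1 => c cs|apply: h2 => c cs]; apply: ss; rewrite mem_cat cs ?orbT.
  - by move=> Q1 Q2 Q12 [s1 h1]; exists s1 => s /h1/Q12.
pose Q (s : seq B) (c : B) := exists2 b, b \in s & 0 < (F b).2 c.
have [s0 hs] : FS [set s | [set: B] `<=` Q s].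
  apply: (iffLR (compact_near_coveringP _) cB (seq B) FS Q FF) => c _.
  have [_ fc] := FP c.
  exists ([set c' | 0 < (F c).2 c'], [set s : seq B | c \in s]) => /=.
    split; first exact: (@cvgr_gt _ _ _ _ _ ((F c).2 c) (cf c c) 0 fc).
    by exists [:: c] => s; apply; rewrite inE.
  by move=> [c' s] [/= fc' cs]; exists c.
have [psi [f [[Fp Ip Sp _ Dp] fp]]] := sumP s0.
have f0 c : 0 < f c.
  by have [b bs bc] := hs s0 (fun c cs => cs) c I; exact: (fp b c).
exists (fun x v => (f (proj x))^-1 * psi x v); split.
- have [l s] := iffLR (is_form1_at aP _) Fp.
  apply/(is_form1_at aP); split=> x; first by move=> a u v; rewrite l; ring.
  apply: (form1_at_scale (f := fun x => (f (proj x))^-1) _ (s x)).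
  apply: (mfun_smooth_at_inv aP); first by rewrite gt_eqF.
  exact: (mfun_smooth_at_comp aP aB (proj_smooth x)).
- move=> z; apply/funext => x; apply/funext => v.
  by rewrite /pullf (bundle_proj_act pP) -[in RHS](Ip z).
- by move=> x; rewrite Dp mulVf// gt_eqF.
Qed.

End principal_bundle.

(** * Invariant forms on the trivial bundle *)

Section trivial_bundle.
Context {R : realType} {m : nat} {B : mfd R m}.
Hypothesis aB : is_atlas B.
Notation S1 := (mcircle R).
Notation T := (trivial_bundle B).
Notation one := (circle_one R).

Let aC : is_atlas S1 := circ_atlas.
Let aT : is_atlas T := mprod_atlas aB circ_atlas.

Lemma mdiff_triv_act (b : B) z v :
  mdiff (M := T) (N := T) (fun x => bact x z) (b, one) v = v.
Proof.
rewrite -[RHS](mdiff_id (M := T) (b, one) v aT) /mdiff.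
set f := crd _ \o _ \o _; set h := crd _ \o _ \o _.
suff -> : f = h by [].
by apply/funext => y; congr row_mx; exact: crd_mulr.
Qed.

Lemma triv_dtheta (x : T) : dtheta x = row_mx 0 half_vec.
Proof.
have x1 : bact x one = x.
  by case: x => b z; congr pair; rewrite [LHS]circ_mulC circ_mul1.
have sa : msmooth_at (M := S1) (N := T) (bact x) one.
  exact: (@msmooth_at_pair R m 1 B S1 1 S1 (fun=> x.1) (circle_mul x.2) one aC
    (msmooth_at_cst _ _) (msmooth_at_mull _ _)).
rewrite (dthetaE aT x1 sa).
rewrite (@mdiff_pair R m 1 B S1 aB aC 1 S1 (fun=> x.1) (circle_mul x.2) one half_vec aC
  (msmooth_at_cst _ _) (msmooth_at_mull _ _)).
by rewrite mdiff_cst mdiff_mull.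
Qed.

Context {alpha : dform 1 T} {u : B -> R}.
Hypotheses (falpha : is_form alpha) (ialpha : invariant_form alpha)
  (ualpha : forall x : T, u (bproj x) = alpha x (fun=> dtheta x)).

Let lalpha x : linear1_at alpha x := (iffLR (is_form1_at aT alpha) falpha).1 x.
Let salpha x : form1_at alpha x := (iffLR (is_form1_at aT alpha) falpha).2 x.

(** In the preferred charts the action has identity differential at [(b, one)], so invariance says
    that the components of [alpha] do not depend on the angle. *)
Lemma triv_form_translate b z v : alpha (b, z) v = alpha (b, one) v.
Proof.
have := congr1 (fun w : dform 1 T => w (b, one) v) (ialpha z).
have e : bact ((b, one) : T) z = (b, z) by congr pair; exact: circ_mul1.
rewrite /pullf e => <-; congr (alpha _ _).
by apply/funext => i; rewrite mdiff_triv_act.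
Qed.

Definition base_section (b : B) : T := (b, one).

Definition base_form : dform 1 B := pullf base_section alpha.

Lemma base_section_smooth b : msmooth_at base_section b.
Proof.
exact: (@msmooth_at_pair R m 1 B S1 m B id (fun=> one) b aB
  (msmooth_at_id _ aB) (msmooth_at_cst _ _)).
Qed.

Lemma mdiff_base_section b v : mdiff base_section b v = row_mx v 0.
Proof.
rewrite (@mdiff_pair R m 1 B S1 aB aC m B id (fun=> one) b v aB
  (msmooth_at_id _ aB) (msmooth_at_cst _ _)).
by rewrite mdiff_cst mdiff_id.
Qed.

Lemma base_form1_at b : form1_at base_form b.
Proof. by apply: (form1_at_pull aB aT (base_section_smooth b)); exact: salpha. Qed.

Lemma base_linear1_at b : linear1_at base_form b.
Proof. exact: (linear1_pull aB aT (base_section_smooth b) (lalpha (base_section b))). Qed.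

(** After translation to angle 1, a vector splits into a part tangent to the section [base_section],
    seen by [base_form], and a multiple of the generator [row_mx 0 half_vec], on which [alpha] is
    [u]. The multiple is the value of the angular form. *)
Lemma triv_formE (x : T) v : alpha x (fun=> v) =
  pullf (fst : T -> B) base_form x (fun=> v) +
  u x.1 * pullf (snd : T -> S1) angular_form x (fun=> v).
Proof.
case: x => b z; rewrite triv_form_translate /pullf /base_form /pullf /angular_form.
rewrite (mdiff_snd aB aC (b, z) v).
have -> : (fun _ : 'I_1 => mdiff base_section b (mdiff (M := T) (N := B) fst (b, z) v)) =
    (fun=> row_mx (lsubmx v) 0).
  by apply/funext => i; rewrite (mdiff_fst aB aC (b, z) v) mdiff_base_section.
have ub : u b = alpha (b, one) (fun=> row_mx 0 half_vec).
  rewrite (ualpha (b, one)); congr (alpha _ _); apply/funext => i; exact: triv_dtheta.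
rewrite [(b, z).1]/= ub.
have E : v = 1 *: row_mx (lsubmx v) 0 + ((2 * rsubmx v 0 0) *: row_mx 0 half_vec + 0).
  rewrite scale1r addr0 scale_row_mx scaler0 add_row_mx addr0 add0r -[LHS]hsubmxK.
  by congr row_mx; apply/rowP => j; rewrite !mxE (ord1 j); field.
have l0 := linear1_0 (lalpha (b, one)).
by rewrite {1}E !lalpha l0 mul1r addr0 mulrC.
Qed.

(** [u] is given only through its values. In the product chart at [(b, one)] it is the component of
    [alpha] along the constant vector [row_mx 0 half_vec], restricted to the slice [row_mx y 0],
    hence smooth. *)
Lemma triv_u_smooth b : mfun_smooth_at u b.
Proof.
have bb := atlas_dom aB b; apply: (mfun_smooth_atP aB bb).
have xx := atlas_dom aT (b, one).
have sG : smooth_at (fun y : 'rV[R]_m => row_mx y (0 : 'rV[R]_1)) (crd b b).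
  by apply: smooth_at_row_mx; [exact: smooth_at_id|exact: smooth_at_cst].
have e0 : row_mx (crd b b) 0 = crd (m := m + 1) ((b, one) : T) (b, one) :> 'rV[R]_(m + 1).
  by rewrite /= -[in LHS]circ_one_eq0.
have [_ sa] := salpha (b, one).
have sa' := sa _ xx (row_mx 0 half_vec); rewrite -e0 in sa'.
have sc := @smooth_at_comp _ _ _ ((chart1 alpha (b, one))^~ (row_mx 0 half_vec)) _ _ sG sa'.
apply: smooth_at_eq sc.
have := near_tgt aB bb; apply: filterS => y ty.
have py := par_dom aB ty.
have dy : chart_dom (m := m + 1) ((b, one) : T) (par b y, one).
  by split => //=; exact: (atlas_dom aC one).
have ey : row_mx y 0 = crd (m := m + 1) ((b, one) : T) (par b y, one) :> 'rV[R]_(m + 1).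
  by rewrite /= (crd_parK aB ty) -[in LHS]circ_one_eq0.
rewrite /comp ey (chart1E aT _ _ dy) -[LHS]/(alpha (par b y, one) _).
rewrite (ualpha (par b y, one)); congr (alpha _ _); apply/funext => _.
rewrite triv_dtheta.
have st : smooth_at (crd (par b y) \o par b) (crd b (par b y)).
  by apply: (transition_at aB py); exact: (atlas_dom aB).
have sl : smooth_at (fun w : 'rV[R]_(m + 1) => lsubmx w) (row_mx (crd b (par b y)) (crd (one : S1) one)).
  by apply: (@smooth_at_lsubmx _ _ _ _ id); exact: smooth_at_id.
have sr : smooth_at (fun w : 'rV[R]_(m + 1) => rsubmx w) (row_mx (crd b (par b y)) (crd (one : S1) one)).
  by apply: (@smooth_at_rsubmx _ _ _ _ id); exact: smooth_at_id.
(* Passing from the chart at [(b, one)] to the preferred chart at [(par b y, one)] leaves the circle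
   coordinate alone, so the generator keeps its components. *)
have E : (crd (m := m + 1) ((par b y, one) : T) \o par (m := m + 1) ((b, one) : T)) =
    (fun w => row_mx ((crd (par b y) \o par b) (lsubmx w)) (rsubmx w)).
  by apply/funext => w; congr row_mx; exact: circ_crd_par.
rewrite E /= derive_row_mx//; last first.
  by apply: (@smooth_at_comp_rV _ _ _ _ (crd (par b y) \o par b) lsubmx) => //; rewrite row_mxKl.
rewrite derive_rsubmx; last exact: smooth_at_id.
rewrite derive_id row_mxKr; congr row_mx.
rewrite (derive_comp (g := lsubmx) (f := crd (par b y) \o par b)).
- by rewrite derive_lsubmx ?derive_id ?row_mxKl ?derive0//; exact: smooth_at_id.
- exact: smooth_at_differentiable.
- by rewrite row_mxKl; exact: smooth_at_differentiable.
Qed.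

End trivial_bundle.

(** * Alternating forms and the wedge product *)

Section alternating_forms.
Context {R : realType}.

Definition upd (k : nat) (T : Type) (v : 'I_k -> T) (i : 'I_k) (z : T) : 'I_k -> T :=
  fun j => if j == i then z else v j.

Lemma upd_id k T (v : 'I_k -> T) i : upd v i (v i) = v.
Proof. by apply/funext => j; rewrite /upd; case: eqP => [->|]. Qed.

Lemma upd_eq k T (v : 'I_k -> T) i z : upd v i z i = z.
Proof. by rewrite /upd eqxx. Qed.

Lemma upd_neq k T (v : 'I_k -> T) i j z : j != i -> upd v i z j = v j.
Proof. by rewrite /upd => /negPf->. Qed.

Lemma updC k T (v : 'I_k -> T) i j x y : i != j ->
  upd (upd v i x) j y = upd (upd v j y) i x.
Proof.
move=> ij; apply/funext => l; rewrite /upd; case: (eqVneq l j) => [->|//].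
by rewrite eq_sym (negPf ij).
Qed.

Lemma slot_linearP k m (w : ('I_k -> 'rV[R]_m) -> R) : slot_linear w <->
  forall v i a x y, w (upd v i (a *: x + y)) = a * w (upd v i x) + w (upd v i y).
Proof. by []. Qed.

Section one_form.
Context {k m : nat} (w : ('I_k -> 'rV[R]_m) -> R).
Hypotheses (lw : slot_linear w) (aw : slot_alternating w).

Lemma slotD v i x y : w (upd v i (x + y)) = w (upd v i x) + w (upd v i y).
Proof. by have := lw v i 1 x y; rewrite /= scale1r mul1r. Qed.

Lemma slot0 v i : w (upd v i 0) = 0.
Proof.
have := slotD v i 0 0; rewrite addr0 => /eqP.
by rewrite -subr_eq0 opprD addNKr oppr_eq0 => /eqP.
Qed.

Lemma slotZ v i a x : w (upd v i (a *: x)) = a * w (upd v i x).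
Proof. by have := lw v i a x 0; rewrite /= addr0 -!/(upd _ _ _) slot0 addr0. Qed.

Lemma slot_sum v i I (s : seq I) (f : I -> 'rV[R]_m) :
  w (upd v i (\sum_(j <- s) f j)) = \sum_(j <- s) w (upd v i (f j)).
Proof.
elim: s => [|j s IH]; first by rewrite !big_nil slot0.
by rewrite !big_cons slotD IH.
Qed.

Lemma alt_swap v i j x y : i != j ->
  w (upd (upd v i x) j y) = - w (upd (upd v i y) j x).
Proof.
move=> ij; have E z : w (upd (upd v i z) j z) = 0.
  by apply: (aw ij); rewrite upd_eq upd_neq ?upd_eq.
have := E (x + y); rewrite slotD !(updC _ _ _ ij) !slotD -!(updC _ _ _ ij) !E.
by rewrite add0r addr0 addrC => /eqP; rewrite addr_eq0 => /eqP.
Qed.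

Lemma alt_tperm v i j : i != j -> w (fun l => v (tperm i j l)) = - w v.
Proof.
move=> ij; rewrite -[in RHS](upd_id v i) -[in RHS](upd_id (upd v i (v i)) j).
rewrite (upd_neq _ _ (_ : j != i)) 1?eq_sym// alt_swap// opprK; congr w.
apply/funext => l; rewrite /upd; case: tpermP => [->|->|/eqP/negPf-> /eqP/negPf->//].
  by rewrite eqxx; case: eqP => // ->.
by rewrite eqxx.
Qed.

Lemma alt_perm v (s : {perm 'I_k}) : w (fun l => v (s l)) = (-1) ^+ s * w v.
Proof.
have [ts -> dts] := prod_tpermP s.
elim: ts dts v => [_|t ts IH /= /andP[dt dts]] v.
  rewrite big_nil odd_perm1 mul1r; congr w; apply/funext => l.
  by rewrite perm1.
rewrite big_cons odd_mul_tperm dt.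
pose u l := v ((\prod_(t <- ts) tperm t.1 t.2)%g l).
transitivity (w (fun l => u (tperm t.1 t.2 l))).
  by congr w; apply/funext => l; rewrite /u permM.
by rewrite (alt_tperm u dt) IH// signr_addb mulN1r mulNr.
Qed.

End one_form.

(** On basis vectors with a repetition [g] vanishes by alternation; without repetition they are a
    permutation of the standard frame. Multilinearity does the rest. *)
Lemma alt_zero m (g : ('I_m -> 'rV[R]_m) -> R) : slot_linear g -> slot_alternating g ->
  g (fun i => delta_mx 0 i) = 0 -> forall v, g v = 0.
Proof.
move=> lg ag g0.
have gb (f : 'I_m -> 'I_m) : g (fun i => delta_mx 0 (f i)) = 0.
  have [/injectiveP fi|] := boolP (injectiveb f).
    have := alt_perm lg ag (fun i => delta_mx 0 i) (perm fi); rewrite g0 mulr0 => <-.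
    by congr g; apply/funext => i; rewrite permE.
  by move=> /injectivePn[i [j ij fij]]; apply: (ag _ _ _ ij); rewrite fij.
(* [s] lists the slots not yet reduced to basis vectors; the induction expands one of them at a
   time. *)
suff H (s : seq 'I_m) v : (forall i, i \notin s -> exists j, v i = delta_mx 0 j) -> g v = 0.
  by move=> v; apply: (H (enum 'I_m)) => i; rewrite mem_enum.
elim: s v => [|i s IH] v vb.
  have /choice[f fE] : forall i, exists j, v i = delta_mx 0 j by move=> i; exact: vb.
  by rewrite (_ : v = fun i => delta_mx 0 (f i)) ?gb//; exact/funext.
rewrite -(upd_id v i) [v i]row_sum_delta slot_sum// big1// => j _.
rewrite slotZ// IH ?mulr0// => l ls.
have [->|li] := eqVneq l i; first by exists j; rewrite upd_eq.
by rewrite upd_neq//; apply: vb; rewrite inE negb_or li.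
Qed.

Definition frame_mx m (v : 'I_m -> 'rV[R]_m) : 'M[R]_m := \matrix_(i, j) v i 0 j.

Lemma det_slot_linear m : slot_linear (fun v : 'I_m -> 'rV[R]_m => \det (frame_mx v)).
Proof.
move=> v i a x y put.
have R' z z' : row' i (frame_mx (put z)) = row' i (frame_mx (put z')).
  by apply/matrixP => p q; rewrite !mxE /put eq_sym (negPf (neq_lift _ _)).
have Ri : row i (frame_mx (put (a *: x + y))) =
    a *: row i (frame_mx (put x)) + 1 *: row i (frame_mx (put y)).
  by apply/rowP => j; rewrite !mxE /put eqxx !mxE mul1r.
by rewrite (determinant_multilinear Ri (R' _ _) (R' _ _)) mul1r.
Qed.

Lemma det_slot_alternating m : slot_alternating (fun v : 'I_m -> 'rV[R]_m => \det (frame_mx v)).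
Proof.
move=> v i j ij vij; apply: (determinant_alternate ij) => l.
by rewrite !mxE vij.
Qed.

(** Uniqueness of the determinant: the difference of the two sides is alternating, multilinear and
    zero on the standard frame. *)
Lemma top_form m (f : ('I_m -> 'rV[R]_m) -> R) v : slot_linear f -> slot_alternating f ->
  f v = f (fun i => delta_mx 0 i) * \det (frame_mx v).
Proof.
move=> lf af; apply/eqP; rewrite -subr_eq0; apply/eqP.
pose g u := f u - f (fun i => delta_mx 0 i) * \det (frame_mx u).
apply: (@alt_zero m g).
- move=> u i a x y put; rewrite /g lf -/put det_slot_linear -/put; ring.
- by move=> u i j ij uij; rewrite /g (af u i j)// (det_slot_alternating ij uij) mulr0 subr0.
- rewrite /g (_ : frame_mx _ = 1%:M) ?det1 ?mulr1 ?subrr//.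
  by apply/matrixP => i j; rewrite !mxE eqxx /= eq_sym.
Qed.

End alternating_forms.

Section pointwise_wedge.
Context {R : realType}.

(** [wedgef] at one point, with vectors in any type [T]. It commutes by definition with a map
    applied to the vectors, which lets the tangent space of [P] be replaced by $\mathbb
    R\times\mathbb R^m$. *)
Definition pwedge k l (T : Type) (w : ('I_k -> T) -> R) (t : ('I_l -> T) -> R)
    (v : 'I_(k + l) -> T) : R :=
  (k`!%:R * l`!%:R)^-1 *
    \sum_(s : {perm 'I_(k + l)}) (-1) ^+ s *
      w (fun i => v (s (lshift l i))) * t (fun j => v (s (rshift k j))).

Fixpoint pwedge_exp k (T : Type) (w : ('I_k -> T) -> R) n : ('I_(n * k) -> T) -> R :=
  if n is n'.+1 then @pwedge k (n' * k) T w (@pwedge_exp k T w n') else fun=> 1.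

Lemma wedgef_expE k m (M : mfd R m) (w : dform k M) n p :
  wedgef_exp w n p = pwedge_exp (w p) (n := n).
Proof. by elim: n => [//|n IH]; apply/funext => v /=; rewrite -IH. Qed.

Lemma pwedge_exp_comp k (S T : Type) (L : S -> T) (w : ('I_k -> T) -> R) n v :
  pwedge_exp (fun u => w (fun i => L (u i))) v = @pwedge_exp k T w n (fun i => L (v i)).
Proof.
elim: n v => [//|n IH] v /=; rewrite /pwedge; congr (_ * _).
by apply: eq_bigr => s _; rewrite IH.
Qed.

Section multilinear.
Context {k l m : nat} (w : ('I_k -> 'rV[R]_m) -> R) (t : ('I_l -> 'rV[R]_m) -> R).

(** Reindexing the sum by composition with the transposition of [i] and [j] fixes both factors and
    flips the sign, so the sum equals its opposite. *)
Lemma pwedge_alternating : slot_alternating (pwedge w t).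
Proof.
move=> v i j ij vij; rewrite /pwedge; set S := \sum_s _.
suff : S = - S.
  move=> /eqP; rewrite -subr_eq0 opprK -mulr2n mulrn_eq0/= => /eqP->.
  by rewrite mulr0.
rewrite {1}/S (reindex_inj (mulIg (tperm i j)))/= -sumrN; apply: eq_bigr => s _.
have E x : v ((s * tperm i j)%g x) = v (s x).
  by rewrite permM; case: tpermP => // ->.
have -> : (fun a => v ((s * tperm i j)%g (lshift l a))) = (fun a => v (s (lshift l a))).
  by apply/funext => a.
have -> : (fun a => v ((s * tperm i j)%g (rshift k a))) = (fun a => v (s (rshift k a))).
  by apply/funext => a.
by rewrite odd_permM odd_tperm ij signr_addb expr1 mulrN1 !mulNr.
Qed.

Hypotheses (lw : slot_linear w) (lt : slot_linear t).

(** In the summand of [s], the slot [i] is read by exactly one of [w] and [t], according to the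
    block that contains the preimage of [i] under [s]. *)
Lemma pwedge_linear : slot_linear (pwedge w t).
Proof.
move=> v i a x y put; rewrite /pwedge mulrCA -mulrDr; congr (_ * _).
rewrite mulr_sumr -big_split; apply: eq_bigr => s _ /=.
have putE z : put z = upd v i z by [].
have R1 (e X Y Z : R) : e * (a * X + Y) * Z = a * (e * X * Z) + e * Y * Z by ring.
have R2 (e X Y Z : R) : e * Z * (a * X + Y) = a * (e * Z * X) + e * Z * Y by ring.
have updl z c : s (lshift l c) = i ->
    (fun b => put z (s (lshift l b))) = upd (fun b => v (s (lshift l b))) c z /\
    (fun b => put z (s (rshift k b))) = (fun b => v (s (rshift k b))).
  move=> si; split; apply/funext => b; rewrite putE /upd -si (inj_eq perm_inj).
    by rewrite (inj_eq (@lshift_inj _ _)).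
  by rewrite eq_rlshift.
have updr z c : s (rshift k c) = i ->
    (fun b => put z (s (rshift k b))) = upd (fun b => v (s (rshift k b))) c z /\
    (fun b => put z (s (lshift l b))) = (fun b => v (s (lshift l b))).
  move=> si; split; apply/funext => b; rewrite putE /upd -si (inj_eq perm_inj).
    by rewrite (inj_eq (@rshift_inj _ _)).
  by rewrite eq_lrshift.
case: (split_ordP ((s^-1)%g i)) => c sc.
  have si : s (lshift l c) = i by rewrite -sc permKV.
  have [e1 e2] := updl x c si; have [e3 e4] := updl y c si.
  have [e5 e6] := updl (a *: x + y) c si.
  rewrite e1 e2 e3 e4 e5 e6 (iffLR (slot_linearP w) lw); exact: R1.
have si : s (rshift k c) = i by rewrite -sc permKV.
have [e1 e2] := updr x c si; have [e3 e4] := updr y c si.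
have [e5 e6] := updr (a *: x + y) c si.
rewrite e1 e2 e3 e4 e5 e6 (iffLR (slot_linearP t) lt); exact: R2.
Qed.

End multilinear.

Lemma pwedge_exp_linear k m (w : ('I_k -> 'rV[R]_m) -> R) n :
  slot_linear w -> slot_linear (@pwedge_exp k _ w n).
Proof.
by move=> lw; elim: n => [v []//|n IH]; exact: (pwedge_linear lw IH).
Qed.

Section continuity.
Context {X : topologicalType} {T : Type}.

Lemma pwedge_continuous k l (w : X -> ('I_k -> T) -> R) (t : X -> ('I_l -> T) -> R) x v :
  (forall u, {for x, continuous (w^~ u)}) -> (forall u, {for x, continuous (t^~ u)}) ->
  {for x, continuous (fun y => pwedge (w y) (t y) v)}.
Proof.
move=> cw ct; have Fx : Filter (nbhs x) by exact: nbhs_filter.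
have cc (c : R) : {for x, continuous (fun=> c : R)} by exact: cst_continuous.
have cM (f g : X -> R) : {for x, continuous f} -> {for x, continuous g} ->
    {for x, continuous (fun y => f y * g y)}.
  by move=> cf cg; exact: (@cvgM R _ _ Fx _ _ _ _ cf cg).
apply: (cM _ _ (cc _)); elim: (index_enum _) => [|s r IH].
  by rewrite (_ : (fun y => _) = (fun=> 0)) //; apply/funext => y; rewrite big_nil.
rewrite (_ : (fun y => _) = (fun y => (-1) ^+ s *
  w y (fun i => v (s (lshift l i))) * t y (fun j => v (s (rshift k j))) +
  \sum_(s <- r) (-1) ^+ s *
  w y (fun i => v (s (lshift l i))) * t y (fun j => v (s (rshift k j))))); last first.
  by apply/funext => y; rewrite big_cons.
have c1 := cM _ _ (cM _ _ (cc ((-1) ^+ s)) (cw (fun i => v (s (lshift l i)))))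
  (ct (fun j => v (s (rshift k j)))).
exact: (@cvgD R _ _ _ Fx _ _ _ _ c1 IH).
Qed.

Lemma pwedge_exp_continuous k (w : X -> ('I_k -> T) -> R) n x v :
  (forall u, {for x, continuous (w^~ u)}) ->
  {for x, continuous (fun y => @pwedge_exp k T (w y) n v)}.
Proof.
move=> cw; elim: n v => [|n IH] v; first exact: (@cst_continuous _ _ (1 : R) x).
exact: (pwedge_continuous (w := w) (t := fun y => @pwedge_exp k T (w y) n)).
Qed.

End continuity.

End pointwise_wedge.

(** * Volume forms on $\mathbb R\times\mathbb R^m$ *)

Section volume.
Context {R : realType} {m : nat}.
Implicit Types (vol : ('I_m -> 'rV[R]_m) -> R) (a : ('I_1 -> 'rV[R]_(1 + m)) -> R).

Definition std_frame N : 'I_N -> 'rV[R]_N := fun i => delta_mx 0 i.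

Definition pr_form vol (v : 'I_m -> 'rV[R]_(1 + m)) : R := vol (fun i => rsubmx (v i)).

Definition fst_form (v : 'I_1 -> 'rV[R]_(1 + m)) : R := v 0 0 (lshift m 0).

Lemma pr_form_linear vol : slot_linear vol -> slot_linear (pr_form vol).
Proof.
move=> lv v i c x y put; rewrite /pr_form /put.
have E z : (fun j => rsubmx (if j == i then z else v j)) =
    upd (fun j => rsubmx (v j)) i (rsubmx z).
  by apply/funext => j; rewrite /upd; case: eqP.
rewrite !E -(iffLR (slot_linearP vol) lv); congr (vol (upd _ _ _)).
by apply/rowP => j; rewrite !mxE.
Qed.

Lemma fst_form_linear : slot_linear fst_form.
Proof. by move=> v i c x y put; rewrite /fst_form /put (ord1 i) eqxx !mxE. Qed.

Lemma rsubmx_std_frame (s : {perm 'I_(1 + m)}) j :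
  s (rshift 1 j) = lshift m 0 -> rsubmx (std_frame (s (rshift 1 j))) = 0 :> 'rV[R]_m.
Proof. by move=> ->; apply/rowP => i; rewrite !mxE eq_rlshift andbF. Qed.

(** Only the value of the 1-form on the vertical basis vector matters: whenever that vector is fed
    to [vol] instead, its projection is 0 and the summand vanishes. *)
Lemma pwedge_vol_eq a a' vol : slot_linear vol ->
  a (fun=> std_frame (lshift m 0)) = a' (fun=> std_frame (lshift m 0)) ->
  pwedge a (pr_form vol) (std_frame (N := 1 + m)) =
  pwedge a' (pr_form vol) (std_frame (N := 1 + m)).
Proof.
move=> lv aa; rewrite /pwedge; congr (_ * _); apply: eq_bigr => s _.
case: (split_ordP ((s^-1)%g (lshift m 0))) => c sc.
  have si i : s (lshift m i) = lshift m 0.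
    by rewrite (ord1 i) -[X in s (lshift m X)](ord1 c) -sc permKV.
  congr (_ * _ * _); rewrite (_ : (fun i => _) = (fun=> std_frame (lshift m 0)))//.
  by apply/funext => i; rewrite si.
have si : s (rshift 1 c) = lshift m 0 by rewrite -sc permKV.
suff -> : pr_form vol (fun j => std_frame (s (rshift 1 j))) = 0 by rewrite !mulr0.
rewrite /pr_form -(upd_id (fun j => rsubmx (std_frame (s (rshift 1 j)))) c).
by rewrite (rsubmx_std_frame si) slot0.
Qed.

(** Every permutation fixing the vertical index contributes the same nonzero number [e] and the
    others contribute 0; the identity shows that the count is positive. *)
Lemma pwedge_vol_neq0 vol : slot_linear vol -> slot_alternating vol ->
  (exists v, vol v <> 0) -> pwedge fst_form (pr_form vol) (std_frame (N := 1 + m)) <> 0.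
Proof.
move=> lv av [v0 volv0]; set e := vol (std_frame (N := m)).
have e0 : e != 0.
  apply/eqP => e0; apply: volv0.
  by rewrite (top_form v0 lv av) -[X in X * _]/e e0 mul0r.
have T s : (-1) ^+ (odd_perm s) * fst_form (fun i => std_frame (s (lshift m i))) *
    pr_form vol (fun j => std_frame (s (rshift 1 j))) =
    (s (lshift m 0) == lshift m 0)%:R * e.
  case: (split_ordP ((s^-1)%g (lshift m 0))) => c sc.
    have s0 : s (lshift m 0) = lshift m 0 by rewrite -[X in s (lshift m X)](ord1 c) -sc permKV.
    rewrite s0 eqxx mul1r /fst_form s0 !mxE !eqxx mulr1 /pr_form.
    rewrite (top_form _ lv av) -/(std_frame (N := m)) -/e.
    (* Since [s] fixes the vertical index, its permutation matrix is block triangular with corner 1,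
       so its sign is the determinant of the remaining block. The two signs then cancel. *)
    have -> : \det (frame_mx (fun j => rsubmx (std_frame (s (rshift 1 j))))) = (-1) ^+ s.
      rewrite -det_perm -[in RHS](submxK (perm_mx s)).
      have -> : ursubmx (perm_mx s : 'M[R]_(1 + m)) = 0.
        apply/matrixP => i j; rewrite !mxE (ord1 i) s0.
        by rewrite eq_lrshift.
      rewrite det_lblock [X in X * _](_ : _ = 1) ?mul1r; last first.
        by rewrite [ulsubmx _]mx11_scalar det_scalar1 !mxE s0 eqxx.
      by congr (\det _); apply/matrixP => i j; rewrite !mxE eq_sym.
    by rewrite mulrCA -expr2 sqrr_sign mulr1.
  have si : s (rshift 1 c) = lshift m 0 by rewrite -sc permKV.
  have -> : (s (lshift m 0) == lshift m 0) = false.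
    by rewrite -{2}si (inj_eq perm_inj) eq_lrshift.
  suff -> : pr_form vol (fun j => std_frame (s (rshift 1 j))) = 0 by rewrite mulr0 mul0r.
  rewrite /pr_form -(upd_id (fun j => rsubmx (std_frame (s (rshift 1 j)))) c).
  by rewrite (rsubmx_std_frame si) slot0.
rewrite /pwedge (eq_bigr _ (fun s _ => T s)) -mulr_suml; apply/eqP.
rewrite !mulf_neq0// ?invr_neq0// ?mulf_neq0// ?pnatr_eq0 -?lt0n ?fact_gt0//.
rewrite -natr_sum pnatr_eq0 -lt0n (bigD1 1%g)//= perm1 eqxx.
by rewrite addn_gt0.
Qed.

(** The constant is the same for all 1-forms with value 1 on the vertical vector, so the orientation
    of a frame does not depend on the connection form that tests it. *)
Lemma pwedge_vol_det a vol v : slot_linear a -> slot_linear vol ->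
  a (fun=> std_frame (lshift m 0)) = 1 ->
  pwedge a (pr_form vol) v =
  pwedge fst_form (pr_form vol) (std_frame (N := 1 + m)) * \det (frame_mx v).
Proof.
move=> la lv a1.
rewrite (top_form v (pwedge_linear la (pr_form_linear lv)) (pwedge_alternating _ _)).
congr (_ * _); apply: pwedge_vol_eq => //.
by rewrite a1 /fst_form !mxE !eqxx.
Qed.

End volume.

(** * The contact condition *)

Section bilinear_d.
Context {R : realType}.

Lemma dderiv_dirP (V : normedModType R) (f : V -> R) a u v x : smooth_fun_at f x ->
  dderiv f (a *: u + v) x = a * dderiv f u x + dderiv f v x.
Proof.
move=> /smooth_at_differentiable df; rewrite /dderiv !deriveE//.
exact: linearP.
Qed.

Definition linear_fun (V : lmodType R) (f : V -> R) : Prop :=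
  forall a u v, f (a *: u + v) = a * f u + f v.

Definition bilinear_fun (V : lmodType R) (f : V -> V -> R) : Prop :=
  (forall v, linear_fun (f^~ v)) /\ (forall u, linear_fun (f u)).

Lemma slot_linear_bilinear m (f : 'rV[R]_m -> 'rV[R]_m -> R) :
  bilinear_fun f -> slot_linear (fun w : 'I_2 -> 'rV[R]_m => f (w 0) (w 1)).
Proof.
move=> [fl fr] v i a x y put.
have : i = 0 \/ i = 1.
  by case: i {put} => -[|[|//]] ilt; [left|right]; exact: val_inj.
by rewrite /put => -[]->; rewrite ?eqxx /=; [exact: fl|exact: fr].
Qed.

Lemma chart_d_bilinear m (w : 'rV[R]_m -> 'rV[R]_m -> R) y :
  (\forall z \near y, forall v, w z v = \sum_j v 0 j * w z (delta_mx 0 j)) ->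
  (forall v, smooth_fun_at (w^~ v) y) -> bilinear_fun (chart_d w y).
Proof.
move=> lw sw.
have E a u u' v : dderiv (w^~ (a *: u + u')) v y = a * dderiv (w^~ u) v y + dderiv (w^~ u') v y.
  rewrite (@dderiv_eq _ _ _ (fun z => a * w z u + w z u')).
    rewrite dderivD; last exact: sw.
      by rewrite (dderivZ _ _ (sw u)).
    by apply: (smooth_atM _ (sw u)); exact: smooth_at_cst.
  apply: filterS lw => z lz; rewrite lz (lz u) (lz u') mulr_sumr -big_split.
  by apply: eq_bigr => j _ /=; rewrite !mxE; ring.
have L v : linear_fun ((chart_d w y)^~ v).
  by move=> a u u'; rewrite /chart_d (E a u u' v) (dderiv_dirP _ _ _ (sw v)); ring.
split=> // u a v v'.
have S s t : chart_d w y s t = - chart_d w y t s by rewrite /chart_d opprB.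
by rewrite S (L u a v v') (S u v) (S u v'); ring.
Qed.

End bilinear_d.

Section model_forms.
Context {R : realType} {m : nat}.
Implicit Types (b c : 'rV[R]_m -> R) (d F : 'rV[R]_m -> 'rV[R]_m -> R).

(* [b + u dt] and its would-be derivative [d + c /\ dt + F] on [R x R^m]. *)
Definition model1 b (u : R) (w : 'I_1 -> 'rV[R]_(1 + m)) : R :=
  b (rsubmx (w 0)) + u * w 0 0 (lshift m 0).

Definition model2 d c F (w : 'I_2 -> 'rV[R]_(1 + m)) : R :=
  d (rsubmx (w 0)) (rsubmx (w 1)) +
  (c (rsubmx (w 0)) * w 1 0 (lshift m 0) - c (rsubmx (w 1)) * w 0 0 (lshift m 0)) +
  F (rsubmx (w 0)) (rsubmx (w 1)).

Lemma rsubmxP a (u v : 'rV[R]_(1 + m)) :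
  rsubmx (a *: u + v) = a *: rsubmx u + rsubmx v.
Proof. by apply/rowP => j; rewrite !mxE. Qed.

Lemma model1_linear b u : linear_fun b -> slot_linear (model1 b u).
Proof.
move=> lb v i a x y put; rewrite /model1 /put (ord1 i) eqxx rsubmxP lb !mxE; ring.
Qed.

Lemma model2_linear d c F : bilinear_fun d -> linear_fun c -> bilinear_fun F ->
  slot_linear (model2 d c F).
Proof.
move=> [dl dr] lc [Fl Fr].
apply: (@slot_linear_bilinear _ _ (fun x y : 'rV[R]_(1 + m) => d (rsubmx x) (rsubmx y) +
  (c (rsubmx x) * y 0 (lshift m 0) - c (rsubmx y) * x 0 (lshift m 0)) +
  F (rsubmx x) (rsubmx y))).
split=> [v a u u'|v a u u']; rewrite !rsubmxP.
  by rewrite (dl _ a) lc (Fl _ a) !mxE; ring.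
by rewrite (dr _ a) lc (Fr _ a) !mxE; ring.
Qed.

Definition pair_vec (t : R) (h : 'rV[R]_m) : 'rV[R]_(1 + m) := row_mx (const_mx t) h.

Lemma pair_vec_fst t h : pair_vec t h 0 (lshift m 0) = t.
Proof. by rewrite row_mxEl mxE. Qed.

Lemma pair_vec_snd t h : rsubmx (pair_vec t h) = h.
Proof. by rewrite row_mxKr. Qed.

Lemma model1E b u (t : 'I_1 -> R) (h : 'I_1 -> 'rV[R]_m) :
  model1 b u (fun i => pair_vec (t i) (h i)) = b (h 0) + u * t 0.
Proof. by rewrite /model1 pair_vec_fst pair_vec_snd. Qed.

Lemma model2E d c F (t : 'I_2 -> R) (h : 'I_2 -> 'rV[R]_m) :
  model2 d c F (fun i => pair_vec (t i) (h i)) =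
  d (h 0) (h 1) + (c (h 0) * t 1 - c (h 1) * t 0) + F (h 0) (h 1).
Proof. by rewrite /model2 !pair_vec_fst !pair_vec_snd. Qed.

Lemma pair_vecK (w : 'rV[R]_(1 + m)) : pair_vec (w 0 (lshift m 0)) (rsubmx w) = w.
Proof.
rewrite -[RHS]hsubmxK; congr row_mx; apply/rowP => j.
by rewrite !mxE (ord1 j).
Qed.

(** The vertical coordinate is one column of the frame matrix; this is the origin of the factor [e]
    in the contact volume. *)
Lemma det_pair_vec_scale e (t : 'I_(1 + m) -> R) (h : 'I_(1 + m) -> 'rV[R]_m) :
  \det (frame_mx (fun i => pair_vec (e * t i) (h i))) =
  e * \det (frame_mx (fun i => pair_vec (t i) (h i))).
Proof.
pose D : 'rV[R]_(1 + m) := pair_vec e (const_mx 1).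
have -> : frame_mx (fun i => pair_vec (e * t i) (h i)) =
    frame_mx (fun i => pair_vec (t i) (h i)) *m diag_mx D.
  apply/matrixP => i j; rewrite mul_mx_diag [LHS]mxE [RHS]mxE [X in _ = X * _]mxE.
  case: (split_ordP j) => k ->.
    by rewrite /D !row_mxEl !mxE mulrC.
  by rewrite /D !row_mxEr mxE mulr1.
rewrite det_mulmx det_diag big_split_ord /= mulrC; congr (_ * _).
rewrite big_ord1 [X in _ * X]big1 ?mulr1; last by move=> i _; rewrite row_mxEr mxE.
by rewrite row_mxEl mxE.
Qed.

End model_forms.

Lemma pwedge_comp (R : realType) k l (S T : Type) (L : S -> T) (w : ('I_k -> T) -> R)
    (t : ('I_l -> T) -> R) v :
  pwedge (fun u => w (fun i => L (u i))) (fun u => t (fun i => L (u i))) v =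
  pwedge w t (fun i => L (v i)).
Proof. by []. Qed.

Lemma in_chart_self (R : realType) k m (M : mfd R m) (w : dform k M) (x : M) v :
  is_atlas M -> in_chart w x (crd x x) v = w x v.
Proof.
move=> aM; rewrite /in_chart (atlas_crdK aM (atlas_dom aM x)).
by congr (w x _); apply/funext => i; exact: (mdiff_id x (v i) aM).
Qed.

Lemma in_chart_linear (R : realType) k m (M : mfd R m) (w : dform k M) (q x : M) :
  is_atlas M -> chart_dom q x -> slot_linear (w x) -> slot_linear (in_chart w q (crd q x)).
Proof.
move=> aM qx lw v i a y y' put; rewrite /in_chart (atlas_crdK aM qx).
set D := fun z => 'D_z (crd x \o par q) (crd q x).
have DE z : (fun j => 'D_(put z j) (crd x \o par q) (crd q x)) =
    (fun j => if j == i then D z else D (v j)).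
  by apply/funext => j; rewrite /put /D; case: ifP.
have DP : D (a *: y + y') = a *: D y + D y'.
  have dt : differentiable (crd x \o par q) (crd q x).
    apply: smooth_at_differentiable; apply: (transition_at aM qx).
    exact: (atlas_dom aM).
  by rewrite /D !deriveE// linearP.
have key := lw (fun j => D (v j)) i a (D y) (D y'); rewrite -DP in key.
exact: (etrans (congr1 (w x) (DE _)) (etrans key (esym
  (f_equal2 (fun s t => a * s + t) (congr1 (w x) (DE y)) (congr1 (w x) (DE y')))))).
Qed.

(** Reading the vertical coordinate as [e] times [psi] absorbs the [e] of $e\,du\wedge\psi$; only
    the curvature term keeps it. *)
Lemma contact_ring (R : realType) (e A C0 C1 p0 p1 U D : R) :
  A + (e * C0 * p1 - e * C1 * p0 + e * U * D) =
  A + (C0 * (e * p1) - C1 * (e * p0)) + e * U * D.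
Proof. by ring. Qed.

(** * The contact condition in the splitting given by a connection form *)

Section pulled_back_contact.
Opaque dderiv chart_d.
Context {R : realType} {n : nat} {B : mfd R (n * 2)} {P : bundle B}.
Notation m := (n * 2)%N.
Notation proj := (@bproj R m B P).
Hypotheses (aB : is_atlas B) (aP : is_atlas P).
Context {beta : dform 1 B} {u : B -> R} {psi : dform 1 P} {x : P} {q : B}.
Hypotheses (sproj : msmooth_at proj x) (qx : chart_dom q (proj x))
  (fbeta : form1_at beta (proj x)) (su : mfun_smooth_at u (proj x))
  (fpsi : form1_at psi x).

Let G := crd q \o proj \o par x.
Let Y := crd q (proj x).
Let xx : chart_dom x x := atlas_dom aP x.

Definition contact_family (e : R) : dform 1 P :=
  fun x v => pullf proj beta x v + (e * u (proj x)) * psi x v.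

Lemma pull_chart1 v : pullf proj beta x (fun=> v) = chart1 beta q Y ('D_v G (crd x x)).
Proof. by rewrite -(chart1_self aP) (chart1_pull aP aB beta v sproj xx qx). Qed.

Lemma dderiv_base (f : B -> R) v : mfun_smooth_at f (proj x) ->
  dderiv (f \o proj \o par x) v (crd x x) = dderiv (f \o par q) ('D_v G (crd x x)) Y.
Proof.
move=> sf; have [_ sG] := sproj.
have GY : G (crd x x) = Y by rewrite /G /Y /= (atlas_crdK aP xx).
rewrite -[in RHS]GY -(@dderiv_comp _ _ _ (f \o par q) G v (crd x x)).
- apply: dderiv_eq.
  have nq := near_continuous (msmooth_continuous sproj) (near_dom aB qx).
  by have := near_par aP xx nq; apply: filterS => y qy; rewrite /G /= (atlas_crdK aB qy).
- exact: (sG x q xx qx).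
- by rewrite GY; exact: (sf q qx).
Qed.

Lemma ext_d_contact_family e v F : ext_d psi x v = F ('D_(v 0) G (crd x x)) ('D_(v 1) G (crd x x)) ->
  ext_d (contact_family e) x v =
  model2 (chart_d (chart1 beta q) Y) (fun h => dderiv (u \o par q) h Y)
    (fun h h' => e * u (proj x) * F h h')
    (fun i => pair_vec (e * psi x (fun=> v i)) ('D_(v i) G (crd x x))).
Proof.
move=> dpsi.
have seu : mfun_smooth_at (fun b => e * u b) (proj x).
  by move=> p px; apply: (smooth_atM _ (su px)); exact: smooth_at_cst.
have seup := mfun_smooth_at_comp aP aB sproj seu.
have f1 := form1_at_pull aP aB sproj fbeta.
have f2 := form1_at_scale seup fpsi.
have E h : dderiv ((fun b => e * u b) \o par q) h Y = e * dderiv (u \o par q) h Y.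
  exact: (dderivZ _ _ (su qx)).
have D i := etrans (dderiv_base (v i) seu) (E _).
pose h i := 'D_(v i) G (crd x x).
have e2 : ext_d (pullf proj beta) x v = chart_d (chart1 beta q) Y (h 0) (h 1).
  exact: (ext_d_pull aP aB v sproj fbeta qx).
have e3 : ext_d (fun x v => e * u (proj x) * psi x v) x v =
    e * dderiv (u \o par q) (h 0) Y * psi x (fun=> v 1) -
    e * dderiv (u \o par q) (h 1) Y * psi x (fun=> v 0) + e * u (proj x) * F (h 0) (h 1).
  have := ext_d_scale aP v seup fpsi; rewrite (D 0) (D 1) dpsi; exact: id.
have e1 := ext_d_add aP v f1 f2.
have e4 := etrans e1 (f_equal2 +%R e2 e3).
apply: (etrans e4); rewrite contact_ring.
exact: (esym (model2E (chart_d (chart1 beta q) Y) (fun h => dderiv (u \o par q) h Y)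
  (fun h h' => e * u (proj x) * F h h') (fun i => e * psi x (fun=> v i)) h)).
Qed.

Lemma contact_family_model e v : contact_family e x v =
  model1 (chart1 beta q Y) (u (proj x))
    (fun i => pair_vec (e * psi x (fun=> v i)) ('D_(v i) G (crd x x))).
Proof.
apply: esym; apply: (etrans (model1E _ _ _ _)).
rewrite /contact_family (form1E (pullf proj beta) x v) (pull_chart1 (v 0)) (form1E psi x v).
by congr (_ + _); rewrite mulrA (mulrC (u _)).
Qed.

(** The contact form and its differential at [x] are both model forms composed with the map [L] from
    the tangent space of [P] to $\mathbb R\times\mathbb R^m$, and wedge products commute with
    [L]. *)
Lemma contact_eval e (F : 'rV[R]_m -> 'rV[R]_m -> R) v :
  (forall v, ext_d psi x v = F ('D_(v 0) G (crd x x)) ('D_(v 1) G (crd x x))) ->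
  wedgef (contact_family e) (wedgef_exp (ext_d (contact_family e)) n) x v =
  pwedge (model1 (chart1 beta q Y) (u (proj x)))
    (@pwedge_exp R 2 _ (model2 (chart_d (chart1 beta q) Y) (fun h => dderiv (u \o par q) h Y)
      (fun h h' => e * u (proj x) * F h h')) n)
    (fun i => pair_vec (e * psi x (fun=> v i)) ('D_(v i) G (crd x x))).
Proof.
move=> dpsi.
pose L (w : 'rV[R]_(m + 1)) := pair_vec (e * psi x (fun=> w)) ('D_w G (crd x x)).
rewrite -[LHS]/(pwedge (contact_family e x) (wedgef_exp (ext_d (contact_family e)) n x) v).
rewrite wedgef_expE.
have -> : contact_family e x = (fun w => model1 (chart1 beta q Y) (u (proj x)) (fun i => L (w i))).
  by apply/funext => w; exact: contact_family_model.
set M := model2 _ _ _.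
have -> : ext_d (contact_family e) x = (fun w => M (fun i => L (w i))).
  by apply/funext => w; exact: (ext_d_contact_family e (dpsi w)).
have -> : @pwedge_exp R 2 _ (fun w => M (fun i => L (w i))) n =
    (fun w => @pwedge_exp R 2 _ M n (fun i => L (w i))).
  by apply/funext => w; exact: pwedge_exp_comp.
exact: (pwedge_comp L (model1 (chart1 beta q Y) (u (proj x))) (@pwedge_exp R 2 _ M n) v).
Qed.

Lemma orient_pull (vol : dform m B) w :
  pullf proj vol x w = in_chart vol q Y (fun i => 'D_(w i) G (crd x x)).
Proof.
rewrite /pullf /in_chart /Y (atlas_crdK aB qx); congr (vol _ _); apply/funext => i.
by rewrite /mdiff -(derive_rep_tgt aP aB (w i) sproj xx qx (atlas_dom aB (proj x))).
Qed.

Lemma orient_eval (vol : dform m B) v :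
  wedgef psi (pullf proj vol) x v =
  pwedge fst_form (pr_form (in_chart vol q Y))
    (fun i => pair_vec (psi x (fun=> v i)) ('D_(v i) G (crd x x))).
Proof.
pose L (w : 'rV[R]_(m + 1)) := pair_vec (psi x (fun=> w)) ('D_w G (crd x x)).
have e1 : psi x = (fun w => fst_form (fun i => L (w i))).
  by apply/funext => w; rewrite /fst_form pair_vec_fst form1E.
have e2 : pullf proj vol x = (fun w => pr_form (in_chart vol q Y) (fun i => L (w i))).
  apply/funext => w; rewrite orient_pull /pr_form; congr in_chart.
  by apply/funext => i; rewrite pair_vec_snd.
exact: (etrans (f_equal2 (fun a b => pwedge a b v) e1 e2)
  (pwedge_comp L fst_form (pr_form (in_chart vol q Y)) v)).
Qed.

Transparent dderiv chart_d.
End pulled_back_contact.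

Section values.
Context {R : realType} {n : nat} {B : mfd R (n * 2)}.
Notation m := (n * 2)%N.
Hypothesis aB : is_atlas B.

Lemma chart1_linear (beta : dform 1 B) (q b : B) : chart_dom q b -> form1_at beta b ->
  linear_fun (chart1 beta q (crd q b)).
Proof.
move=> qb [lb _]; have S := nbhs_singleton (chart1_sum aB qb lb).
move=> a v w; rewrite (S (a *: v + w)) (S v) (S w) mulr_sumr -big_split.
by apply: eq_bigr => j _ /=; rewrite !mxE; ring.
Qed.

Lemma chart_d_form_bilinear (beta : dform 1 B) (q b : B) : chart_dom q b ->
  form1_at beta b -> bilinear_fun (chart_d (chart1 beta q) (crd q b)).
Proof.
move=> qb [lb sb]; apply: chart_d_bilinear (sb q qb); exact: chart1_sum.
Qed.

Lemma linear_dderiv (u : B -> R) (q b : B) : chart_dom q b -> mfun_smooth_at u b ->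
  linear_fun (fun h => dderiv (u \o par q) h (crd q b)).
Proof. by move=> qb su a v w; exact: (dderiv_dirP a v w (su q qb)). Qed.

(** The coefficient of the contact volume with respect to the determinant on $\mathbb R\times\mathbb
    R^m$. Its arguments are data of the base at one point, which makes the contact condition uniform
    along a fibre. *)
Definition contact_coef (bt : 'rV[R]_m -> R) (u0 : R) d c F : R :=
  pwedge (model1 bt u0) (@pwedge_exp R 2 _ (model2 d c F) n) (std_frame (N := 1 + m)).

Definition orient_coef (vol : ('I_m -> 'rV[R]_m) -> R) : R :=
  pwedge fst_form (pr_form vol) (std_frame (N := 1 + m)).

Context {P : bundle B}.
Notation proj := (@bproj R m B P).
Hypothesis aP : is_atlas P.
Context {beta : dform 1 B} {u : B -> R} {psi : dform 1 P} {x : P} {q : B}.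
Hypotheses (sproj : msmooth_at proj x) (qx : chart_dom q (proj x))
  (fbeta : form1_at beta (proj x)) (su : mfun_smooth_at u (proj x))
  (fpsi : form1_at psi x).

Let G := crd q \o proj \o par x.
Let Y := crd q (proj x).

Definition split_frame (v : 'I_(1 + m) -> 'rV[R]_(m + 1)) : 'I_(1 + m) -> 'rV[R]_(1 + m) :=
  fun i => pair_vec (psi x (fun=> v i)) ('D_(v i) G (crd x x)).

Lemma contact_value e (F : 'rV[R]_m -> 'rV[R]_m -> R) v : bilinear_fun F ->
  (forall v, ext_d psi x v = F ('D_(v 0) G (crd x x)) ('D_(v 1) G (crd x x))) ->
  wedgef (contact_family (beta := beta) (u := u) (psi := psi) e)
    (wedgef_exp (ext_d (contact_family (beta := beta) (u := u) (psi := psi) e)) n) x v =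
  contact_coef (chart1 beta q Y) (u (proj x)) (chart_d (chart1 beta q) Y)
    (fun h => dderiv (u \o par q) h Y) (fun h h' => e * u (proj x) * F h h') *
  (e * \det (frame_mx (split_frame v))).
Proof.
move=> [Fl Fr] dpsi; rewrite (contact_eval aB aP sproj qx fbeta su fpsi e v dpsi).
have l1 := model1_linear (u (proj x)) (chart1_linear qx fbeta).
have bF : bilinear_fun (fun h h' => e * u (proj x) * F h h').
  split=> [h a k k'|h a k k']; first by rewrite (Fl h); ring.
  by rewrite (Fr h); ring.
have l2 := model2_linear (chart_d_form_bilinear qx fbeta) (linear_dderiv qx su) bF.
rewrite (top_form _ (pwedge_linear l1 (pwedge_exp_linear (n := n) l2)) (pwedge_alternating _ _)).
by rewrite det_pair_vec_scale.
Qed.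

Lemma orient_value (vol : dform m B) v : slot_linear (vol (proj x)) ->
  wedgef psi (pullf proj vol) x v =
  orient_coef (in_chart vol q Y) * \det (frame_mx (split_frame v)).
Proof.
move=> lv; rewrite (orient_eval aB aP sproj qx vol v).
apply: pwedge_vol_det; first exact: fst_form_linear.
  exact: (in_chart_linear aB qx lv).
by rewrite /fst_form mxE !eqxx.
Qed.

End values.

(** * Positivity of the coefficient for the trivial bundle *)

Section trivial_positive.
Context {R : realType} {n : nat} {B : mfd R (n * 2)}.
Notation m := (n * 2)%N.
Notation T := (trivial_bundle B).
Notation S1 := (mcircle R).
Notation one := (circle_one R).
Hypothesis aB : is_atlas B.
Context {vol : dform m B} {alpha : dform 1 T} {u : B -> R}.
Hypotheses (fvol : is_volume_form vol) (calpha : contact_form vol alpha)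
  (ialpha : invariant_form alpha)
  (ualpha : forall x : T, u (bproj x) = alpha x (fun=> dtheta x)).

Let aT : is_atlas T := mprod_atlas aB circ_atlas.
Let falpha : is_form alpha := proj1 calpha.
Let beta : dform 1 B := base_form (alpha := alpha).

(** The contact inequality is available on positive frames only, so one is constructed and the
    inequality read off on it. The product with [orient_coef] compares signs whether or not the
    chart preserves orientation. *)
Lemma triv_coef_pos (b : B) :
  0 < contact_coef (chart1 beta b (crd b b)) (u b) (chart_d (chart1 beta b) (crd b b))
        (fun h => dderiv (u \o par b) h (crd b b)) (fun _ _ => 0) *
      orient_coef (in_chart vol b (crd b b)).
Proof.
pose x : T := (b, one).
pose psi : dform 1 T := pullf (snd : T -> S1) angular_form.
have sproj : msmooth_at (@bproj R m B T) x by exact: (msmooth_at_fst aB circ_atlas).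
have ssnd : msmooth_at (N := S1) (snd : T -> S1) x by exact: (msmooth_at_snd aB circ_atlas).
have bb := atlas_dom aB b.
have fbeta : form1_at beta b by exact: (base_form1_at aB falpha).
have su : mfun_smooth_at u b by exact: (triv_u_smooth aB falpha ualpha).
have fpsi : form1_at psi x.
  by apply: (form1_at_pull aT circ_atlas ssnd); exact: angular_form1_at.
have dpsi (v : 'I_2 -> 'rV[R]_(m + 1)) : ext_d psi x v = 0.
  exact: (ext_d_pull_angular v aT ssnd).
have lvol : slot_linear (vol b) by exact: (form_linear (proj1 fvol)).
have [_ volne] := fvol.
set k := orient_coef _.
have k0 : k != 0.
  rewrite /k (_ : in_chart vol b (crd b b) = vol b); last first.
    by apply/funext => v; exact: (in_chart_self vol b v aB).
  apply/eqP; apply: pwedge_vol_neq0 => //; exact: (form_alternating (proj1 fvol)).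
(* Scaling the vertical vector by [k] gives the frame determinant [k], so its orientation value is
   [k * k > 0] whatever the sign of [k]. *)
pose w : 'I_(1 + m) -> 'rV[R]_(1 + m) :=
  upd (std_frame (N := 1 + m)) (lshift m 0) (k *: std_frame (lshift m 0)).
have detw : \det (frame_mx w) = k.
  rewrite /w (slotZ (@det_slot_linear R (1 + m))) upd_id.
  rewrite (_ : frame_mx _ = 1%:M) ?det1 ?mulr1//.
  by apply/matrixP => i j; rewrite !mxE eqxx /= eq_sym.
(* The inverse of the splitting: [psi] doubles the circle coordinate, whence the division by 2. *)
pose lift_vec (z : 'rV[R]_(1 + m)) : 'rV[R]_(m + 1) :=
  row_mx (rsubmx z) (const_mx (z 0 (lshift m 0) / 2)).
have liftP a y z : lift_vec (a *: y + z) = a *: lift_vec y + lift_vec z.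
  rewrite /lift_vec rsubmxP scale_row_mx add_row_mx; congr row_mx.
  by apply/rowP => j; rewrite !mxE mulrDl mulrA.
pose v i := lift_vec (w i).
have DG z : 'D_z (crd b \o @bproj R m B T \o par x) (crd x x) = lsubmx z.
  exact: (mdiff_fst aB circ_atlas x z).
have psiE z : psi x (fun=> z) = 2 * rsubmx z 0 0.
  by rewrite /psi /pullf /angular_form (mdiff_snd aB circ_atlas x z).
have splitK z : pair_vec (psi x (fun=> lift_vec z))
    ('D_(lift_vec z) (crd b \o @bproj R m B T \o par x) (crd x x)) = z.
  rewrite DG psiE /lift_vec row_mxKl row_mxKr mxE -[RHS]pair_vecK; congr pair_vec.
  by field.
have splitv : split_frame (psi := psi) (x := x) (q := b) v = w.
  by apply/funext => i; exact: splitK.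
have pos : positive_frame vol x v.
  (* Positivity is tested by all connection forms [psi']. By [pwedge_vol_det] only the value 1 of
     [psi'] on the generator counts. *)
  move=> psi' [fpsi' _ psi'1]; have [lpsi' _] := iffLR (is_form1_at aT psi') fpsi'.
  pose a' (z : 'I_1 -> 'rV[R]_(1 + m)) := psi' x (fun=> lift_vec (z 0)).
  have la' : slot_linear a'.
    by move=> z i a y y' put; rewrite /a' /put (ord1 i) eqxx liftP; exact: lpsi'.
  have a'1 : a' (fun=> std_frame (lshift m 0)) = 1.
    rewrite -(psi'1 x) /a'; congr (psi' x _); apply/funext => _.
    rewrite (triv_dtheta aB) /lift_vec; congr row_mx.
      by apply/rowP => j; rewrite !mxE eq_rlshift andbF.
    by apply/rowP => j; rewrite !mxE !eqxx mul1r.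
  have E : wedgef psi' (pullf (@bproj R m B T) vol) x v =
      pwedge a' (pr_form (in_chart vol b (crd b b))) w.
    have e1 : (fun z : 'I_1 -> 'rV[R]_(1 + m) => psi' x (fun i => lift_vec (z i))) = a'.
      by apply/funext => z; rewrite (form1E psi').
    have e2 : (fun z : 'I_m -> 'rV[R]_(1 + m) =>
        pullf (@bproj R m B T) vol x (fun i => lift_vec (z i))) =
        pr_form (in_chart vol b (crd b b)).
      apply/funext => z; rewrite (orient_pull aB aT sproj bb vol) /pr_form.
      congr in_chart; apply/funext => i.
      by rewrite DG /lift_vec row_mxKl.
    exact: (f_equal2 (fun a b => pwedge a b w) e1 e2).
  rewrite E (pwedge_vol_det _ la' (in_chart_linear aB bb lvol) a'1) detw -/(orient_coef _) -/k.
  by rewrite -expr2 exprn_even_gt0.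
(* [psi] is the closed angular form, so the curvature is 0, and [alpha] is the member [e = 1] of its
   contact family. *)
pose Z (_ _ : 'rV[R]_m) : R := 0.
have Z0 : bilinear_fun Z by split=> ? a ? ?; rewrite /Z mulr0 addr0.
have V := contact_value (F := Z) aB aT sproj bb fbeta su fpsi 1 v Z0 dpsi.
have [_ /(_ x v pos)] := calpha.
have Ea : alpha = contact_family (beta := beta) (u := u) (psi := psi) 1.
  apply/funext => y; apply/funext => z; rewrite (form1E alpha).
  rewrite (triv_formE aB falpha ialpha ualpha) /contact_family mul1r.
  by rewrite (form1E (pullf _ beta) y z) (form1E psi y z).
rewrite [X in wedgef X _]Ea [X in ext_d X]Ea V splitv detw !mul1r.
have EZ : (fun _ _ => 0) = (fun h h' : 'rV[R]_m => u b * Z h h').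
  by apply/funext => h; apply/funext => h'; rewrite mulr0.
by rewrite EZ.
Qed.

End trivial_positive.

(** * Curvature of a connection form *)

Section connection_curvature.
Context {R : realType} {m : nat} {B : mfd R m} {P : bundle B}.
Hypotheses (mB : is_manifold B) (pP : is_principal_bundle P).
Notation S1 := (mcircle R).
Notation proj := (@bproj R m B P).
Notation act := (@bact R m B P).
Context {psi : dform 1 P} {U : set B} {g : P -> S1} {sig : B -> P}.
Hypotheses (cpsi : connection_form psi) (ls : local_section U g sig).

Let aB : is_atlas B := manifold_atlas mB.
Let aP : is_atlas P := manifold_atlas (bundle_manifold pP).
Let aC : is_atlas S1 := circ_atlas.
Let aPC : is_atlas (mprod P S1) := mprod_atlas aP aC.

Lemma connection_form1_at x : form1_at psi x.
Proof. by have [_] := iffLR (is_form1_at aP psi) (connection_is_form cpsi). Qed.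

Lemma connection_linear1_at x : linear1_at psi x.
Proof. by have [] := iffLR (is_form1_at aP psi) (connection_is_form cpsi). Qed.

(** The potential $A$ of the connection in the gauge given by the section [sig]. *)
Definition local_potential : dform 1 B := pullf sig psi.

Lemma local_potential_form1_at b : U b -> form1_at local_potential b.
Proof.
move=> Ub; apply: (form1_at_pull aB aP (lsec_sig_smooth ls Ub)).
exact: connection_form1_at.
Qed.

(* Differentiate [x = sig (proj x) * g x]. *)
Lemma connection_local x v : U (proj x) ->
  psi x (fun=> v) =
  pullf proj local_potential x (fun=> v) + pullf g angular_form x (fun=> v).
Proof.
move=> Ux; set b := proj x; set s := sig b.
have sp : msmooth_at proj x by exact: (proj_smooth mB pP).
have ss : msmooth_at sig (proj x) by exact: (lsec_sig_smooth ls Ux).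
have ssp := msmooth_at_comp aP aB aP sp ss.
have sg := lsec_angle_smooth ls Ux.
pose K (y : P) : mprod P S1 := ((sig \o proj) y, g y).
have sK : msmooth_at K x by exact: (@msmooth_at_pair R _ 1 P S1 _ P (sig \o proj) g x aP ssp sg).
pose H (xz : mprod P S1) : P := act xz.1 xz.2.
have sH : msmooth_at H (K x) by exact: (act_smooth pP).
have xE : act s (g x) = x by exact: (lsec_sigE ls Ux).
have vE : v = mdiff (act^~ (g x)) s (mdiff sig b (mdiff proj x v)) +
    (2 * mdiff g x v 0 0) *: dtheta x.
  rewrite -[LHS](mdiff_id x v aP).
  have nE : \forall y \near x, id y = (H \o K) y.
    have := near_lsec mB pP ls Ux; apply: filterS => y Uy.
    by rewrite /H /K /= (lsec_sigE ls Uy).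
  rewrite (mdiff_eq aP v nE) (mdiff_comp v aP aPC aP sK sH).
  have -> : mdiff K x v = row_mx (mdiff (sig \o proj) x v) (mdiff g x v).
    exact: (@mdiff_pair R _ 1 P S1 aP aC _ P (sig \o proj) g x v aP ssp sg).
  rewrite (mdiff_partial _ _ aP aC aP sH) (mdiff_comp v aP aB aP sp ss).
  congr (_ + _); have := mdiff_act_r pP s (g x) (mdiff g x v).
  by rewrite xE.
have l := @connection_linear1_at x.
pose y := mdiff (act^~ (g x)) s (mdiff sig b (mdiff proj x v)).
pose a := 2 * mdiff g x v 0 0.
have e1 : psi x (fun=> y) = pullf proj local_potential x (fun=> v).
  have := congr1 (fun w : dform 1 P => w s (fun=> mdiff sig b (mdiff proj x v)))
    (connection_invariant cpsi (g x)).
  by rewrite /pullf xE.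
have e2 : psi x (fun=> a *: dtheta x + y) = a * 1 + psi x (fun=> y).
  by rewrite l (connection_dtheta cpsi).
rewrite mulr1 e1 in e2; rewrite [RHS]addrC; apply: (etrans _ e2).
by rewrite {1}vE addrC.
Qed.

(** Near [x] the form [psi] is $\pi^*A$ plus a pull-back of the angular form, which is closed. Hence
    the curvature is $dA$, computed in a chart of the base. *)
Lemma connection_curvature x q v : U (proj x) -> chart_dom q (proj x) ->
  ext_d psi x v = chart_d (chart1 local_potential q) (crd q (proj x))
    ('D_(v 0) (crd q \o proj \o par x) (crd x x))
    ('D_(v 1) (crd q \o proj \o par x) (crd x x)).
Proof.
move=> Ux qx; have sp : msmooth_at proj x by exact: (proj_smooth mB pP).
have fA := local_potential_form1_at Ux.
have sg := lsec_angle_smooth ls Ux.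
rewrite (@ext_d_eq _ _ _ aP psi (fun x v => pullf proj local_potential x v +
  pullf g angular_form x v)); last first.
  have := near_lsec mB pP ls Ux; apply: filterS => y Uy w.
  exact: connection_local.
rewrite (ext_d_add aP v (form1_at_pull aP aB sp fA) (local_connection_form pP ls Ux)).
by rewrite (ext_d_pull_angular v aP sg) addr0 (ext_d_pull aP aB v sp fA qx).
Qed.

End connection_curvature.

(** * Dependence of the coefficient on the base point and on [e] *)

Section continuity.
Context {R : realType} {n : nat} {B : mfd R (n * 2)}.
Notation m := (n * 2)%N.
Hypothesis aB : is_atlas B.

(** The frame of $\mathbb R\times\mathbb R^m$ and the chart at [b] are fixed, so the expression is a
    finite polynomial in [e] and smooth functions of the chart coordinate. Positivity at [(b, 0)]
    thereby spreads to nearby base points and small [e]. *)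
Lemma coef_continuous (beta A : dform 1 B) (u : B -> R) (vol : dform m B) (b : B) :
  form1_at beta b -> form1_at A b -> mfun_smooth_at u b -> is_form vol ->
  {for (crd b b, 0 : R), continuous (fun p : 'rV[R]_m * R =>
    contact_coef (chart1 beta b p.1) (u (par b p.1)) (chart_d (chart1 beta b) p.1)
      (fun h => dderiv (u \o par b) h p.1)
      (fun h h' => p.2 * u (par b p.1) * chart_d (chart1 A b) p.1 h h') *
    orient_coef (in_chart vol b p.1))}.
Proof.
move=> [_ sb] [_ sA] su fvol; have bb := atlas_dom aB b.
set x0 : 'rV[R]_m * R := (crd b b, 0).
have Fx : Filter (nbhs x0) by exact: nbhs_filter.
have cM (f g : 'rV[R]_m * R -> R) : {for x0, continuous f} -> {for x0, continuous g} ->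
    {for x0, continuous (fun y => f y * g y)}.
  by move=> cf cg; exact: (@cvgM R _ _ Fx _ _ _ _ cf cg).
have cD (f g : 'rV[R]_m * R -> R) : {for x0, continuous f} -> {for x0, continuous g} ->
    {for x0, continuous (fun y => f y + g y)}.
  by move=> cf cg; exact: (@cvgD R _ _ _ Fx _ _ _ _ cf cg).
have cN (f : 'rV[R]_m * R -> R) : {for x0, continuous f} ->
    {for x0, continuous (fun y => - f y)}.
  by move=> cf; exact: (@cvgN R _ _ _ Fx _ _ cf).
have cc (c : R) : {for x0, continuous (fun=> c : R)} by exact: cst_continuous.
have c1 : {for x0, continuous (fst : 'rV[R]_m * R -> 'rV[R]_m)} by exact: cvg_fst.
have c2 : {for x0, continuous (snd : 'rV[R]_m * R -> R)} by exact: cvg_snd.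
have cf (f : 'rV[R]_m -> R) : smooth_fun_at f (crd b b) ->
    {for x0, continuous (fun p => f p.1)}.
  by move=> /smooth_at_continuous c; exact: (continuous_comp c1 c).
have cd (w : 'rV[R]_m -> 'rV[R]_m -> R) h h' : (forall v, smooth_fun_at (w^~ v) (crd b b)) ->
    {for x0, continuous (fun p => chart_d w p.1 h h')}.
  move=> sw; apply: (cD (fun p => dderiv (w^~ h') h p.1) (fun p => - dderiv (w^~ h) h' p.1)).
    exact: (cf (dderiv (w^~ h') h) (smooth_fun_dderiv h (sw h'))).
  by apply: cN; exact: (cf (dderiv (w^~ h) h') (smooth_fun_dderiv h' (sw h))).
have cu : {for x0, continuous (fun p => u (par b p.1))} := cf _ (su b bb).
apply: (cM _ _); last first.
  apply: (pwedge_continuous (w := fun _ => fst_form)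
    (t := fun p : 'rV[R]_m * R => pr_form (in_chart vol b p.1))) => v; first exact: cc.
  apply: (cf (fun y => in_chart vol b y (fun i => rsubmx (v i)))).
  apply: (smooth_smooth_at (U := chart_tgt b)); last exact: (form_smooth fvol).
    exact: (atlas_tgt_open aB).
  exact: chart_tgt_crd.
apply: (pwedge_continuous
  (w := fun p : 'rV[R]_m * R => model1 (chart1 beta b p.1) (u (par b p.1)))
  (t := fun p : 'rV[R]_m * R => @pwedge_exp R 2 _ (model2 (chart_d (chart1 beta b) p.1)
      (fun h => dderiv (u \o par b) h p.1)
      (fun h h' => p.2 * u (par b p.1) * chart_d (chart1 A b) p.1 h h')) n)) => v.
  exact: (cD _ _ (cf _ (sb b bb (rsubmx (v 0)))) (cM _ _ cu (cc _))).
apply: (pwedge_exp_continuous (w := fun p : 'rV[R]_m * R =>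
  model2 (chart_d (chart1 beta b) p.1) (fun h => dderiv (u \o par b) h p.1)
      (fun h h' => p.2 * u (par b p.1) * chart_d (chart1 A b) p.1 h h'))) => w.
have k1 := cd _ (rsubmx (w 0)) (rsubmx (w 1)) (sb b bb).
have k2 := cf _ (smooth_fun_dderiv (rsubmx (w 0)) (su b bb)).
have k3 := cf _ (smooth_fun_dderiv (rsubmx (w 1)) (su b bb)).
have k4 := cd _ (rsubmx (w 0)) (rsubmx (w 1)) (sA b bb).
exact: (cD _ _ (cD _ _ k1 (cD _ _ (cM _ _ k2 (cc (w 1 0 (lshift m 0))))
  (cN _ (cM _ _ k3 (cc (w 0 0 (lshift m 0))))))) (cM _ _ (cM _ _ c2 cu) k4)).
Qed.

End continuity.

(** [c] is the contact coefficient, [k] the orientation coefficient and [D] the determinant of the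
    frame: [c] and [k] have the same sign, and so do [k] and [D]. *)
Lemma sign_transfer (R : realType) (c k D e : R) :
  0 < c * k -> 0 < k * D -> 0 < e -> 0 < c * (e * D).
Proof.
move=> ck kD e0; have k0 : k != 0 by apply: contraTneq ck => ->; rewrite mulr0 ltxx.
have k2 : 0 < k ^+ 2 by rewrite exprn_even_gt0.
rewrite -(pmulr_lgt0 _ k2) (_ : _ * k ^+ 2 = (c * k) * (k * D) * e); last by ring.
exact: mulr_gt0 (mulr_gt0 ck kD) e0.
Qed.

Lemma linear_ring (R : realType) (a b1 b2 k p1 p2 : R) :
  a * b1 + b2 + k * (a * p1 + p2) = a * (b1 + k * p1) + (b2 + k * p2).
Proof. by ring. Qed.

(** * The contact form on an arbitrary principal bundle *)

Section contact_on_bundle.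
Context {R : realType} {n : nat} {B : mfd R (n * 2)}.
Notation m := (n * 2)%N.
Notation T := (trivial_bundle B).
Context {vol : dform m B} {alpha : dform 1 T} {u : B -> R} {P : bundle B} {psi : dform 1 P}.
Notation proj := (@bproj R m B P).
Hypotheses (mB : is_manifold B) (cB : compact [set: B]) (fvol : is_volume_form vol)
  (calpha : contact_form vol alpha) (ialpha : invariant_form alpha)
  (ualpha : forall x : T, u (bproj x) = alpha x (fun=> dtheta x))
  (pP : is_principal_bundle P) (cpsi : connection_form psi).

Let aB : is_atlas B := manifold_atlas mB.
Let aP : is_atlas P := manifold_atlas (bundle_manifold pP).
Let falpha : is_form alpha := proj1 calpha.
Let beta : dform 1 B := base_form (alpha := alpha).
Let fbeta b : form1_at beta b := base_form1_at aB falpha b.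
Let su b : mfun_smooth_at u b.
Proof. exact: (triv_u_smooth aB falpha ualpha). Qed.

Let alpha_ (e : R) : dform 1 P := contact_family (beta := beta) (u := u) (psi := psi) e.

Definition positive_over (e : R) (b : B) : Prop := forall x : P, proj x = b ->
  forall v, positive_frame vol x v ->
    0 < wedgef (alpha_ e) (wedgef_exp (ext_d (alpha_ e)) n) x v.

(** At [e = 0] the curvature term drops out and the coefficient over [b] is that of the trivial
    bundle, positive relative to the orientation; continuity gives the neighbourhoods. Positivity of
    [e] itself enters through the factor [e] of the determinant. *)
Lemma positive_over_near (b : B) :
  exists Q : set B * set R, [/\ nbhs b Q.1, nbhs (0 : R) Q.2 &
    forall b' e, Q.1 b' -> Q.2 e -> 0 < e -> positive_over e b'].
Proof.
have [U [g [sig [Ub ls]]]] := local_section_exists mB pP b.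
pose A := local_potential (psi := psi) (sig := sig).
have fA b' : U b' -> form1_at A b' by move=> Ub'; exact: (local_potential_form1_at mB pP cpsi ls).
have bb := atlas_dom aB b.
have cc := coef_continuous aB (fbeta b) (fA b Ub) (@su b) (proj1 fvol).
have pos0 := triv_coef_pos aB fvol calpha ialpha ualpha b.
have Z0 : (fun h h' => 0 * u (par b (crd b b)) * chart_d (chart1 A b) (crd b b) h h') =
    (fun _ _ => 0).
  by apply/funext => h; apply/funext => h'; rewrite !mul0r.
have ub : u (par b (crd b b)) = u b by rewrite (atlas_crdK aB bb).
set C := (fun p : 'rV[R]_m * R => _) in cc.
have C0 : 0 < C (crd b b, 0) by rewrite /C /= Z0 ub.
have nC : nbhs (crd b b, 0 : R) [set p | 0 < C p].
  exact: (@cvgr_gt _ _ _ _ _ (C (crd b b, 0)) cc 0 C0).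
case: nC => -[Q1 Q2] [/= nQ1 nQ2] QC.
exists ([set b' | chart_dom b b' /\ U b' /\ Q1 (crd b b')], Q2); split => //=.
  apply: near_and; first exact: near_dom.
  apply: near_and; last exact: (near_crd aB bb nQ1).
  by apply: open_nbhs_nbhs; split => //; exact: (lsec_open ls).
move=> b' e [db' [Ub' Q1b']] Q2e e0 x xb' v pv.
have sp := proj_smooth mB pP x.
have Ux : U (proj x) by rewrite xb'.
have dx : chart_dom b (proj x) by rewrite xb'.
have Q1x : Q1 (crd b (proj x)) by rewrite xb'.
have fpsi := connection_form1_at pP cpsi x.
have := QC (crd b (proj x), e) (conj Q1x Q2e); rewrite /C /= (atlas_crdK aB dx) => Cpos.
have := pv psi cpsi.
have lvol : slot_linear (vol (proj x)) by exact: (form_linear (proj1 fvol)).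
rewrite (orient_value aB aP sp dx v lvol) => Opos.
have bF := chart_d_form_bilinear aB dx (fA _ Ux).
have dpsi w := connection_curvature mB pP cpsi ls w Ux dx.
rewrite /alpha_ (contact_value aB aP sp dx (fbeta _) (@su _) fpsi e v bF dpsi).
exact: (sign_transfer Cpos Opos e0).
Qed.

Lemma exists_contact_family : exists2 e : R, 0 < e & forall b, positive_over e b.
Proof.
have FF : Filter (at_right (0 : R)) by exact: at_right_proper_filter.
(* The right-hand neighbourhoods of 0 make [e] small and positive at once, and compactness of [B]
   gives one [e] for all base points. *)
have H : (at_right (0 : R)) [set e | [set: B] `<=` positive_over e].
  apply: (iffLR (compact_near_coveringP _) cB R (at_right 0) positive_over FF) => b _.
  have [[Q1 Q2] [/= nQ1 nQ2 Q]] := positive_over_near b.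
  exists (Q1, [set e | 0 < e /\ Q2 e]) => /=.
    split => //; apply: filterI; first exact: nbhs_right_gt.
    exact: (cvg_at_right_filter (@cvg_id _ (nbhs (0 : R)))).
  by move=> [b' e] [/= Q1b' [e0 Q2e]]; exact: Q.
have H2 : (at_right (0 : R)) [set e | 0 < e /\ ([set: B] `<=` positive_over e)].
  by apply: filterI H; exact: nbhs_right_gt.
have [e [e0 He]] := filter_ex H2.
by exists e => // b; exact: He.
Qed.

Lemma contact_family_is_form e : is_form (alpha_ e).
Proof.
apply/(is_form1_at aP); split=> x.
  move=> a v w; rewrite /alpha_ /contact_family.
  have lb := linear1_pull aP aB (proj_smooth mB pP x)
    (base_linear1_at aB falpha (proj x)) a v w.
  have lp := connection_linear1_at pP cpsi x a v w.
  exact: (etrans (f_equal2 (fun s t => s + e * u (proj x) * t) lb lp) (linear_ring _ _ _ _ _ _)).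
have sp := proj_smooth mB pP x.
have seu : mfun_smooth_at (fun b => e * u b) (proj x).
  by move=> p px; apply: (smooth_atM _ (su px)); exact: smooth_at_cst.
exact: (form1_at_add (form1_at_pull aP aB sp (fbeta _))
  (form1_at_scale (mfun_smooth_at_comp aP aB sp seu) (connection_form1_at pP cpsi x))).
Qed.

Lemma contact_family_invariant e : invariant_form (alpha_ e).
Proof.
move=> z; apply/funext => x; apply/funext => v.
pose zv i := mdiff (fun y : P => bact y z) x (v i).
have e0 : proj (bact x z) = proj x by exact: (bundle_proj_act pP).
have e1 : pullf proj beta (bact x z) zv = pullf proj beta x v.
  rewrite /pullf; have -> : (fun i => mdiff proj (bact x z) (zv i)) =
      (fun i => mdiff proj x (v i)).
    by apply/funext => i; exact: (mdiff_proj_act mB pP).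
  by rewrite e0.
have e2 : psi (bact x z) zv = psi x v.
  exact: (congr1 (fun w : dform 1 P => w x v) (connection_invariant cpsi z)).
exact: (f_equal2 +%R e1 (f_equal2 *%R (congr1 (fun b => e * u b) e0) e2)).
Qed.

Lemma contact_family_dtheta e x : alpha_ e x (fun=> dtheta x) = e * u (proj x).
Proof.
have e1 : pullf proj beta x (fun=> dtheta x) = 0.
  rewrite /pullf (mdiff_proj_dtheta mB pP).
  exact: linear1_0 (base_linear1_at aB falpha (proj x)).
have e2 : e * u (proj x) * psi x (fun=> dtheta x) = e * u (proj x).
  by rewrite (connection_dtheta cpsi) mulr1.
exact: (etrans (f_equal2 +%R e1 e2) (add0r _)).
Qed.

End contact_on_bundle.

(** Invariance of [alpha] puts the image of the kernel inside the kernel at [bact x z]. Every vector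
    there is reached because the differential of the action of [circ_inv z] is a right inverse that
    also preserves kernels. *)
Lemma invariant_ker_form (R : realType) m (B : mfd R m) (P : bundle B) (alpha : dform 1 P) :
  is_principal_bundle P -> invariant_form alpha -> invariant_distribution (ker_form alpha).
Proof.
move=> pP ia z x; have aP := manifold_atlas (bundle_manifold pP).
have E (w : circle R) y v :
    alpha (bact y w) (fun=> mdiff (fun x' : P => bact x' w) y v) = alpha y (fun=> v).
  exact: (congr1 (fun f : dform 1 P => f y (fun=> v)) (ia w)).
have xzK : bact (bact x z) (circ_inv z) = x.
  by rewrite (bundle_actM pP) circ_mulC circ_mulV (bundle_act1 pP).
apply/seteqP; split=> [_ [v vx <-]|v vx]; first by rewrite /ker_form /= E.
have sz := act_l_smooth pP z; have si := act_l_smooth pP (circ_inv z).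
exists (mdiff (fun x' : P => bact x' (circ_inv z)) (bact x z) v).
  by have := E (circ_inv z) (bact x z) v; rewrite xzK /ker_form /= => ->.
have sx : msmooth_at (fun x' : P => bact x' z) (bact (bact x z) (circ_inv z)) by exact: sz.
have := mdiff_comp v aP aP aP (si (bact x z)) sx; rewrite xzK => <-.
rewrite -[RHS](mdiff_id (bact x z) v aP); apply: (mdiff_eq aP); apply: near_all => y.
by rewrite /= (bundle_actM pP) circ_mulV (bundle_act1 pP).
Qed.

Theorem corollary5p1 (R : realType) (n : nat) (B : mfd R (n * 2)%N)
    (volB : dform (n * 2)%N B) (Gamma : set B) :
  is_manifold B -> compact [set: B] -> is_volume_form volB ->
  admits_contact_with_dividing_set volB (trivial_bundle B) Gamma ->
  forall P : bundle B, is_principal_bundle P ->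
    admits_contact_with_dividing_set volB P Gamma.
Proof.
move=> mB cB fvol [xi [_ _ [alpha [u [calpha ialpha _ ualpha GammaE]]]]] P pP.
have [psi cpsi] := connection_exists mB pP cB.
have [e e0 pos] := exists_contact_family mB cB fvol calpha ialpha ualpha pP cpsi.
have cf := contact_family_is_form mB calpha ualpha pP cpsi e.
have invf := contact_family_invariant mB (alpha := alpha) (u := u) pP cpsi e.
set a := contact_family _ in cf invf.
have ca : contact_form volB a.
  by split=> // x v pv; exact: (pos (bproj x) x erefl v pv).
exists (ker_form a); split; first by exists a.
  exact: invariant_ker_form.
exists a, (fun b => e * u b); split=> //.
  by move=> x; exact: (esym (contact_family_dtheta mB calpha pP cpsi e x)).
(* The new function is [e * u], which has the zeros of [u] because [e] is positive. *)
rewrite GammaE; apply/seteqP; split=> b /= => [->|/eqP]; first by rewrite mulr0.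
by rewrite mulf_eq0 gt_eqF//= => /eqP.
Qed.
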